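(* Let $d \ge 1$, let $f$ be a probability density function on $\mathbb{R}^d$ (with respect to Lebesgue measure), and let $X_1, X_2, \dots$ be independent and identically distributed $\mathbb{R}^d$-valued random vectors with density $f$. If the support of $f$ is bounded and $$\int f(x)\ln (f(x)+1)\,dx<\infty,$$ then the Kozachenko--Leonenko nearest neighbor entropy estimate $H_n$ based on $X_1,\dots,X_n$ satisfies $$\lim_{n\rightarrow \infty }H_n=H(f)\quad\text{almost surely.}$$
   Context: The differential entropy of a density $f$ on $\mathbb{R}^d$ is $H(f) = - \int f(x) \ln f(x)\, dx$ (with $0\ln 0=0$), when this integral exists. For $n\ge 2$ and $1\le i\le n$, let $R_{n,i}(x)=\min_{j\ne i,\, j\le n}\|x-X_j\|$ for $x\in\mathbb{R}^d$, where $\|\cdot\|$ is the Euclidean norm. The Kozachenko--Leonenko nearest neighbor entropy estimate is $$H_n=\frac 1n \sum_{i=1}^{n}\ln \big((n-1)R_{n,i}(X_i)^d v_d\big)+ C_E,$$ where $v_d$ is the volume (Lebesgue measure) of the unit ball in $\mathbb{R}^d$ and $C_E=-\int_0^{\infty} e^{-t}\ln t\,dt$ is the Euler--Mascheroni constant ($0.5772\ldots$). Since $X_1,\dots,X_n$ are almost surely distinct, $H_n$ is almost surely a well-defined real number. *)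

(* Defs.v *)
(* A vector of R^d is a [d.-tuple R]: its sigma-algebra is
   the product one, generated by the coordinates, which is the Borel
   sigma-algebra of R^d. *)
From HB Require Import structures.
From mathcomp Require Import all_boot all_order all_algebra finmap.
From mathcomp Require Import all_classical all_reals all_analysis.

Set Implicit Arguments.
Unset Strict Implicit.
Unset Printing Implicit Defensive.

Import Order.TTheory GRing.Theory Num.Theory.
Import numFieldNormedType.Exports.

Local Open Scope classical_set_scope.
Local Open Scope ring_scope.

Section cons_measure.
Context (R : realType) (n : nat).
Variable m1 : {sigma_finite_measure set (measurableTypeR R) -> \bar R}.
Variable m2 : {sigma_finite_measure set (n.-tuple (measurableTypeR R)) -> \bar R}.

Definition cons_pair (p : measurableTypeR R * n.-tuple (measurableTypeR R)) :
  n.+1.-tuple (measurableTypeR R) := [tuple of p.1 :: p.2].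

Lemma measurable_cons_pair : measurable_fun [set: _] cons_pair.
Proof. exact: (measurable_cons measurable_fst measurable_snd). Qed.

Definition cons_measure : set (n.+1.-tuple (measurableTypeR R)) -> \bar R :=
  pushforward (m1 \x m2)%E cons_pair.

Let cm0 : cons_measure set0 = 0%E.
Proof. by rewrite /cons_measure /pushforward preimage_set0 measure0. Qed.

Let cm_ge0 A : (0 <= cons_measure A)%E.
Proof. by apply: (measure_ge0 (m1 \x m2)%E). Qed.

Let cm_sigma_additive : semi_sigma_additive cons_measure.
Proof.
move=> F mF tF mUF; rewrite /cons_measure /pushforward preimage_bigcup.
have mp X : measurable X -> measurable (cons_pair @^-1` X).
  by move=> mX; rewrite -[X in measurable X]setTI; exact: measurable_cons_pair.
apply: measure_semi_sigma_additive.
- by move=> i; exact: mp.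
- apply/trivIsetP => /= i j _ _ ij; rewrite -preimage_setI.
  by move/trivIsetP : tF => /(_ _ _ _ _ ij) ->//; rewrite preimage_set0.
- by rewrite -preimage_bigcup; exact: mp.
Qed.

HB.instance Definition _ := isMeasure.Build _ _ _ cons_measure
  cm0 cm_ge0 cm_sigma_additive.

Let cm_sigma_finite : sigma_finite setT cons_measure.
Proof.
have /sigma_finiteP[F [TF ndF Foo]] := sigma_finiteT m1.
have /sigma_finiteP[G [TG ndG Goo]] := sigma_finiteT m2.
pose h (x : n.+1.-tuple (measurableTypeR R)) := (thead x, [tuple of behead x]).
have mh : measurable_fun setT h.
  apply/measurable_fun_pairP; split.
    exact: (@measurable_tnth _ (measurableTypeR R) n.+1 ord0).
  exact: measurable_behead.
have hK : cancel cons_pair h.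
  by move=> [a x]; rewrite /h /cons_pair /= theadE; congr pair; apply/val_inj.
exists (fun i => h @^-1` (F i `*` G i)).
  rewrite -preimage_bigcup (_ : \bigcup_i (F i `*` G i) = setT).
    by rewrite preimage_setT.
  apply/seteqP; split=> [//|[a x] _].
  have [k _ Fa] : (\bigcup_k F k) a by rewrite -TF.
  have [l _ Gx] : (\bigcup_k G k) x by rewrite -TG.
  exists (maxn k l) => //; split.
    by move: a Fa; exact/subsetPset/ndF/leq_maxl.
  by move: x Gx; exact/subsetPset/ndG/leq_maxr.
move=> i; have [mFi Fi] := Foo i; have [mGi Gi] := Goo i; split.
  by rewrite -[X in measurable X]setTI; apply: mh => //; exact: measurableX.
rewrite /cons_measure /pushforward -comp_preimage.
rewrite (_ : h \o cons_pair = id); last by apply/funext => p /=; rewrite hK.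
rewrite preimage_id product_measure1E//.
by rewrite lte_mul_pinfty// ge0_fin_numE.
Qed.

HB.instance Definition _ := Measure_isSigmaFinite.Build _ _ _ cons_measure
  cm_sigma_finite.

End cons_measure.

(* Lebesgue measure on R^n, as the n-fold product of the one on R; n = 0 gives
   the unit mass on the empty tuple. *)
Fixpoint lebesgue_tuple (R : realType) (n : nat) :
    {sigma_finite_measure set (n.-tuple (measurableTypeR R)) -> \bar R} :=
  if n is m.+1 then cons_measure lebesgue_measure (lebesgue_tuple R m)
  else \d_[tuple].

Lemma lebesgue_tuple_box (R : realType) (n : nat)
    (A : 'I_n -> set (measurableTypeR R)) :
  (forall i, measurable (A i)) ->
  lebesgue_tuple R n [set x | forall i, A i (tnth x i)] =
    (\prod_(i < n) lebesgue_measure (A i))%E.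
Proof.
elim: n A => [|n IH] A mA.
  by rewrite big_ord0 /= diracE mem_set// => -[].
have mB : measurable [set x : n.-tuple (measurableTypeR R) |
    forall i, A (lift ord0 i) (tnth x i)].
  rewrite (_ : mkset _ = \big[setI/setT]_(i < n)
      ((fun x : n.-tuple (measurableTypeR R) => tnth x i) @^-1` A (lift ord0 i))).
    apply: bigsetI_measurable => i _; rewrite -[X in measurable X]setTI.
    exact: measurable_tnth.
  apply/seteqP; split => x /=.
    by move=> Ax; rewrite -bigcap_seq => i /= _; exact: Ax.
  by rewrite -bigcap_seq => Ax i; apply: (Ax i); rewrite /= mem_index_enum.
rewrite big_ord_recl -IH => [|i]; last exact: mA.
rewrite -product_measure1E//= /cons_measure /pushforward.
congr ((_ \x _)%E _); apply/seteqP; split => -[a x] /= Ax.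
  split; first by have := Ax ord0; rewrite /cons_pair /= tnth0.
  by move=> i; have := Ax (lift ord0 i); rewrite tnthS.
case: Ax => Aa Ax i; case: (unliftP ord0 i) => [j|] ->; last by rewrite tnth0.
by rewrite tnthS.
Qed.

Section euclidean.
Context (R : realType) (d : nat).
Implicit Types x y : d.-tuple R.

Definition euclid_dist x y : R := Num.sqrt (\sum_(i < d) (tnth x i - tnth y i) ^+ 2).

Definition evec0 : d.-tuple R := [tuple 0 | i < d].

Definition eball x (r : R) : set (d.-tuple R) := [set y | euclid_dist x y <= r].

Definition ebounded (A : set (d.-tuple R)) : Prop :=
  exists M : R, A `<=` eball evec0 M.

Definition unit_ball_volume : R := fine (lebesgue_tuple R d (eball evec0 1)).

End euclidean.

Section densities.
Context (R : realType) (d : nat).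
Implicit Type f : d.-tuple R -> R.

Definition is_density f : Prop :=
  [/\ measurable_fun [set: d.-tuple R] f, forall x, 0 <= f x &
    (\int[lebesgue_tuple R d]_x (f x)%:E)%E = 1%E].

(* Topological support of the law with density f.  It does not change when f is
   modified on a null set, and it is contained in the closure of
   [set x | f x != 0]. *)
Definition density_support f : set (d.-tuple R) :=
  [set x | forall r : R, 0 < r ->
    (0 < \int[lebesgue_tuple R d]_(y in eball x r) (f y)%:E)%E].

(* Since ln 0 = 0 in the library, the integrand is 0 where f vanishes. *)
Definition diff_entropy f : \bar R :=
  (- \int[lebesgue_tuple R d]_x (f x * ln (f x))%:E)%E.

Definition has_density dT (T : measurableType dT) (P : probability T R)
    (Y : {RV P >-> d.-tuple R}) f : Prop :=
  forall A : set (d.-tuple R), measurable A ->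
    distribution P Y A = (\int[lebesgue_tuple R d]_(x in A) (f x)%:E)%E.

End densities.

Definition mutually_independent (R : realType) dT (T : measurableType dT)
    (P : probability T R) dS (S : measurableType dS)
    (X : nat -> {RV P >-> S}) : Prop :=
  forall (J : {fset nat}) (A : nat -> set S), (forall i, measurable (A i)) ->
    P (\bigcap_(i in [set` J]) (X i @^-1` A i)) =
      (\prod_(i <- J) P (X i @^-1` A i))%E.

Section kozachenko_leonenko.
Context (R : realType) (d : nat).

(* In this section the sample X_1, ..., X_n is x 0, ..., x n.-1. *)
Implicit Type x : nat -> d.-tuple R.

(* [+oo] is the neutral element of [mine]; it is the value only when the index
   set is empty, that is for n = 1. *)
Definition nn_dist x (n : nat) (i : 'I_n) (y : d.-tuple R) : R :=
  fine (\big[mine/+oo%E]_(j < n | j != i) (euclid_dist y (x j))%:E).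

Definition C_E : R :=
  - \int[lebesgue_measure]_(t in `]0, +oo[) (expR (- t) * ln t).

Definition KL_estimate x (n : nat) : R :=
  n%:R^-1 * \sum_(i < n) ln ((n%:R - 1) * nn_dist x i (x i) ^+ d *
                              unit_ball_volume R d)
  + C_E.

End kozachenko_leonenko.

(* Main.v *)
From HB Require Import structures.
Require Import Defs.
From mathcomp Require Import all_boot all_order all_algebra.
From mathcomp Require Import all_classical all_reals all_analysis.
From mathcomp Require Import measurable_realfun finmap zify ring lra.

Set Implicit Arguments.
Unset Strict Implicit.
Unset Printing Implicit Defensive.

Import Order.TTheory GRing.Theory Num.Theory.
Import numFieldNormedType.Exports.

Local Open Scope classical_set_scope.
Local Open Scope ring_scope.

(** Let [m = n - 1], let [R_i] be the distance from [X_i] to its nearest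
    neighbour, [v] the volume of the unit ball and [Y_i = ln (m * R_i ^ d * v)],
    so that the estimate is the average of the [Y_i] plus [C_E]. Given
    [X_i = x], the event [Y_i > s] says that the other [m] points avoid the ball
    [B] around [x] with [m * volume B = e ^ s]; its probability is
    [(1 - mu B) ^ m], where [mu] is the law of the sample. At a Lebesgue point
    [m * mu B] is close to [e ^ s * f x], and the limit [exp (- e ^ s * f x)] is
    the survival function of [ln t - ln (f x)] for a standard exponential [t].
    The mean of that variable is [- C_E - ln (f x)], and its integral against
    [mu] is [- C_E] plus the entropy.

    The passage to the limit rests on a truncation of the [Y_i] at a level [L]
    of order [n ^ (1/4)], and on three facts.

    - The excesses beyond the truncation are negligible. For the upper ones,
      the balls of radius [R_i / 3] are disjoint and stay in a bounded region,
      so the sum of the [R_i ^ d] is bounded ([sum_nn_volume_le]), while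
      [ln z - L <= z * e ^ (- L)]. For the lower ones, a union bound gives
      probability at most [e ^ (- s / 2)] to [Y_i <= - s] with
      [f (X_i) <= e ^ (s / 2)] ([log_volume_lower_tail]); by the Borel-Cantelli
      lemma the lower excess of [Y_i] is finally dominated by the excess of
      [2 * ln (f (X_i)) + 1], and the averages of these vanish because
      [f * ln (f + 1)] is integrable ([ae_excess_average], a consequence of the
      maximal ergodic inequality).

    - The average of the truncated terms is close to its mean. If one point
      moves, the nearest neighbour distance of another point changes only when
      the moved point is or becomes its unique nearest neighbour, and this
      happens to a number of points bounded in terms of [d]
      ([card_strict_neighbours]). The truncated sum has therefore bounded
      differences, and McDiarmid's exponential moments make its large
      deviations summable ([ae_concentration]).

    - The truncated means converge. They are differences of two integrals of
      tail probabilities ([mean_clip]), to which dominated convergence applies.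
      The pointwise limit [survival_cvg] follows from the convergence in mean
      of ball averages of an integrable function
      ([averages_converge_integrable]), proved first for boxes, then by a
      lambda-system argument and by density of the simple functions. The packing
      bound and the union bound provide the domination ([survival_upper],
      [survival_lower]), and Tonelli's theorem identifies the limit
      ([log_density_mean]). *)

(** * Boxes and measures on tuples *)

Definition box T n (A : 'I_n -> set T) : set (n.-tuple T) :=
  [set x | forall i, A i (tnth x i)].

Lemma preimage_measurable d d' (T : measurableType d) (T' : measurableType d')
    (g : T -> T') (A : set T') :
  measurable_fun setT g -> measurable A -> measurable (g @^-1` A).
Proof. by move=> mg mA; rewrite -[X in measurable X]setTI; exact: mg. Qed.

Section level_sets.
Context d (T : measurableType d) (R : realType).
Variables (g : T -> R) (r : R).
Hypothesis mg : measurable_fun setT g.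

Let ray (A : set (measurableTypeR R)) : measurable A -> measurable (g @^-1` A).
Proof. exact: preimage_measurable. Qed.

Lemma measurable_gt_set : measurable [set t | r < g t].
Proof.
have := ray (measurable_itv `]r, +oo[); congr measurable.
by apply/seteqP; split => t /=; rewrite in_itv/= andbT.
Qed.

Lemma measurable_ge_set : measurable [set t | r <= g t].
Proof.
have := ray (measurable_itv `[r, +oo[); congr measurable.
by apply/seteqP; split => t /=; rewrite in_itv/= andbT.
Qed.

Lemma measurable_le_set : measurable [set t | g t <= r].
Proof. exact: ray (measurable_itv `]-oo, r]). Qed.

End level_sets.

Section boxes.
Context d (S : measurableType d) (n : nat).
Implicit Types A B : 'I_n -> set S.

Lemma box_bigcap A :
  box A = \big[setI/setT]_(i < n) ((fun x : n.-tuple S => tnth x i) @^-1` A i).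
Proof.
apply/seteqP; split => x /=.
  by move=> Ax; rewrite -bigcap_seq => i /= _; exact: Ax.
by rewrite -bigcap_seq => Ax i; apply: (Ax i); rewrite /= mem_index_enum.
Qed.

Lemma measurable_box A : (forall i, measurable (A i)) -> measurable (box A).
Proof.
move=> mA; rewrite box_bigcap; apply: bigsetI_measurable => i _.
by apply: preimage_measurable => //; exact: measurable_tnth.
Qed.

Lemma boxI A B : box A `&` box B = box (fun i => A i `&` B i).
Proof.
apply/seteqP; split => [x [xA xB] i|x xAB]; first by split; [exact: xA|exact: xB].
by split=> i; have [] := xAB i.
Qed.

(** A generator of the sigma-algebra of [S] gives boxes that generate the one
    of the tuples, as soon as it contains the full set: a cylinder over one
    coordinate is then a box. *)
Lemma measurable_tuple_boxes (G : set (set S)) : G setT ->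
  measurable = <<s G >> ->
  measurable = <<s [set box A | A in [set A : 'I_n -> set S | forall i, G (A i)]] >>
    :> set (set (n.-tuple S)).
Proof.
move=> GT mG; set H := (X in <<s X >>).
have Gm X : G X -> measurable X by rewrite mG; exact: sub_sigma_algebra.
apply/seteqP; split; last first.
  apply: smallest_sub; first exact: sigma_algebra_measurable.
  by move=> _ [A GA <-]; apply: measurable_box => i; exact/Gm/GA.
apply: smallest_sub; first exact: smallest_sigma_algebra.
move=> X; rewrite -bigcup_seq /= => -[i _ [B mB <-]]; rewrite setTI.
pose HT := g_sigma_algebraType H.
suff mi : measurable_fun [set: HT] ((fun x : n.-tuple S => tnth x i) : HT -> S).
  by have := preimage_measurable mi mB.
apply: (measurability G) => // _ [C GC <-]; rewrite setTI.
apply: sub_sigma_algebra; exists (fun j => if j == i then C else setT).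
  by move=> j /=; case: ifP.
apply/seteqP; split => x /=; first by move/(_ i); rewrite eqxx.
by move=> xC j; case: eqVneq => // ->.
Qed.

(** Boxes with measurable sides are stable under intersection and generate the
    sigma-algebra; the powers of the sets [F k] exhaust the space by boxes of
    finite measure. *)
Lemma tuple_measure_unique (R : realType) (m1 m2 : {measure set (n.-tuple S) -> \bar R})
    (F : (set S)^nat) :
  (forall k, measurable (F k)) -> nondecreasing_seq F -> \bigcup_k F k = setT ->
  (forall k, (m1 (box (fun=> F k)) < +oo)%E) ->
  (forall A, (forall i, measurable (A i)) -> m1 (box A) = m2 (box A)) ->
  forall X, measurable X -> m1 X = m2 X.
Proof.
move=> mF ndF UF F1 m12 X mX.
pose G := [set box A | A in [set A : 'I_n -> set S | forall i, measurable (A i)]].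
apply: (measure_unique G (fun k => box (fun=> F k))) => //.
- by apply: (@measurable_tuple_boxes measurable) => //; rewrite sigma_algebra_id//;
    exact: sigma_algebra_measurable.
- move=> _ _ [A mA <-] [B mB <-]; rewrite boxI; exists (fun i => A i `&` B i) => //.
  by move=> i; apply: measurableI.
- by move=> k; exists (fun=> F k).
- apply/seteqP; split => // x _.
  have /choice[k Fk] i : exists k, F k (tnth x i).
    by have : (\bigcup_k F k) (tnth x i) by [rewrite UF]; case=> k _; exists k.
  exists (\max_i k i)%N => // i.
  have /subsetPset := ndF _ _ (@leq_bigmax _ k i).
  by apply; exact: Fk.
- by move=> _ [A mA <-]; exact: m12.
Qed.

End boxes.

Lemma measure_mono d (T : measurableType d) (R : realType)
    (m : {measure set T -> \bar R}) (A B : set T) :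
  measurable A -> measurable B -> A `<=` B -> (m A <= m B)%E.
Proof. by move=> mA mB AB; apply: le_measure => //; apply: mem_set. Qed.

(** * Lebesgue measure under affine maps *)

Definition image_measure d d' (T : measurableType d) (T' : measurableType d')
    (R : realType) (m : {measure set T -> \bar R}) (g : T -> T')
    (mg : measurable_fun setT g) : {measure set T' -> \bar R} :=
  @measure_function_pushforward__canonical__measure_function_Measure
    _ _ _ _ _ m g mg.

Section affine_change.
Context (R : realType).
Local Notation leb := (@lebesgue_measure R).

Lemma lebesgue_measure_affine (c b : R) (A : set R) : 0 < c -> measurable A ->
  (c%:E * leb ((fun y => c * y + b)%R @^-1` A) = leb A)%E.
Proof.
move=> c0 mA.
have mg : measurable_fun [set: measurableTypeR R]
    (fun y : measurableTypeR R => c * y + b : measurableTypeR R).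
  by apply: measurable_funD => //; exact: mulrl_measurable.
have c0' : 0 <= c by exact: ltW.
suff /(_ _ mA) -> : forall X, measurable X ->
    leb X = mscale (NngNum c0') (image_measure leb mg) X by [].
apply: lebesgue_measure_unique => _ [[x1 x2] _ <-].
change (leb `]x1, x2]%classic =
  (c%:E * leb ((fun y => c * y + b)%R @^-1` `]x1, x2]%classic))%E).
rewrite (_ : _ @^-1` _ = `](x1 - b) / c, (x2 - b) / c]%classic); last first.
  by apply/seteqP; split => z /=; rewrite !in_itv/= ltr_pdivrMr// ler_pdivlMr//
    ltrBlDr lerBrDr (mulrC z).
rewrite !lebesgue_measure_itv/= !lte_fin ltr_pM2r ?invr_gt0// ltrD2r.
case: ifP => _; last by rewrite mule0.
rewrite !EFinN -!EFinB -EFinM; congr EFin.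
by field; rewrite gt_eqF.
Qed.

Definition affine_tuple n (c : R) (b y : n.-tuple R) : n.-tuple R :=
  [tuple c * tnth y i + tnth b i | i < n].

Lemma measurable_affine_tuple n c b :
  measurable_fun [set: n.-tuple (measurableTypeR R)]
    (affine_tuple c b : n.-tuple (measurableTypeR R) -> n.-tuple (measurableTypeR R)).
Proof.
apply/measurable_fun_tnthP => i.
rewrite (_ : _ \o _ = (fun x => c * tnth x i + tnth b i)); last first.
  by apply/funext => x /=; rewrite tnth_mktuple.
apply: measurable_funD => //.
exact: (measurableT_comp (mulrl_measurable _) (measurable_tnth i)).
Qed.

Lemma lebesgue_box n (A : 'I_n -> set (measurableTypeR R)) :
  (forall i, measurable (A i)) ->
  lebesgue_tuple R n (box A) = (\prod_(i < n) leb (A i))%E.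
Proof. exact: lebesgue_tuple_box. Qed.

(** Both sides are measures in [A]; on a box the equality is that of
    [lebesgue_measure_affine] in each coordinate. *)
Lemma lebesgue_tuple_affine n (c : R) (b : n.-tuple R) (A : set (n.-tuple R)) :
  0 < c -> measurable A ->
  ((c ^+ n)%:E * lebesgue_tuple R n (affine_tuple c b @^-1` A)
    = lebesgue_tuple R n A)%E.
Proof.
move=> c0 mA.
have cn0 : 0 <= c ^+ n by exact/ltW/exprn_gt0.
pose m2 := mscale (NngNum cn0)
  (image_measure (lebesgue_tuple R n) (measurable_affine_tuple c b)).
suff /(_ _ mA) -> : forall X, measurable X -> lebesgue_tuple R n X = m2 X by [].
pose F k : set (measurableTypeR R) := `[- k%:R, k%:R]%classic.
have mF k : measurable (F k) by exact: measurable_itv.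
apply: (tuple_measure_unique (F := F)) => //.
- move=> k l kl; apply/subsetPset => x; rewrite /F /= !in_itv/= => /andP[kx xk].
  by rewrite (le_trans _ kx) ?lerN2 ?ler_nat// (le_trans xk) ?ler_nat.
- apply/seteqP; split => // x _; exists (Num.truncn `|x|).+1 => //.
  by rewrite /F /= in_itv/= -ler_norml ltW// truncnS_gt.
- move=> k; have : (\prod_(i < n) leb (F k) < +oo)%E; last first.
    by apply: le_lt_trans; rewrite le_eqVlt; apply/orP; left; apply/eqP/lebesgue_box.
  rewrite ltey_eq prode_fin_num// => i _.
  by rewrite lebesgue_measure_itv/=; case: ifP.
- move=> B mB; change (lebesgue_tuple R n (box B) =
    ((c ^+ n)%:E * lebesgue_tuple R n (affine_tuple c b @^-1` box B))%E).
  rewrite (_ : _ @^-1` _ =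
      box (fun i => (fun y : measurableTypeR R => c * y + tnth b i) @^-1` B i)).
    have mcB i : measurable ((fun y : measurableTypeR R => c * y + tnth b i) @^-1` B i).
      apply: preimage_measurable; last exact: mB.
      by apply: measurable_funD => //; exact: mulrl_measurable.
    transitivity (\prod_(i < n) leb (B i))%E; first exact: lebesgue_box.
    transitivity ((c ^+ n)%:E *
        \prod_(i < n) leb ((fun y : R => c * y + tnth b i)%R @^-1` B i))%E; last first.
      by congr (_ * _)%E; symmetry; apply: lebesgue_box.
    have -> : c ^+ n = \prod_(i < n) c by rewrite prodr_const card_ord.
    rewrite -prodEFin -big_split/=.
    by apply: eq_bigr => i _; rewrite (lebesgue_measure_affine _ c0 (mB i)).
  apply/seteqP; split => x /= xB i; have := xB i; rewrite /= /affine_tuple;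
    by rewrite tnth_mktuple.
Qed.

End affine_change.

(** * Euclidean geometry *)

Section euclidean_geometry.
Context (R : realType) (d : nat).
Implicit Types x y z : d.-tuple R.

(** Expand the nonnegative sum of the [(B * a i - C * b i) ^+ 2]. *)
Lemma cauchy_schwarz (a b : 'I_d -> R) :
  (\sum_i a i * b i) ^+ 2 <= (\sum_i a i ^+ 2) * (\sum_i b i ^+ 2).
Proof.
set A := \sum_i a i ^+ 2; set B := \sum_i b i ^+ 2; set C := \sum_i a i * b i.
have B0 : 0 <= B by apply: sumr_ge0 => i _; exact: sqr_ge0.
have [B1|B1] := eqVneq B 0.
  have b0 i : b i = 0.
    have /eqP := B1; rewrite psumr_eq0 => [/allP/(_ i)|j _]; last exact: sqr_ge0.
    by rewrite mem_index_enum sqrf_eq0 => /(_ isT)/eqP.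
  by rewrite B1 mulr0 /C big1 ?expr0n// => i _; rewrite b0 mulr0.
have : 0 <= \sum_i (B * a i - C * b i) ^+ 2 by apply: sumr_ge0 => i _; exact: sqr_ge0.
have -> : \sum_i (B * a i - C * b i) ^+ 2 = B * (A * B - C ^+ 2).
  transitivity (\sum_i (B ^+ 2 * a i ^+ 2 - 2 * B * C * (a i * b i) + C ^+ 2 * b i ^+ 2)).
    by apply: eq_bigr => i _; ring.
  by rewrite !big_split/= sumrN -!mulr_sumr -/A -/B -/C; ring.
by rewrite pmulr_rge0 ?subr_ge0// lt_neqAle eq_sym B1.
Qed.

Lemma minkowski (a b : 'I_d -> R) :
  Num.sqrt (\sum_i (a i + b i) ^+ 2) <=
  Num.sqrt (\sum_i a i ^+ 2) + Num.sqrt (\sum_i b i ^+ 2).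
Proof.
have s0 (c : 'I_d -> R) : 0 <= \sum_i c i ^+ 2.
  by apply: sumr_ge0 => i _; exact: sqr_ge0.
rewrite -[leRHS]ger0_norm ?addr_ge0 ?sqrtr_ge0// -sqrtr_sqr ler_wsqrtr//.
rewrite sqrrD !sqr_sqrtr//.
have -> : \sum_i (a i + b i) ^+ 2 =
    \sum_i a i ^+ 2 + (\sum_i a i * b i) *+ 2 + \sum_i b i ^+ 2.
  by rewrite -sumrMnl -!big_split; apply: eq_bigr => i _; rewrite sqrrD.
rewrite lerD2r lerD2l lerMn2r /=.
rewrite -sqrtrM// (le_trans (ler_norm _))// -sqrtr_sqr ler_wsqrtr//.
exact: cauchy_schwarz.
Qed.

Lemma euclid_dist_ge0 x y : 0 <= euclid_dist x y.
Proof. exact: sqrtr_ge0. Qed.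

Lemma euclid_distC x y : euclid_dist x y = euclid_dist y x.
Proof.
by congr Num.sqrt; apply: eq_bigr => i _; rewrite -sqrrN opprB.
Qed.

Lemma euclid_dist_sqr x y :
  euclid_dist x y ^+ 2 = \sum_(i < d) (tnth x i - tnth y i) ^+ 2.
Proof. by rewrite sqr_sqrtr// sumr_ge0// => i _; exact: sqr_ge0. Qed.

Lemma euclid_dist_triangle y x z :
  euclid_dist x z <= euclid_dist x y + euclid_dist y z.
Proof.
have -> : euclid_dist x z =
    Num.sqrt (\sum_i ((tnth x i - tnth y i) + (tnth y i - tnth z i)) ^+ 2).
  by congr Num.sqrt; apply: eq_bigr => i _; congr (_ ^+ 2); ring.
exact: minkowski.
Qed.

Lemma le_coord_euclid_dist x y i : `|tnth x i - tnth y i| <= euclid_dist x y.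
Proof.
rewrite -sqrtr_sqr ler_wsqrtr// (bigD1 i)//= lerDl sumr_ge0// => j _.
exact: sqr_ge0.
Qed.

Lemma euclid_dist_eq0 x y : euclid_dist x y = 0 -> x = y.
Proof.
move=> xy; apply: eq_from_tnth => i; apply/eqP.
by rewrite -subr_eq0 -normr_le0 -xy le_coord_euclid_dist.
Qed.

(** A crude kissing number: intervals of length [1 / (d + 1)] cut [-1, 1] into
    [2 * d + 3] pieces, end points included, in each coordinate. *)
Definition kissing_bound : nat := (2 * d).+3 ^ d.

(** The angle argument behind the kissing number: if each of two vectors is
    closer to the origin than to the other one, then they make an angle of at
    least 60 degrees, so their directions are at distance at least 1. *)
Lemma directions_separated (a b : 'I_d -> R) (na nb : R) :
  0 < na -> 0 < nb -> na ^+ 2 = \sum_i a i ^+ 2 -> nb ^+ 2 = \sum_i b i ^+ 2 ->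
  na ^+ 2 <= \sum_i (a i - b i) ^+ 2 -> nb ^+ 2 <= \sum_i (a i - b i) ^+ 2 ->
  1 <= \sum_i (a i / na - b i / nb) ^+ 2.
Proof.
move=> na0 nb0 ea eb.
have sqB (u v : 'I_d -> R) : \sum_i (u i - v i) ^+ 2 =
    \sum_i u i ^+ 2 + \sum_i v i ^+ 2 - 2 * \sum_i u i * v i.
  by rewrite mulr_sumr -sumrN -!big_split/=; apply: eq_bigr => i _; ring.
rewrite !sqB -ea -eb.
have -> : \sum_i (a i / na) ^+ 2 = 1.
  under eq_bigr do rewrite exprMn.
  by rewrite -mulr_suml -ea -exprMn divff ?gt_eqF// expr1n.
have -> : \sum_i (b i / nb) ^+ 2 = 1.
  under eq_bigr do rewrite exprMn.
  by rewrite -mulr_suml -eb -exprMn divff ?gt_eqF// expr1n.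
have -> : \sum_i a i / na * (b i / nb) = (\sum_i a i * b i) / (na * nb).
  by rewrite mulr_suml; apply: eq_bigr => i _; rewrite invfM; ring.
set C := \sum_i a i * b i => h1 h2.
suff : C / (na * nb) <= 1 / 2 by lra.
rewrite ler_pdivrMr ?mulr_gt0//.
have [ab|ab] := leP na nb; nra.
Qed.

(** Pigeonhole: the directions of the points from [p] lie in a cube that is
    cut into [kissing_bound] cells of diameter less than 1. *)
Lemma card_strict_neighbours (I : finType) (A : {set I}) (y : I -> d.-tuple R)
    (p : d.-tuple R) :
  (forall i k, i \in A -> k \in A -> i != k ->
     euclid_dist (y i) p < euclid_dist (y i) (y k)) ->
  (#|A| <= kissing_bound)%N.
Proof.
move=> Ay.
have [A1|A1] := leqP #|A| 1.
  by rewrite (leq_trans A1)// expn_gt0.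
have pos i : i \in A -> 0 < euclid_dist (y i) p.
  move=> iA; rewrite lt_neqAle euclid_dist_ge0 andbT eq_sym; apply/eqP => /euclid_dist_eq0 yip.
  have [k kA ki] : exists2 k, k \in A & k != i.
    have : (0 < #|A :\ i|)%N by rewrite -(ltn_add2l (i \in A)) -cardsD1 iA.
    by case/card_gt0P => k /[!inE] /andP[ki kA]; exists k.
  by have := Ay k i kA iA ki; rewrite yip ltxx.
pose u i c := (tnth (y i) c - tnth p c) / euclid_dist (y i) p.
have u1 i c : i \in A -> `|u i c| <= 1.
  move=> iA; rewrite normrM normfV (ger0_norm (ltW (pos i iA))).
  by rewrite ler_pdivrMr ?pos// mul1r le_coord_euclid_dist.
have sepE i k : \sum_c (tnth (y i) c - tnth p c - (tnth (y k) c - tnth p c)) ^+ 2 =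
    euclid_dist (y i) (y k) ^+ 2.
  by rewrite euclid_dist_sqr; apply: eq_bigr => c _; congr (_ ^+ 2); ring.
have usep i k : i \in A -> k \in A -> i != k -> 1 <= \sum_c (u i c - u k c) ^+ 2.
  move=> iA kA ik; apply: directions_separated; rewrite ?pos ?euclid_dist_sqr//.
    rewrite -euclid_dist_sqr sepE ler_sqr ?nnegrE ?euclid_dist_ge0//.
    exact/ltW/Ay.
  rewrite -euclid_dist_sqr sepE (euclid_distC (y i)).
  rewrite ler_sqr ?nnegrE ?euclid_dist_ge0//.
  by apply/ltW/Ay; rewrite // eq_sym.
pose cell i : {ffun 'I_d -> 'I_(2 * d).+3} :=
  [ffun c => inord (Num.truncn ((u i c + 1) * d.+1%:R))].
have d0 : (0 : R) < d.+1%:R by rewrite ltr0n.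
have cell_inj : {in A &, injective cell}.
  move=> i k iA kA /ffunP ik; apply/eqP; apply/negPn/negP => nik.
  have : \sum_c (u i c - u k c) ^+ 2 <= \sum_(c < d) d.+1%:R ^- 2.
    apply: ler_sum => c _; have := ik c; rewrite !ffunE => /(congr1 val)/=.
    have bnd j : j \in A -> 0 <= (u j c + 1) * d.+1%:R < (2 * d).+3%:R.
      move=> jA; have := u1 _ c jA; rewrite ler_norml => /andP[uj1 uj2].
      apply/andP; split; first by rewrite mulr_ge0// -lerBlDr sub0r.
      rewrite (@le_lt_trans _ _ (2 * d.+1%:R))// ?ler_pM2r//; first by lra.
      by rewrite -natrM ltr_nat; lia.
    have trn j : j \in A -> (Num.truncn ((u j c + 1) * d.+1%:R) < (2 * d).+3)%N.
      move=> jA; have /andP[b0 b1] := bnd j jA.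
      by rewrite -(ltr_nat R) (le_lt_trans _ b1)// truncn_le.
    rewrite !inordK ?trn// => eqt.
    have /andP[bi0 _] := bnd i iA; have /andP[bk0 _] := bnd k kA.
    have := truncn_itv bi0; have := truncn_itv bk0; rewrite eqt.
    set t := Num.truncn _ => /andP[h1 h2] /andP[h3 h4].
    have : `|u i c - u k c| <= d.+1%:R^-1.
      rewrite -[d.+1%:R^-1]div1r ler_pdivlMr// -[X in _ * X]ger0_norm ?(ltW d0)//.
      rewrite -normrM ler_norml; rewrite -[t.+1%:R]natr1 in h2 h4.
      by apply/andP; split; lra.
    by move=> h; rewrite -exprVn -real_normK ?num_real// lerXn2r ?nnegrE ?invr_ge0 ?(ltW d0).
  rewrite sumr_const card_ord; apply/negP; rewrite -ltNge.
  apply: lt_le_trans (usep i k iA kA nik).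
  rewrite -[X in X < _]mulr_natl ltr_pdivrMr ?exprn_gt0// mul1r -natrX ltr_nat.
  by rewrite expnS expn1; lia.
rewrite -(card_in_imset cell_inj) (leq_trans (max_card _))//.
by rewrite card_ffun !card_ord.
Qed.

End euclidean_geometry.

(** * Euclidean balls *)

Section balls.
Context (R : realType) (d : nat).
Local Notation E := (d.-tuple (measurableTypeR R)).
Local Notation lam := (lebesgue_tuple R d).

Lemma measurable_euclid_dist dT (T : measurableType dT) (u v : T -> E) :
  measurable_fun setT u -> measurable_fun setT v ->
  measurable_fun setT (fun t => euclid_dist (u t) (v t) : R).
Proof.
move=> mu mv; rewrite /euclid_dist.
apply: (@measurableT_comp _ _ _ _ _ _ (@Num.sqrt R)).
  by apply: continuous_measurable_fun; exact: sqrt_continuous.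
apply: measurable_sum => i; apply: measurable_funX; apply: measurable_funB.
  exact: (measurableT_comp (measurable_tnth i) mu).
exact: (measurableT_comp (measurable_tnth i) mv).
Qed.

Lemma measurable_euclid_dist_le dT (T : measurableType dT) (u v : T -> E) (r : R) :
  measurable_fun setT u -> measurable_fun setT v ->
  measurable [set t | euclid_dist (u t) (v t) <= r].
Proof.
by move=> mu mv; exact: measurable_le_set (measurable_euclid_dist mu mv).
Qed.

Lemma measurable_eball (x : E) (r : R) : measurable (eball x r : set E).
Proof. exact: measurable_euclid_dist_le. Qed.

Lemma eball_subset_box (x : E) (r : R) :
  eball x r `<=` box (fun i => `[tnth x i - r, tnth x i + r]%classic).
Proof.
move=> y /= xy i; rewrite /= in_itv/= -ler_distlC.
exact: le_trans (le_coord_euclid_dist _ _ _) xy.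
Qed.

Lemma lebesgue_eball_lty (x : E) (r : R) : (lam (eball x r) < +oo)%E.
Proof.
pose B (i : 'I_d) : set (measurableTypeR R) := `[tnth x i - r, tnth x i + r]%classic.
apply: (@le_lt_trans _ _ (lam (box B))).
  apply: measure_mono.
  - exact: measurable_eball.
  - by apply: measurable_box => i; exact: measurable_itv.
  - exact: eball_subset_box.
rewrite lebesgue_box; last by move=> i; exact: measurable_itv.
rewrite ltey_eq prode_fin_num// => i _.
by rewrite lebesgue_measure_itv/=; case: ifP.
Qed.

Lemma lebesgue_unit_ball :
  lam (eball (evec0 R d) 1) = (unit_ball_volume R d)%:E.
Proof.
by rewrite /unit_ball_volume fineK// ge0_fin_numE// lebesgue_eball_lty.
Qed.

Lemma unit_ball_volume_gt0 : 0 < unit_ball_volume R d.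
Proof.
rewrite -lte_fin -lebesgue_unit_ball.
pose B (i : 'I_d) : set (measurableTypeR R) := `[0, d.+1%:R^-1]%classic.
have d0 : (0 : R) < d.+1%:R by rewrite ltr0n.
have mB i : measurable (B i) by exact: measurable_itv.
apply: (@lt_le_trans _ _ (lam (box B))); last first.
  apply: measure_mono.
  - exact: measurable_box.
  - exact: measurable_eball.
  - move=> y yB; rewrite /eball /= -[leRHS]sqrtr1 ler_wsqrtr//.
    apply: (@le_trans _ _ (\sum_(i < d) d.+1%:R ^- 2)).
      apply: ler_sum => i _; have := yB i; rewrite /B /= in_itv/= => /andP[y0 y1].
      by rewrite tnth_mktuple sub0r sqrrN -exprVn lerXn2r// nnegrE invr_ge0 ltW.
    rewrite sumr_const card_ord -[leLHS]mulr_natl ler_pdivrMr ?exprn_gt0//.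
    by rewrite mul1r -natrX ler_nat expnS expn1; lia.
rewrite lebesgue_box//.
rewrite (eq_bigr (fun=> (d.+1%:R^-1)%:E)); last first.
  move=> i _; rewrite lebesgue_measure_itv/= lte_fin invr_gt0 d0.
  by rewrite -EFinB subr0.
by rewrite prodEFin lte_fin prodr_gt0// => i _; rewrite invr_gt0.
Qed.

(** A ball of positive radius is the preimage of the unit ball under an affine
    map; a ball of radius zero is a point, hence null in positive dimension. *)
Lemma lebesgue_eball (x : E) (r : R) : (0 < d)%N -> 0 <= r ->
  lam (eball x r) = (r ^+ d * unit_ball_volume R d)%:E.
Proof.
move=> d0; rewrite le_eqVlt => /predU1P[<-|r0].
  rewrite expr0n gtn_eqF// mul0r; apply/eqP; rewrite eq_le measure_ge0 andbT.
  pose B (i : 'I_d) : set (measurableTypeR R) := `[tnth x i - 0, tnth x i + 0]%classic.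
  have mB i : measurable (B i) by exact: measurable_itv.
  apply: (@le_trans _ _ (lam (box B))).
    apply: measure_mono.
    - exact: measurable_eball.
    - exact: measurable_box.
    - exact: eball_subset_box.
  rewrite lebesgue_box// (bigD1 (Ordinal d0))//= /B.
  by rewrite subr0 addr0 set_itv1 lebesgue_measure_set1 mul0e.
pose b : d.-tuple R := [tuple - tnth x i / r | i < d].
have e : eball x r = affine_tuple r^-1 b @^-1` eball (evec0 R d) 1.
  have eD y : euclid_dist (evec0 R d) (affine_tuple r^-1 b y) = euclid_dist x y / r.
    rewrite -[r in RHS]ger0_norm ?(ltW r0)// -normfV -sqrtr_sqr -sqrtrM; last first.
      by rewrite sumr_ge0// => i _; exact: sqr_ge0.
    rewrite mulr_suml; congr Num.sqrt; apply: eq_bigr => i _.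
    by rewrite !tnth_mktuple; ring.
  by apply/seteqP; split => y; rewrite /eball /= eD ler_pdivrMr// mul1r.
have ri0 : 0 < r^-1 by rewrite invr_gt0.
have := lebesgue_tuple_affine b ri0 (measurable_eball (evec0 R d) 1).
rewrite -e lebesgue_unit_ball => h.
have rd0 : r ^+ d != 0 by rewrite expf_neq0// gt_eqF.
have -> : lam (eball x r) = ((r ^+ d)%:E * ((r^-1 ^+ d)%:E * lam (eball x r)))%E.
  by rewrite muleA -EFinM -exprMn divff ?gt_eqF// expr1n mul1e.
by rewrite h EFinM.
Qed.

End balls.

(** * Nearest neighbour distances *)

Section nearest_neighbours.
Context (R : realType) (d : nat).
Implicit Types (x : nat -> d.-tuple R) (y : d.-tuple R).

Lemma exists_other n (i : 'I_n) : (1 < n)%N -> exists j : 'I_n, j != i.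
Proof.
case: n i => [[]//|[//|n]] i _.
have [->|i0] := eqVneq i ord0; last by exists ord0; rewrite eq_sym.
by exists ord_max.
Qed.

Lemma nn_dist_attained x n (i : 'I_n) y : (1 < n)%N ->
  exists2 j : 'I_n, j != i & nn_dist x i y = euclid_dist y (x j).
Proof.
move=> n1; have [k ki] := exists_other i n1.
rewrite /nn_dist (bigmin_eq_arg _ k)// => [|j _]; last by rewrite leey.
by case: arg_minP => // j ji _; exists j.
Qed.

Lemma nn_dist_le x n (i j : 'I_n) y : j != i -> nn_dist x i y <= euclid_dist y (x j).
Proof.
move=> ji; rewrite /nn_dist (bigmin_eq_arg _ j)// => [|k _]; last by rewrite leey.
by case: arg_minP => // k ki /(_ _ ji); rewrite lee_fin.
Qed.

Lemma nn_dist_ge0 x n (i : 'I_n) y : (1 < n)%N -> 0 <= nn_dist x i y.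
Proof. by move=> /(nn_dist_attained x i y)[j _ ->]; exact: euclid_dist_ge0. Qed.

Lemma nn_dist_gtP x n (i : 'I_n) y (r : R) : (1 < n)%N ->
  r < nn_dist x i y <-> forall j : 'I_n, j != i -> r < euclid_dist y (x j).
Proof.
move=> n1; split=> [ri j ji|rx]; first exact: lt_le_trans (nn_dist_le _ _ ji).
by have [j ji ->] := nn_dist_attained x i y n1; exact: rx.
Qed.

Lemma eq_nn_dist x x' n (i : 'I_n) y : (forall j : 'I_n, j != i -> x j = x' j) ->
  nn_dist x i y = nn_dist x' i y.
Proof.
by move=> xx'; rewrite /nn_dist; congr fine; apply: eq_bigr => j ji; rewrite xx'.
Qed.

(** The points whose unique nearest neighbour is [x j0]. Uniqueness matters:
    each of several coincident points is a nearest neighbour of all the others,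
    so without it the number of such points has no bound. *)
Definition strict_neighbours x n (j0 : 'I_n) : {set 'I_n} :=
  [set i | (i != j0) && [forall k, (k != i) && (k != j0) ==>
     (euclid_dist (x i) (x j0) < euclid_dist (x i) (x k))]].

Lemma card_strict_neighbours_of x n (j0 : 'I_n) :
  (#|strict_neighbours x j0| <= kissing_bound d)%N.
Proof.
apply: (@card_strict_neighbours _ _ _ _ (fun i : 'I_n => x i) (x j0)) => i k.
rewrite !inE => /andP[_ /forallP ik] /andP[kj0 _] nik.
by have := ik k; rewrite eq_sym nik kj0.
Qed.

Lemma nn_dist_le_change x x' n (i j0 : 'I_n) : (1 < n)%N -> i != j0 ->
  (forall j : 'I_n, j != j0 -> x j = x' j) ->
  i \notin strict_neighbours x' j0 ->
  nn_dist x i (x i) <= nn_dist x' i (x' i).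
Proof.
move=> n1 ij0 xx'; rewrite inE ij0/= => /forallPn[k].
rewrite negb_imply -leNgt => /andP[/andP[ki kj0] kle].
have [l li ->] := nn_dist_attained x' i (x' i) n1.
have [lj0|lj0] := eqVneq l j0; last by rewrite -!xx'// nn_dist_le.
by rewrite lj0 (le_trans _ kle)// -!xx'// nn_dist_le.
Qed.

(** Moving one point changes the nearest neighbour distance of another point
    only if the moved point was, or becomes, its unique nearest neighbour. *)
Lemma nn_dist_unchanged x x' n (i j0 : 'I_n) : (1 < n)%N -> i != j0 ->
  (forall j : 'I_n, j != j0 -> x j = x' j) ->
  i \notin strict_neighbours x j0 :|: strict_neighbours x' j0 ->
  nn_dist x i (x i) = nn_dist x' i (x' i).
Proof.
move=> n1 ij0 xx'; rewrite inE negb_or => /andP[i1 i2].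
apply/eqP; rewrite eq_le (nn_dist_le_change n1 ij0 xx')//=.
by rewrite (nn_dist_le_change n1 ij0)// => j jj0; rewrite xx'.
Qed.

(** Apart from the term of the moved point, only those of its strict
    neighbours, before or after the move, can change. *)
Lemma nn_sum_bounded_difference x x' n (j0 : 'I_n) (c : R -> R) (L : R) :
  (1 < n)%N -> (forall j : 'I_n, j != j0 -> x j = x' j) ->
  (forall r, `|c r| <= L) ->
  `|\sum_(i < n) c (nn_dist x i (x i)) - \sum_(i < n) c (nn_dist x' i (x' i))|
    <= 2 * L * (2 * kissing_bound d + 1)%:R.
Proof.
move=> n1 xx' cL.
have L0 : 0 <= L by exact: le_trans (normr_ge0 _) (cL 0).
pose A := j0 |: (strict_neighbours x j0 :|: strict_neighbours x' j0).
rewrite -sumrB (le_trans (ler_norm_sum _ _ _))//.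
apply: (@le_trans _ _ (\sum_(i in A) 2 * L)).
  rewrite [leLHS](bigID (mem A))/= [X in _ + X]big1 ?addr0 => [|i]; last first.
    rewrite in_setU1 negb_or => /andP[ij0 iA].
    by rewrite (nn_dist_unchanged n1 ij0 xx' iA) subrr normr0.
  apply: ler_sum => i _; rewrite (le_trans (ler_normB _ _))//.
  by rewrite mulr_natl mulr2n lerD.
rewrite sumr_const -[leLHS]mulr_natr ler_wpM2l ?mulr_ge0// ler_nat.
rewrite cardsU1 addnC leq_add//; last by case: (_ \notin _).
rewrite (leq_trans (leq_card_setU _ _).1)//.
by rewrite mul2n -addnn leq_add// card_strict_neighbours_of.
Qed.

(** Volume packing: the balls of a third of the nearest neighbour radius are
    disjoint and stay in a bounded region. *)
Lemma sum_nn_volume_le x n (M : R) : (0 < d)%N -> (1 < n)%N ->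
  (forall i : 'I_n, eball (evec0 R d) M (x i)) ->
  \sum_(i < n) nn_dist x i (x i) ^+ d * unit_ball_volume R d <=
    (6 * M) ^+ d * unit_ball_volume R d.
Proof.
move=> d0 n1 xM.
have M0 : 0 <= M.
  by apply: le_trans (xM (Ordinal (ltnW n1))); exact: euclid_dist_ge0.
set v := unit_ball_volume R d.
have v0 : 0 < v := unit_ball_volume_gt0 R d.
pose r (i : 'I_n) := nn_dist x i (x i).
have r0 i : 0 <= r i by exact: nn_dist_ge0.
have r2M i : r i <= 2 * M.
  have [j ji rij] := nn_dist_attained x i (x i) n1; rewrite /r rij.
  apply: (le_trans (euclid_dist_triangle (evec0 R d) _ _)).
  have := xM i; have := xM j; rewrite /eball /= => hj; rewrite euclid_distC => hi.
  by lra.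
pose J (i : 'I_n) := 0 < r i.
pose B (i : 'I_n) : set (d.-tuple (measurableTypeR R)) := eball (x i) (r i / 3).
have mB i : measurable (B i) by exact: measurable_eball.
have tB : trivIset (fun i => J i) B.
  apply/trivIsetP => /= i j iJ jJ ij; apply/seteqP; split => // z [].
  rewrite /B /eball /= => iz jz.
  have /nn_dist_le := ij => /(_ x (x j)).
  have := ij; rewrite eq_sym => /nn_dist_le => /(_ x (x i)).
  rewrite (euclid_distC (x j)) -/(r i) -/(r j).
  have := euclid_dist_triangle z (x i) (x j).
  rewrite (euclid_distC z).
  move: iJ jJ; rewrite /J /=; lra.
have h : (\sum_(i < n | J i) lebesgue_tuple R d (B i) <=
    lebesgue_tuple R d (eball (evec0 R d) (2 * M)))%E.
  rewrite -measure_bigsetU_ord_cond//; apply: measure_mono.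
  - by apply: bigsetU_measurable => i _; exact: mB.
  - exact: measurable_eball.
  - move=> z; rewrite -bigcup_seq_cond => -[i /= _]; rewrite /B /eball /= => iz.
    rewrite (le_trans (euclid_dist_triangle (x i) _ _))//.
    by have := xM i; have := r2M i; rewrite /eball /=; lra.
move: h; rewrite (lebesgue_eball _ d0) ?mulr_ge0//.
rewrite (eq_bigr (fun i => ((r i / 3) ^+ d * v)%:E)); last first.
  by move=> i _; rewrite /B (lebesgue_eball _ d0)// divr_ge0.
rewrite sumEFin lee_fin => h.
rewrite (bigID J)/= [X in _ + X]big1 ?addr0 => [|i]; last first.
  rewrite /J lt_neqAle r0 andbT negbK => /eqP ri.
  by rewrite -/(r i) -ri expr0n gtn_eqF// mul0r.
have -> : 6 * M = 3 * (2 * M) by ring.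
rewrite exprMn -mulrA.
apply: le_trans (ler_wpM2l _ h); last by rewrite exprn_ge0.
rewrite mulr_sumr; apply: ler_sum => i _.
by rewrite mulrA -exprMn mulrC (mulrC 3) mulrVK ?unitfE// mulrC.
Qed.

End nearest_neighbours.

(** * Independent identically distributed samples *)

Section iid_samples.
Context dS (S : measurableType dS) dT (T : measurableType dT) (R : realType)
  (P : probability T R) (X : nat -> {RV P >-> S}) (mu : probability S R).
Hypothesis hind : mutually_independent X.
Hypothesis hmu : forall i A, measurable A -> P (X i @^-1` A) = mu A.

Definition sample (s : nat -> nat) n (w : T) : n.-tuple S := [tuple X (s i) w | i < n].

Lemma measurable_sample s n : measurable_fun setT (sample s n).
Proof.
apply/measurable_fun_tnthP => i; rewrite (_ : _ \o _ = X (s i)) //.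
by apply/funext => w /=; rewrite tnth_mktuple.
Qed.

Definition sampleRV s n : {RV P >-> n.-tuple S} :=
  HB.pack (sample s n) (isMeasurableFun.Build _ _ _ _ (sample s n) (@measurable_sample s n)).

Definition sample_law n : probability (n.-tuple S) R :=
  distribution P (sampleRV id n).

Lemma sample_box s n (A : 'I_n -> set S) : injective s ->
  (forall i, measurable (A i)) ->
  P (sample s n @^-1` box A) = (\prod_(i < n) mu (A i))%E.
Proof.
move=> sI mA.
(* Independence speaks of families indexed by the positions in the sequence,
   so the sides are indexed again by the values of [s]. *)
pose A' k : set S := \big[setI/setT]_(i < n | s i == k) A i.
have mA' k : measurable (A' k) by apply: bigsetI_measurable.
have A'E (i : 'I_n) : A' (s i) = A i.
  rewrite /A' (big_pred1 i)// => j /=; apply/eqP/eqP => [/sI/val_inj//|->//].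
pose J := [fset s (val i) | i in 'I_n]%fset.
have := hind J mA'.
rewrite big_imfset/=; last by move=> i j _ _ /sI/val_inj.
rewrite big_enum/= => h.
transitivity (P (\bigcap_(i in [set` J]) X i @^-1` A' i)).
  congr (P _); apply/seteqP; split => [w wA k /= /imfsetP[i _ ->]|w wA i].
    by rewrite A'E; have := wA i; rewrite tnth_mktuple.
  have := wA (s i); rewrite /= A'E tnth_mktuple; apply.
  by apply/imfsetP; exists i.
rewrite h; apply: eq_bigr => i _; rewrite hmu ?A'E//.
Qed.

Lemma sample_law_box n (A : 'I_n -> set S) : (forall i, measurable (A i)) ->
  sample_law n (box A) = (\prod_(i < n) mu (A i))%E.
Proof. by move=> mA; exact: sample_box. Qed.

Lemma probability_tuple_unique n (m1 m2 : {measure set (n.-tuple S) -> \bar R}) :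
  (m1 setT < +oo)%E ->
  (forall A, (forall i, measurable (A i)) -> m1 (box A) = m2 (box A)) ->
  forall A, measurable A -> m1 A = m2 A.
Proof.
move=> m1oo m12; apply: (tuple_measure_unique (F := fun=> setT)) => //.
- by rewrite bigcup_const//; exists 0%N.
- by move=> _; apply: le_lt_trans m1oo; apply: measure_mono => //; exact: measurable_box.
Qed.

(** Any way of drawing [n] distinct members of the sequence gives the same
    law: both the exchangeability of the sample and its stationarity. *)
Lemma sample_same_law s n (A : set (n.-tuple S)) : injective s -> measurable A ->
  P (sample s n @^-1` A) = sample_law n A.
Proof.
move=> sI; apply: (@probability_tuple_unique n (distribution P (sampleRV s n))).
  by apply: (@le_lt_trans _ _ 1%E); [exact: probability_le1|exact: ltry].
move=> B mB; transitivity (\prod_(i < n) mu (B i))%E; first exact: sample_box.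
by symmetry; exact: sample_law_box.
Qed.

Lemma measurable_cons_tuple n :
  measurable_fun setT (fun p : S * n.-tuple S => [tuple of p.1 :: p.2]).
Proof. exact: (measurable_cons measurable_fst measurable_snd). Qed.

Lemma sample_lawS n (A : set (n.+1.-tuple S)) : measurable A ->
  sample_law n.+1 A =
    (mu \x sample_law n)%E ((fun p : S * n.-tuple S => [tuple of p.1 :: p.2]) @^-1` A).
Proof.
move=> mA; pose m2 := image_measure (mu \x sample_law n)%E (@measurable_cons_tuple n).
suff : sample_law n.+1 A = m2 A by [].
move: A mA; apply: probability_tuple_unique.
  by apply: (@le_lt_trans _ _ 1%E); [exact: probability_le1|exact: ltry].
move=> B mB; transitivity (\prod_(i < n.+1) mu (B i))%E.
  exact: sample_law_box.
rewrite big_ord_recl -sample_law_box// -product_measure1E//; last first.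
  by apply: measurable_box => i; exact: mB.
congr ((_ \x _)%E _); apply/seteqP; split => -[a x] /= Ax.
  move=> i; case: (unliftP ord0 i) => [j|] ->; last by rewrite tnth0; case: Ax.
  by rewrite tnthS; case: Ax => _; apply.
split; first by have := Ax ord0; rewrite tnth0.
by move=> i; have := Ax (lift ord0 i); rewrite tnthS.
Qed.

Lemma ge0_integral_sample_lawS n (F : n.+1.-tuple S -> \bar R) :
  measurable_fun setT F -> (forall t, (0 <= F t)%E) ->
  (\int[sample_law n.+1]_t F t =
   \int[mu]_x \int[sample_law n]_t F [tuple of x :: t])%E.
Proof.
move=> mF F0.
have mFc : measurable_fun setT (fun p : S * n.-tuple S => F [tuple of p.1 :: p.2]).
  exact: (measurableT_comp mF (@measurable_cons_tuple n)).
rewrite -(fubini_tonelli1 (fun p : S * n.-tuple S => F [tuple of p.1 :: p.2]))//.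
rewrite (eq_measure_integral
  (image_measure (mu \x sample_law n)%E (@measurable_cons_tuple n))); last first.
  by move=> A mA _; exact: sample_lawS.
rewrite ge0_integral_pushforward ?preimage_setT//.
exact: measurable_cons_tuple.
Qed.

Lemma ge0_integral_sample s n (F : n.-tuple S -> \bar R) : injective s ->
  measurable_fun setT F -> (forall t, (0 <= F t)%E) ->
  (\int[P]_w F (sample s n w) = \int[sample_law n]_t F t)%E.
Proof.
move=> sI mF F0.
transitivity (\int[distribution P (sampleRV s n)]_t F t)%E.
  by rewrite ge0_integral_distribution.
by apply: eq_measure_integral => A mA _; exact: sample_same_law.
Qed.

End iid_samples.

(** * Summable probabilities *)

Section almost_sure_tools.
Context dT (T : measurableType dT) (R : realType) (P : {measure set T -> \bar R}).

(** The Borel-Cantelli lemma, for a bound whose series telescopes. *)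
Lemma ae_finally_not (A : (set T)^nat) (C : R) (n0 : nat) : 0 <= C ->
  (forall n, (n0 <= n)%N -> measurable (A n)) ->
  (forall n, (n0 <= n)%N -> (P (A n) <= (C / (n.+1%:R * n.+2%:R))%:E)%E) ->
  {ae P, forall w, \forall n \near \oo, ~ A n w}.
Proof.
move=> C0 mA PA; pose B n := if (n0 <= n)%N then A n else set0.
have mB n : measurable (B n) by rewrite /B; case: ifPn => // /mA.
have PB n : (P (B n) <= (C / (n.+1%:R * n.+2%:R))%:E)%E.
  rewrite /B; case: ifPn => [/PA//|_]; rewrite measure0 lee_fin.
  by rewrite divr_ge0// mulr_ge0.
have sB : (\sum_(0 <= n <oo) P (B n) < +oo)%E.
  apply: (@le_lt_trans _ _ C%:E); last exact: ltry.
  apply: lime_le; first by apply: is_cvg_nneseries => n _ _; exact: measure_ge0.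
  apply: nearW => N; apply: (@le_trans _ _ (C * (1 - N.+1%:R^-1))%:E); last first.
    by rewrite lee_fin ler_piMr// gerBl invr_ge0.
  elim: N => [|N IH]; first by rewrite big_geq// invr1 subrr mulr0.
  rewrite big_nat_recr//= (le_trans (leeD IH (PB N)))// -EFinD lee_fin.
  rewrite le_eqVlt; apply/orP; left; apply/eqP.
  rewrite -[N.+2%:R]natr1.
  have : (N.+1%:R : R) != 0 by rewrite pnatr_eq0.
  have : (N.+1%:R + 1 : R) != 0 by rewrite natr1 pnatr_eq0.
  by move=> ? ?; field; apply/andP.
exists (lim_sup_set B); split.
- apply: bigcap_measurable => // k _; exact: bigcup_measurable.
- exact: lim_sup_set_cvg0.
- move=> w /= nw k _; apply: contrapT => nk; apply: nw.
  exists (maxn n0 k) => // n /=; rewrite geq_max => /andP[n0n kn] An; apply: nk.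
  by exists n => //; rewrite /B n0n.
Qed.

Lemma measure_le_integral (A : set T) (h : T -> \bar R) : measurable A ->
  measurable_fun setT h -> (forall w, (0 <= h w)%E) ->
  (forall w, A w -> (1 <= h w)%E) -> (P A <= \int[P]_w h w)%E.
Proof.
move=> mA mh h0 Ah; rewrite -[X in P X]setIT -integral_indic//.
apply: ge0_le_integral => //.
  by apply/measurable_EFinP; exact: measurable_indic.
move=> w _; rewrite indicE; case: (boolP (w \in A)) => [/set_mem/Ah//|_].
exact: h0.
Qed.

End almost_sure_tools.

Section real_inequalities.
Context (R : realType).

Lemma expR_quadratic (y : R) : y <= 1 / 2 -> expR y <= 1 + y + 2 * y ^+ 2.
Proof.
move=> y1; have y0 : 0 < 1 - y by lra.
rewrite -[expR y]invrK -expRN.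
apply: (@le_trans _ _ (1 - y)^-1).
  by rewrite lef_pV2 ?posrE ?expR_gt0//; exact: expR_ge1Dx.
by rewrite -[leLHS]div1r ler_pdivrMr//; nra.
Qed.

(** The truncation level at sample size [n]. It tends to infinity, but slowly:
    if one point moves a sum by a multiple of [root4 n], then deviations of
    order [n] of that sum have probability of order [e ^ (- k * root4 n)]. *)
Definition root4 (n : nat) : R := Num.sqrt (Num.sqrt n%:R).

Lemma root4_ge0 n : 0 <= root4 n. Proof. exact: sqrtr_ge0. Qed.

Lemma root4X n : root4 n ^+ 4 = n%:R.
Proof. by rewrite (exprM _ 2 2) !sqr_sqrtr// sqrtr_ge0. Qed.

Lemma root4_ge1 n : (0 < n)%N -> 1 <= root4 n.
Proof.
have h (x : R) : 1 <= x -> 1 <= Num.sqrt x.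
  by move=> x1; rewrite -[leLHS]sqrtr1 ler_wsqrtr.
by move=> n0; rewrite !h// ler1n.
Qed.

Lemma expR_ge_pow (n : nat) : exists2 K : R, 0 < K &
  forall x, 0 <= x -> x ^+ n.+1 / K <= expR x.
Proof.
exists (n.+1)`!%:R => [|x x0]; first by rewrite ltr0n fact_gt0.
by apply: le_trans (expR_ge1Dxn n x0); rewrite lerDr ler01.
Qed.

(** The exponential exceeds a multiple of [root4 n ^+ 12 = n ^+ 3]. *)
Lemma root4_rate (k : R) : 0 < k -> exists2 C, 0 <= C & forall n, (0 < n)%N ->
  n%:R * expR (- (k * root4 n)) <= C / (n.+1%:R * n.+2%:R).
Proof.
move=> k0; have [K K0 powK] := expR_ge_pow 11; pose A : R := K / k ^+ 12.
have A0 : 0 < A by rewrite divr_gt0 ?exprn_gt0.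
exists (6 * A) => [|n n0]; first by rewrite mulr_ge0 ?ltW.
have nR : (1 : R) <= n%:R by rewrite ler1n.
have n0R : (0 : R) < n%:R by lra.
have kn : 0 <= k * root4 n by rewrite mulr_ge0 ?root4_ge0 ?ltW.
have : n%:R ^+ 3 / A <= expR (k * root4 n).
  apply: le_trans (powK _ kn).
  by rewrite exprMn (exprM (root4 n) 4 3) root4X /A invf_div mulrA [X in X / _]mulrC.
rewrite expRN => h.
have n3 : 0 < n%:R ^+ 3 / A by rewrite divr_gt0 ?exprn_gt0.
have h' : (expR (k * root4 n))^-1 <= A / n%:R ^+ 3.
  by rewrite -[leRHS]invf_div lef_pV2 ?posrE ?expR_gt0.
apply: (le_trans (ler_wpM2l (ltW n0R) h')).
have -> : n%:R * (A / n%:R ^+ 3) = A / n%:R ^+ 2 by field; rewrite gt_eqF.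
have h6 : (n.+1%:R * n.+2%:R : R) <= 6 * n%:R ^+ 2.
  by rewrite -natrM -natrX -natrM ler_nat; case: n n0 {h h' n3 kn nR n0R} => // n _; nia.
rewrite ler_pdivlMr ?mulr_gt0 ?ltr0n// mulrAC ler_pdivrMr ?exprn_gt0//.
by rewrite [leRHS]mulrAC [leRHS]mulrC ler_pM2l.
Qed.

End real_inequalities.

(** * Exponential moments under bounded differences *)

Lemma integral_prob_cst d (T : measurableType d) (R : realType)
    (P : probability T R) (c : R) : (\int[P]_t c%:E = c%:E)%E.
Proof.
have e : (P : {measure set T -> \bar R}) setT = 1%E by exact: probability_setT.
by have := @integral_cst _ _ _ P setT measurableT c%:E; rewrite e mule1.
Qed.

Section mean_bounds.
Context d (T : measurableType d) (R : realType) (P : probability T R).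
Variables (h : T -> R) (a b : R).
Hypotheses (mh : measurable_fun setT h) (h0 : forall x, 0 <= h x).
Hypothesis ha : (\int[P]_x (h x)%:E)%E = a%:E.

Lemma mean_le : (forall x, h x <= b) -> a <= b.
Proof.
move=> hb; rewrite -lee_fin -ha -(integral_prob_cst P b).
by apply: ge0_le_integral => // [x _||x _]; rewrite ?lee_fin//; exact/measurable_EFinP.
Qed.

Lemma mean_ge : (forall x, b <= h x) -> b <= a.
Proof.
move=> hb; have [b0|b0] := leP b 0.
  rewrite (le_trans b0)// -lee_fin -ha; apply: integral_ge0 => x _.
  by rewrite lee_fin.
rewrite -lee_fin -ha -(integral_prob_cst P b).
apply: ge0_le_integral => // [x _||x _]; rewrite ?lee_fin ?(ltW b0)//.
exact/measurable_EFinP.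
Qed.

End mean_bounds.

Section concentration.
Context dS (S : measurableType dS) dT (T : measurableType dT) (R : realType)
  (P : probability T R) (X : nat -> {RV P >-> S}) (mu : probability S R).
Hypothesis hind : mutually_independent X.
Hypothesis hmu : forall i A, measurable A -> P (X i @^-1` A) = mu A.

Local Notation Q := (sample_law X).

Definition bounded_differences n (F : n.-tuple S -> R) (c : R) :=
  forall (i : 'I_n) t t', (forall j, j != i -> tnth t j = tnth t' j) ->
    `|F t - F t'| <= c.

Lemma integral_bounded n (F : n.-tuple S -> R) (K : R) : measurable_fun setT F ->
  (forall t, 0 <= F t <= K) ->
  exists2 m : R, 0 <= m <= K & (\int[Q n]_t (F t)%:E)%E = m%:E.
Proof.
move=> mF FK; have I0 : (0 <= \int[Q n]_t (F t)%:E)%E.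
  by apply: integral_ge0 => t _; rewrite lee_fin; have /andP[] := FK t.
have IK : (\int[Q n]_t (F t)%:E <= K%:E)%E.
  rewrite -(integral_prob_cst (Q n) K); apply: ge0_le_integral => //.
  - by move=> t _; rewrite lee_fin; have /andP[] := FK t.
  - exact/measurable_EFinP.
  - by move=> t _; rewrite lee_fin; have /andP[] := FK t.
exists (fine (\int[Q n]_t (F t)%:E)%E).
  rewrite fine_ge0//= -lee_fin fineK// ge0_fin_numE//.
  exact: le_lt_trans IK (ltry _).
by rewrite fineK// ge0_fin_numE//; exact: le_lt_trans IK (ltry _).
Qed.

(** The martingale argument of McDiarmid, one coordinate at a time: given the
    first coordinate [x], the mean [g x] of [F] moves by at most [c] with [x],
    and [F - g x] satisfies the hypothesis with one coordinate less. *)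
Lemma bounded_differences_exp_moment n (F : n.-tuple S -> R) (c K m l : R) :
  measurable_fun setT F -> (forall t, 0 <= F t <= K) -> bounded_differences F c ->
  (\int[Q n]_t (F t)%:E)%E = m%:E -> 0 <= c -> 0 <= l -> l * c <= 1 / 2 ->
  (\int[Q n]_t (expR (l * (F t - m)))%:E <=
    (expR (n%:R * (2 * (l * c) ^+ 2)))%:E)%E.
Proof.
move=> + + + + c0 l0 lc; elim: n => [|n IH] in F m *.
  move=> mF FK _ Fm; have Fcst t : F t = m.
    apply: EFin_inj; rewrite -Fm -(integral_prob_cst (Q 0) (F t)).
    by apply: eq_integral => t' _; rewrite (tuple0 t) (tuple0 t').
  rewrite mul0r expR0 -(integral_prob_cst (Q 0) 1) le_eqVlt; apply/orP; left.
  by apply/eqP; apply: eq_integral => t _; rewrite Fcst subrr mulr0 expR0.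
move=> mF FK Fc Fm.
have mFx x : measurable_fun setT (fun t : n.-tuple S => F [tuple of x :: t]).
  apply: (@measurableT_comp _ _ _ _ _ _ F _ (fun t : n.-tuple S => [tuple of x :: t])) => //.
  by apply: measurable_cons => //; exact: measurable_cst.
have FKx x (t : n.-tuple S) : 0 <= F [tuple of x :: t] <= K by exact: FK.
have /choice[g gP] x : exists m', 0 <= m' <= K /\
    (\int[Q n]_t (F [tuple of x :: t])%:E)%E = m'%:E.
  by have [m' m'K h] := integral_bounded (mFx x) (FKx x); exists m'.
have gK x : 0 <= g x <= K by have [] := gP x.
have gE x : (\int[Q n]_t (F [tuple of x :: t])%:E)%E = (g x)%:E by have [] := gP x.
have mFc : measurable_fun setT (fun p : S * n.-tuple S => (F [tuple of p.1 :: p.2])%:E).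
  apply/measurable_EFinP.
  exact: (@measurableT_comp _ _ _ _ _ _ F _ _ mF (@measurable_cons_tuple _ S n)).
have mg : measurable_fun setT g.
  apply/measurable_EFinP; rewrite (_ : EFin \o g =
    (fun x => \int[Q n]_t (F [tuple of x :: t])%:E)%E); last first.
    by apply/funext => x /=; rewrite gE.
  apply: (measurable_fun_fubini_tonelli_F
    (fun p : S * n.-tuple S => (F [tuple of p.1 :: p.2])%:E)) => //.
  by move=> p; rewrite lee_fin; have /andP[] := FK [tuple of p.1 :: p.2].
have gm : (\int[mu]_x (g x)%:E)%E = m%:E.
  rewrite -Fm (ge0_integral_sample_lawS hind hmu); last 2 first.
  - exact/measurable_EFinP.
  - by move=> t; rewrite lee_fin; have /andP[] := FK t.
  by apply: eq_integral => x _; rewrite gE.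
have gc x x' : g x <= g x' + c.
  rewrite -lee_fin EFinD -!gE.
  rewrite -[X in (_ + X)%E](integral_prob_cst (Q n)).
  rewrite -ge0_integralD//; last 2 first.
  - by move=> t _; rewrite lee_fin; have /andP[] := FKx x' t.
  - exact/measurable_EFinP.
  apply: ge0_le_integral => //.
  - by move=> t _; rewrite lee_fin; have /andP[] := FKx x t.
  - exact/measurable_EFinP.
  - by apply: emeasurable_funD => //; exact/measurable_EFinP.
  move=> t _; rewrite -EFinD lee_fin -lerBlDl (le_trans (ler_norm _))//.
  apply: (Fc ord0) => j j0; have [k ->|j0'] := unliftP ord0 j; first by rewrite !tnthS.
  by rewrite j0' eqxx in j0.
have g0 x : 0 <= g x by have /andP[] := gK x.
have gmc x : g x - m <= c.
  by rewrite lerBlDr -lerBlDl; apply: (mean_ge mg g0 gm) => x'; rewrite lerBlDl addrC.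
have gmc' x : - c <= g x - m.
  rewrite lerBrDr addrC lerBlDr; apply: (mean_le mg g0 gm) => x'; exact: gc.
pose A := 2 * (l * c) ^+ 2.
have outer : (\int[mu]_x (expR (l * (g x - m)))%:E <= (expR A)%:E)%E.
  have lm : (l * m)%:E \is a fin_num by [].
  rewrite -(leeD2rE _ _ lm).
  have m0 : 0 <= m by rewrite (mean_ge mg g0 gm).
  have lm0 : 0 <= l * m by rewrite mulr_ge0.
  have mexp : measurable_fun setT (fun x => expR (l * (g x - m))).
    apply: measurableT_comp => //; apply: measurable_funM => //.
    exact: measurable_funB.
  have -> : (\int[mu]_x (expR (l * (g x - m)))%:E + (l * m)%:E =
      \int[mu]_x (expR (l * (g x - m)) + l * m)%:E)%E.
    rewrite -(integral_prob_cst mu (l * m)) -ge0_integralD//.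
    exact/measurable_EFinP.
  apply: (@le_trans _ _ (\int[mu]_x ((1 + A)%:E + l%:E * (g x)%:E))%E).
    apply: ge0_le_integral => //.
    - by move=> x _; rewrite lee_fin addr_ge0 ?expR_ge0.
    - by apply/measurable_EFinP; exact: measurable_funD.
    - apply: emeasurable_funD => //; apply: emeasurable_funM => //.
      exact/measurable_EFinP.
    - move=> x _; rewrite -EFinM -EFinD lee_fin.
      set y := l * (g x - m).
      have y1 : `|y| <= l * c.
        by rewrite normrM (ger0_norm l0) ler_wpM2l// ler_norml gmc' gmc.
      have y2 : y <= 1 / 2 by rewrite (le_trans (ler_norm _))// (le_trans y1).
      have y3 : y ^+ 2 <= (l * c) ^+ 2.
        by rewrite -(real_normK (num_real y)) lerXn2r// nnegrE mulr_ge0.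
      have := expR_quadratic y2; rewrite /A.
      have : l * g x = y + l * m by rewrite /y; ring.
      by lra.
  rewrite ge0_integralD//; last 3 first.
  - by move=> x _; rewrite lee_fin addr_ge0// mulr_ge0// sqr_ge0.
  - by move=> x _; rewrite mule_ge0 ?lee_fin.
  - by apply: emeasurable_funM => //; exact/measurable_EFinP.
  rewrite integral_prob_cst ge0_integralZl//; last 2 first.
  - exact/measurable_EFinP.
  - by move=> x _; rewrite lee_fin.
  rewrite gm -EFinM -!EFinD lee_fin lerD2r; exact: expR_ge1Dx.
rewrite (ge0_integral_sample_lawS hind hmu); last 2 first.
- apply/measurable_EFinP; apply: measurableT_comp => //; apply: measurable_funM => //.
  exact: measurable_funB.
- by move=> t; rewrite lee_fin expR_ge0.
apply: (@le_trans _ _ (\int[mu]_x ((expR (n%:R * A))%:E * (expR (l * (g x - m)))%:E))%E).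
  apply: ge0_le_integral => //.
  - by move=> x _; apply: integral_ge0 => t _; rewrite lee_fin expR_ge0.
  - apply: (measurable_fun_fubini_tonelli_F
      (fun p : S * n.-tuple S => (expR (l * (F [tuple of p.1 :: p.2] - m)))%:E)) => //.
    apply/measurable_EFinP; apply: measurableT_comp => //; apply: measurable_funM => //.
    by apply: measurable_funB => //; exact/measurable_EFinP.
  - apply: emeasurable_funM => //; apply/measurable_EFinP.
    apply: measurableT_comp => //; apply: measurable_funM => //.
    exact: measurable_funB.
  move=> x _.
  have e (t : n.-tuple S) : (expR (l * (F [tuple of x :: t] - m)))%:E =
      ((expR (l * (g x - m)))%:E * (expR (l * (F [tuple of x :: t] - g x)))%:E)%E.
    by rewrite -EFinM -expRD; congr (expR _)%:E; ring.
  under eq_integral do rewrite e.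
  rewrite ge0_integralZl ?lee_fin ?expR_ge0//; last first.
    apply/measurable_EFinP; apply: measurableT_comp => //; apply: measurable_funM => //.
    exact: measurable_funB.
  rewrite muleC; apply: lee_wpmul2r; first by rewrite lee_fin expR_ge0.
  apply: IH => // i t t' tt'; apply: (Fc (lift ord0 i)) => j.
  have [k ->|->] := unliftP ord0 j; last by rewrite !tnth0.
  by rewrite !tnthS => ki; apply: tt'; apply: contra_neq ki => ->.
rewrite ge0_integralZl ?lee_fin ?expR_ge0//; last first.
  apply/measurable_EFinP; apply: measurableT_comp => //; apply: measurable_funM => //.
  exact: measurable_funB.
rewrite -/A -natr1 mulrDl mul1r expRD EFinM.
by apply: lee_wpmul2l; rewrite ?lee_fin ?expR_ge0.
Qed.

End concentration.

(** * Almost sure concentration *)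

Section almost_sure_concentration.
Context dS (S : measurableType dS) dT (T : measurableType dT) (R : realType)
  (P : probability T R) (X : nat -> {RV P >-> S}) (mu : probability S R).
Hypothesis hind : mutually_independent X.
Hypothesis hmu : forall i A, measurable A -> P (X i @^-1` A) = mu A.

Local Notation Q := (sample_law X).

Section upper_deviation.
Variables (F : forall n, n.-tuple S -> R) (K m : nat -> R) (C : R) (n0 : nat).
Hypothesis n0_gt0 : (0 < n0)%N.
Hypothesis mF : forall n, (n0 <= n)%N -> measurable_fun setT (@F n).
Hypothesis FK : forall n, (n0 <= n)%N -> forall t : n.-tuple S, 0 <= F t <= K n.
Hypothesis Fc : forall n, (n0 <= n)%N -> bounded_differences (@F n) (C * root4 R n).
Hypothesis Fm : forall n, (n0 <= n)%N -> (\int[Q n]_t (F t)%:E)%E = (m n)%:E.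
Hypothesis C0 : 0 < C.

(** Chernoff's bound with exponent [l = 1 / (2 * C * root4 n * sqrt n)], for
    which the quadratic term of the exponential moment is bounded and [l * n]
    is a multiple of [root4 n]. *)
Lemma upper_deviation_le n (e : R) : (n0 <= n)%N -> 0 < e ->
  (P [set w | (e * n%:R <= F (sample X id n w) - m n)%R] <=
    (expR (1 / 2) * expR (- (e / (2 * C) * root4 R n)))%:E)%E.
Proof.
move=> n0n e0; have n_gt0 : (0 < n)%N by exact: leq_trans n0n.
have r1 : 1 <= root4 R n by exact: root4_ge1.
have r0 : 0 < root4 R n by lra.
set r := root4 R n in r1 r0 *.
have nr : n%:R = r ^+ 4 by rewrite root4X.
have C0' : C != 0 by rewrite gt_eqF.
have r0' : r != 0 by rewrite gt_eqF.
pose l := (2 * (C * r) * r ^+ 2)^-1.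
have l0 : 0 < l by rewrite invr_gt0 !mulr_gt0 ?exprn_gt0.
have lc : l * (C * r) = (2 * r ^+ 2)^-1.
  by rewrite /l; field; apply/andP.
have lc2 : l * (C * r) <= 1 / 2.
  rewrite lc div1r lef_pV2 ?posrE ?mulr_gt0 ?exprn_gt0//.
  by have := exprn_ege1 2 r1; lra.
have mFs : measurable_fun setT (fun w => F (sample X id n w)).
  exact: (measurableT_comp (mF n0n) (@measurable_sample _ _ _ _ _ _ X id n)).
have mG : measurable_fun setT (fun t : n.-tuple S => expR (l * (F t - m n))).
  apply: measurableT_comp => //; apply: measurable_funM => //.
  by apply: measurable_funB => //; exact: mF.
have cr0 : 0 <= C * r by rewrite mulr_ge0 ?ltW.
have := bounded_differences_exp_moment hind hmu (mF n0n) (FK n0n) (Fc n0n) (Fm n0n)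
  cr0 (ltW l0) lc2.
rewrite -/r lc => mom.
apply: (@le_trans _ _ (\int[P]_w ((expR (- (l * (e * n%:R))))%:E *
    (expR (l * (F (sample X id n w) - m n)))%:E))%E).
  apply: measure_le_integral.
  - by apply: measurable_ge_set; exact: measurable_funB.
  - apply: emeasurable_funM => //; apply/measurable_EFinP.
    exact: (measurableT_comp mG (@measurable_sample _ _ _ _ _ _ X id n)).
  - by move=> w; rewrite mule_ge0// lee_fin expR_ge0.
  - move=> w /= h; rewrite -EFinM lee_fin -expRD -[leLHS]expR0 ler_expR.
    by rewrite addrC subr_ge0 ler_wpM2l// ltW.
rewrite ge0_integralZl ?lee_fin ?expR_ge0//; last first.
  by apply/measurable_EFinP; exact: (measurableT_comp mG (@measurable_sample _ _ _ _ _ _ X id n)).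
rewrite (ge0_integral_sample hind hmu (s := id)
  (F := fun t => (expR (l * (F t - m n)))%:E))//; last first.
  exact/measurable_EFinP.
rewrite muleC; apply: (le_trans (lee_wpmul2r _ mom)).
  by rewrite lee_fin expR_ge0.
rewrite -EFinM lee_fin; apply: ler_pM; rewrite ?expR_ge0// ler_expR.
  rewrite nr le_eqVlt; apply/orP; left; apply/eqP; field; exact: r0'.
rewrite lerN2 nr /l le_eqVlt; apply/orP; left; apply/eqP; field; exact/andP.
Qed.

Lemma ae_upper_deviation (e : R) : 0 < e ->
  {ae P, forall w, \forall n \near \oo, F (sample X id n w) - m n < e * n%:R}.
Proof.
move=> e0; have k0 : 0 < e / (2 * C) by rewrite divr_gt0// mulr_gt0.
have [D D0 HD] := root4_rate k0.
have := @ae_finally_not _ _ _ P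
  (fun n => [set w | e * n%:R <= F (sample X id n w) - m n]) (expR (1 / 2) * D) n0.
have h1 : 0 <= expR (1 / 2) * D by rewrite mulr_ge0 ?expR_ge0.
move=> /(_ h1); case.
- move=> n n0n; apply: measurable_ge_set; apply: measurable_funB => //.
  exact: (measurableT_comp (mF n0n) (@measurable_sample _ _ _ _ _ _ X id n)).
- move=> n n0n; apply: (le_trans (upper_deviation_le n0n e0)).
  rewrite lee_fin -[leRHS]mulrA ler_wpM2l ?expR_ge0//.
  apply: le_trans (HD n (leq_trans n0_gt0 n0n)).
  by rewrite ler_peMl ?expR_ge0// ler1n (leq_trans n0_gt0 n0n).
move=> N [mN PN sN]; exists N; split => // w nw; apply: sN => /= h; apply: nw => /=.
by apply: filterS h => n /negP; rewrite -ltNge.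
Qed.

End upper_deviation.

(** McDiarmid's inequality and the Borel-Cantelli lemma. The lower deviations
    of [F] are the upper deviations of [K - F]. *)
Lemma ae_concentration (F : forall n, n.-tuple S -> R) (K m : nat -> R) (C : R) (n0 : nat) :
  (0 < n0)%N ->
  (forall n, (n0 <= n)%N -> measurable_fun setT (@F n)) ->
  (forall n, (n0 <= n)%N -> forall t, 0 <= F n t <= K n) ->
  (forall n, (n0 <= n)%N -> bounded_differences (@F n) (C * root4 R n)) ->
  (forall n, (n0 <= n)%N -> (\int[Q n]_t (F n t)%:E)%E = (m n)%:E) -> 0 < C ->
  {ae P, forall w, n%:R^-1 * (F n (sample X id n w) - m n) @[n --> \oo] --> (0 : R)}.
Proof.
move=> n00 mF FK Fc Fm C0.
have upper p := ae_upper_deviation n00 mF FK Fc Fm C0 (e := p.+1%:R^-1).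
pose G n (t : n.-tuple S) := K n - F n t.
have mG n : (n0 <= n)%N -> measurable_fun setT (@G n).
  by move=> n0n; apply: measurable_funB => //; exact: mF.
have GK n : (n0 <= n)%N -> forall t, 0 <= G n t <= K n.
  move=> n0n t; have /andP[h1 h2] := FK n n0n t.
  by rewrite /G subr_ge0 h2 gerBl h1.
have Gc n : (n0 <= n)%N -> bounded_differences (@G n) (C * root4 R n).
  move=> n0n i t t' tt'; rewrite /G opprB addrC addrA subrK -[leLHS]normrN opprB.
  by rewrite (Fc n n0n i).
have Gm n : (n0 <= n)%N -> (\int[Q n]_t (G n t)%:E)%E = (K n - m n)%:E.
  move=> n0n; have [g _ gE] := integral_bounded X (mG n n0n) (GK n n0n).
  rewrite gE; congr EFin; apply/eqP; rewrite eq_sym subr_eq; apply/eqP/EFin_inj.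
  rewrite EFinD -gE -(Fm n n0n) -ge0_integralD//.
  - by rewrite -(integral_prob_cst (Q n)); apply: eq_integral => t _; rewrite -EFinD subrK.
  - by move=> t _; rewrite lee_fin; have /andP[] := GK n n0n t.
  - by apply/measurable_EFinP; exact: mG.
  - by move=> t _; rewrite lee_fin; have /andP[] := FK n n0n t.
  - by apply/measurable_EFinP; exact: mF.
have lower p := ae_upper_deviation n00 mG GK Gc Gm C0 (e := p.+1%:R^-1).
have pos p : 0 < p.+1%:R^-1 :> R by rewrite invr_gt0.
have ae1 : {ae P, forall w, forall p, \forall n \near \oo,
    F n (sample X id n w) - m n < p.+1%:R^-1 * n%:R}.
  by apply/ae_foralln => p; exact: upper.
have ae2 : {ae P, forall w, forall p, \forall n \near \oo,
    G n (sample X id n w) - (K n - m n) < p.+1%:R^-1 * n%:R}.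
  by apply/ae_foralln => p; exact: lower.
move: ae1 ae2; apply: filterS2 => w h1 h2.
apply/cvgr0Pnorm_lt => e e0.
have [p] := ltr_add_invr e0; rewrite add0r => pe.
near=> n.
have n1 : (0 < n)%N by near: n; exact: nbhs_infty_gt.
have n1R : (0 : R) < n%:R by rewrite ltr0n.
rewrite normrM normfV (ger0_norm (ltW n1R)) mulrC ltr_pdivrMr//.
apply: (@le_lt_trans _ _ (p.+1%:R^-1 * n%:R)); last by rewrite ltr_pM2r.
rewrite ler_norml; apply/andP; split.
  have -> : F n (sample X id n w) - m n = - (G n (sample X id n w) - (K n - m n)).
    by rewrite /G; ring.
  by rewrite lerN2; apply: ltW; near: n; exact: h2.
by apply: ltW; near: n; exact: h1.
Unshelve. all: end_near. Qed.

End almost_sure_concentration.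

(** * The maximal inequality *)

Section maximal_sums.
Context (R : realType).
Implicit Types (f g W : nat -> R).

(** The largest of the first partial sums of [f], the empty one included. The
    recursion on the front term lets the shift of the sequence appear. *)
Fixpoint max_sum f n : R :=
  if n is m.+1 then Num.max 0 (f 0%N + max_sum (fun i => f i.+1) m) else 0.

Lemma max_sum_ge0 f n : 0 <= max_sum f n.
Proof. by case: n => //= n; rewrite le_max lexx. Qed.

Lemma eq_max_sum f g n : (forall i, (i < n)%N -> f i = g i) ->
  max_sum f n = max_sum g n.
Proof.
elim: n => //= n IH in f g *; move=> fg; rewrite fg// (IH _ (fun i => g i.+1))//.
by move=> i ni; exact: fg.
Qed.

Lemma max_sum_leS f n : max_sum f n <= max_sum f n.+1.
Proof.
elim: n f => [|n IH] f; first exact: max_sum_ge0.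
rewrite [leLHS]/= [leRHS]/= ge_max le_max lexx /= le_max; apply/orP; right.
by rewrite lerD2l; exact: IH.
Qed.

Lemma le_max_sum f n m : (n <= m)%N -> max_sum f n <= max_sum f m.
Proof.
by apply: (homo_leq (fun x => lexx _) le_trans) => k; exact: max_sum_leS.
Qed.

Lemma sum_le_max_sum f n k : (k <= n)%N -> \sum_(i < k) f i <= max_sum f n.
Proof.
elim: n k f => [|n IH] [|k] f kn //=; rewrite ?big_ord0 ?le_max ?lexx//.
by rewrite big_ord_recl/= lerD2l IH// orbT.
Qed.

Lemma max_sum_le f W n : (forall i, f i <= W i) -> (forall i, 0 <= W i) ->
  max_sum f n <= \sum_(i < n) W i.
Proof.
elim: n f W => [|n IH] f W fW W0; first by rewrite big_ord0.
rewrite /= big_ord_recl ge_max addr_ge0 ?sumr_ge0//= lerD//.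
exact: (IH _ (fun i => W i.+1)).
Qed.

(** Garsia's pointwise inequality: when the largest partial sum is positive it
    starts with the first term, and what remains is a partial sum of the
    shifted sequence. *)
Lemma max_sum_shift W (l : R) n : (forall i, 0 <= W i) ->
  max_sum (fun i => W i - l) n + (if 0 < max_sum (fun i => W i - l) n then l else 0) <=
    W 0%N + max_sum (fun i => W i.+1 - l) n.
Proof.
move=> W0; set f := fun i => W i - l; case: ifPn => [fn|]; last first.
  rewrite -leNgt addr0 => /le_trans; apply; rewrite addr_ge0//.
  exact: max_sum_ge0.
have /max_idPr fE : 0 <= f 0%N + max_sum (fun i => f i.+1) n.
  rewrite leNgt; apply/negP => h; move: (lt_le_trans fn (max_sum_leS f n)).
  by rewrite /= lt_max ltxx /= ltNge ltW.
by have := max_sum_leS f n; rewrite [leRHS]/= fE /f; lra.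
Qed.

Lemma measurable_max_sum d (T : measurableType d) (g : nat -> T -> R) n :
  (forall i, measurable_fun setT (g i)) ->
  measurable_fun setT (fun t => max_sum (g ^~ t) n).
Proof.
elim: n g => [|n IH] g mg /=; first exact: measurable_cst.
apply: measurable_maxr; first exact: measurable_cst.
apply: measurable_funD => //.
by apply: (IH (fun i => g i.+1)) => i; exact: mg.
Qed.

Lemma measurable_exists_lt d (T : measurableType d) (a : nat -> R)
    (g : nat -> T -> R) : (forall i, measurable_fun setT (g i)) ->
  measurable [set t | exists k, a k < g k t].
Proof.
move=> mg; rewrite (_ : mkset _ = \bigcup_k [set t | a k < g k t]).
  by apply: bigcupT_measurable => k; exact: measurable_gt_set.
by apply/seteqP; split => [t [k kt]|t [k _ kt]]; exists k.
Qed.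

End maximal_sums.

Section maximal_inequality.
Context dS (S : measurableType dS) dT (T : measurableType dT) (R : realType)
  (P : probability T R) (X : nat -> {RV P >-> S}) (mu : probability S R).
Hypothesis hind : mutually_independent X.
Hypothesis hmu : forall i A, measurable A -> P (X i @^-1` A) = mu A.

Lemma ge0_integral_RV i (F : S -> \bar R) : measurable_fun setT F ->
  (forall x, (0 <= F x)%E) -> (\int[P]_w F (X i w) = \int[mu]_x F x)%E.
Proof.
move=> mF F0; transitivity (\int[distribution P (X i)]_x F x)%E.
  by rewrite ge0_integral_distribution.
by apply: eq_measure_integral => A mA _; exact: hmu.
Qed.

Section one_function.
Variables (W : S -> R) (l : R).
Hypotheses (mW : measurable_fun setT W) (W0 : forall x, 0 <= W x) (l0 : 0 < l).
Hypothesis Woo : (\int[mu]_x (W x)%:E < +oo)%E.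

Let f (s : nat -> nat) w i := W (X (s i) w) - l.

Let mf s n : measurable_fun setT (fun w => max_sum (f s w) n).
Proof.
apply: (measurable_max_sum (g := fun i w => f s w i)) => i.
by apply: measurable_funB => //; exact: (measurableT_comp mW).
Qed.

Let integral_max_sum_same s n : injective s ->
  (\int[P]_w (max_sum (f s w) n)%:E = \int[P]_w (max_sum (f id w) n)%:E)%E.
Proof.
pose F (t : n.-tuple S) := (max_sum (fun i => W (nth point t i) - l) n)%:E.
have FE s' w : F (sample X s' n w) = (max_sum (f s' w) n)%:E.
  congr EFin; apply: eq_max_sum => i ni.
  rewrite (_ : nth _ _ _ = tnth (sample X s' n w) (Ordinal ni)); last first.
    by rewrite (tnth_nth point).
  by rewrite tnth_mktuple.
have mF : measurable_fun setT F.
  apply/measurable_EFinP.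
  apply: (measurable_max_sum (g := fun i (t : n.-tuple S) => W (nth point t i) - l)) => i.
  apply: measurable_funB => //; apply: (measurableT_comp mW).
  have [ni|ni] := ltnP i n; last first.
    rewrite (_ : (fun _ => _) = cst point)//.
    by apply/funext => t; rewrite nth_default// size_tuple.
  rewrite (_ : (fun _ => _) = (fun t => tnth t (Ordinal ni))); first exact: measurable_tnth.
  by apply/funext => t; rewrite (tnth_nth point).
have F0 t : (0 <= F t)%E by rewrite lee_fin max_sum_ge0.
move=> sI; under eq_integral do rewrite -FE.
by rewrite (ge0_integral_sample hind hmu)// -(ge0_integral_sample hind hmu (s := id))//;
  under eq_integral do rewrite FE.
Qed.

Lemma maximal_inequality_fin n :
  (l%:E * P [set w | (0 < max_sum (f id w) n)%R] <= \int[mu]_x (W x)%:E)%E.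
Proof.
set A := [set w | _].
have mA : measurable A by exact: measurable_gt_set.
have mWX i : measurable_fun setT (fun w => (W (X i w))%:E).
  by apply/measurable_EFinP; exact: (measurableT_comp mW).
have mEW : measurable_fun setT (fun x => (W x)%:E) by exact/measurable_EFinP.
have fin : (\int[P]_w (max_sum (f id w) n)%:E)%E \is a fin_num.
  rewrite ge0_fin_numE; last first.
    by apply: integral_ge0 => w _; rewrite lee_fin max_sum_ge0.
  apply: (@le_lt_trans _ _ (\int[P]_w (\sum_(i < n) (W (X i w))%:E))%E).
    apply: ge0_le_integral => //.
    - by move=> w _; rewrite lee_fin max_sum_ge0.
    - exact/measurable_EFinP.
    - by apply: emeasurable_sum => i.
    - move=> w _; rewrite sumEFin lee_fin.
      apply: (max_sum_le (W := fun i => W (X i w))) => // i.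
      by rewrite /f lerBlDr lerDl ltW.
  rewrite ge0_integral_sum//; last by move=> i w _; rewrite lee_fin.
  apply: lte_sum_pinfty => i _.
  by rewrite (ge0_integral_RV i mEW)// => x; rewrite lee_fin.
rewrite -(leeD2lE _ _ fin).
have -> : (l%:E * P A = \int[P]_w (l * \1_A w)%:E)%E.
  under eq_integral do rewrite EFinM.
  rewrite ge0_integralZl//; last 2 first.
  - by apply/measurable_EFinP; exact: measurable_indic.
  - by rewrite lee_fin ltW.
  by rewrite integral_indic// setIT.
rewrite -ge0_integralD//; last 4 first.
- by move=> w _; rewrite lee_fin max_sum_ge0.
- exact/measurable_EFinP.
- by move=> w _; rewrite lee_fin mulr_ge0// ltW.
- by apply/measurable_EFinP; apply: measurable_funM => //; exact: measurable_indic.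
rewrite -(@integral_max_sum_same succn n succn_inj) -(ge0_integral_RV 0 mEW); last first.
  by move=> x; rewrite lee_fin.
rewrite -ge0_integralD//; last 3 first.
- by move=> w _; rewrite lee_fin max_sum_ge0.
- exact/measurable_EFinP.
- by move=> w _; rewrite lee_fin.
apply: ge0_le_integral => //.
- by move=> w _; rewrite -EFinD lee_fin addr_ge0 ?max_sum_ge0 ?mulr_ge0 // ltW.
- apply: emeasurable_funD; apply/measurable_EFinP => //.
  by apply: measurable_funM => //; exact: measurable_indic.
- by apply: emeasurable_funD => //; exact/measurable_EFinP.
move=> w _; rewrite -!EFinD lee_fin addrC [leRHS]addrC.
have := max_sum_shift l n (W := fun i => W (X i w)) (fun i => W0 _).
rewrite indicE /A; case: ifPn => h; rewrite addrC; apply: le_trans.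
  by rewrite mem_set// mulr1.
by rewrite memNset ?mulr0//; apply/negP.
Qed.

(** The maximal ergodic inequality of Hopf, for independent identically
    distributed variables. *)
Lemma maximal_inequality :
  (l%:E * P [set w | exists k, (l * k%:R < \sum_(i < k) W (X i w))%R] <=
    \int[mu]_x (W x)%:E)%E.
Proof.
pose A n := [set w | (0 < max_sum (f id w) n)%R].
have mA n : measurable (A n) by exact: measurable_gt_set.
have sumE k w : \sum_(i < k) f id w i = \sum_(i < k) W (X i w) - l * k%:R.
  by rewrite sumrB sumr_const card_ord mulr_natr.
pose B := [set w | exists k, (l * k%:R < \sum_(i < k) W (X i w))%R].
have BA : B `<=` \bigcup_n A n.
  move=> w [k kw]; exists k => //=.
  by apply: lt_le_trans (sum_le_max_sum _ (leqnn k)); rewrite sumE subr_gt0.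
have mB : measurable B.
  apply: (measurable_exists_lt (fun k => l * k%:R)) => k.
  by apply: measurable_sum => i; exact: (measurableT_comp mW).
have mU : measurable (\bigcup_n A n) by exact: bigcupT_measurable.
apply: (@le_trans _ _ (l%:E * P (\bigcup_n A n))%E).
  by apply: lee_wpmul2l; [rewrite lee_fin ltW|exact: measure_mono].
have ndA : nondecreasing_seq A.
  move=> m n mn; apply/subsetPset => w /= /lt_le_trans; apply.
  exact: le_max_sum.
have cvgA := nondecreasing_cvg_mu mA mU ndA (mu := P).
have cvglA : (l%:E * P (A n))%E @[n --> \oo] --> (l%:E * P (\bigcup_n A n))%E.
  by apply: cvgeZl.
rewrite -(cvg_lim _ cvglA)//; apply: lime_le; first by apply/cvg_ex; eexists; exact: cvglA.
apply: nearW => n; exact: maximal_inequality_fin.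
Qed.

End one_function.

(** The averages of the excesses of integrable variables over a level tending
    to infinity vanish almost surely: for a fixed level [j] the maximal
    inequality bounds the probability that some average of [(W - j)^+] exceeds
    [1 / (p + 1)] by a multiple of the mean of [(W - j)^+], which tends to zero
    with [j]. *)
Lemma ae_excess_average (W : S -> R) (L : nat -> R) :
  measurable_fun setT W -> (forall x, 0 <= W x) ->
  (\int[mu]_x (W x)%:E < +oo)%E ->
  (forall j : nat, \forall n \near \oo, j%:R <= L n) ->
  {ae P, forall w,
    n%:R^-1 * \sum_(i < n) Num.max (W (X i w) - L n) 0 @[n --> \oo] --> (0 : R)}.
Proof.
move=> mW W0 Woo Ly.
pose V (j : nat) x := Num.max (W x - j%:R) 0.
have mV j : measurable_fun setT (V j).
  by apply: measurable_maxr => //; exact: measurable_funB.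
have V0 j x : 0 <= V j x by rewrite le_max lexx orbT.
have VW j x : V j x <= W x by rewrite ge_max W0 lerBlDr lerDl ler0n.
have Voo j : (\int[mu]_x (V j x)%:E < +oo)%E.
  apply: le_lt_trans Woo; apply: ge0_le_integral => //.
  - by move=> x _; rewrite lee_fin.
  - exact/measurable_EFinP.
  - exact/measurable_EFinP.
  - by move=> x _; rewrite lee_fin.
have Vcvg : (\int[mu]_x (V j x)%:E @[j --> \oo] --> 0)%E.
  rewrite (_ : 0%E = \int[mu]_x (cst 0%E x))%E; last by rewrite integral0.
  have [] := @dominated_convergence _ _ _ mu setT measurableT
    (fun j x => (V j x)%:E) (cst 0%E) (fun x => (W x)%:E) => //.
  - by move=> j; exact/measurable_EFinP.
  - apply: aeW => x _; apply: cvg_near_cst.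
    near=> j; rewrite /V; congr EFin; apply/max_idPr; rewrite subr_le0.
    rewrite (le_trans (ltW (truncnS_gt _)))// ler_nat.
    by near: j; exact: nbhs_infty_ge.
  - apply/integrableP; split; first exact/measurable_EFinP.
    by under eq_integral do rewrite gee0_abs ?lee_fin//.
  - by apply: aeW => x j _; rewrite gee0_abs ?lee_fin.
pose B (l : R) j := [set w | exists k, (l * k%:R < \sum_(i < k) V j (X i w))%R].
have mB l j : measurable (B l j).
  apply: (measurable_exists_lt (fun k => l * k%:R)) => k.
  by apply: measurable_sum => i; exact: (measurableT_comp (mV j)).
have BV l j : 0 < l -> (l%:E * P (B l j) <= \int[mu]_x (V j x)%:E)%E.
  by move=> l0; apply: maximal_inequality.
have aeB p : {ae P, forall w, ~ (\bigcap_j B p.+1%:R^-1 j) w}.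
  have p0 : 0 < p.+1%:R^-1 :> R by rewrite invr_gt0.
  exists (\bigcap_j B p.+1%:R^-1 j); split.
  - exact: bigcapT_measurable.
  - apply/eqP; rewrite eq_le measure_ge0 andbT.
    rewrite -(@lee_pmul2l _ p.+1%:R^-1%:E)// mule0.
    apply: (cvge_ge _ Vcvg); apply: nearW => j.
    apply: le_trans (BV _ j p0); apply: lee_wpmul2l; first by rewrite lee_fin ltW.
    by apply: measure_mono => //; [exact: bigcapT_measurable|exact: bigcap_inf].
  - by move=> w /= /contrapT.
have := ae_foralln aeB; apply: filterS => w wB.
apply/cvgr0Pnorm_lt => e e0; have [p] := ltr_add_invr e0; rewrite add0r => pe.
have [j jB] : exists j, ~ B p.+1%:R^-1 j w.
  apply: contrapT => /forallNP h; apply: (wB p) => j _.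
  exact: contrapT.
near=> n.
have n1 : (0 < n)%N by near: n; exact: nbhs_infty_gt.
have n1R : (0 : R) < n%:R by rewrite ltr0n.
rewrite ger0_norm; last first.
  by rewrite mulr_ge0 ?invr_ge0// sumr_ge0// => i _; rewrite le_max lexx orbT.
apply: le_lt_trans pe; rewrite mulrC ler_pdivrMr//.
apply: (@le_trans _ _ (\sum_(i < n) V j (X i w))).
  apply: ler_sum => i _; rewrite /V ge_max; apply/andP; split; rewrite le_max.
    by apply/orP; left; rewrite lerB//; near: n; exact: Ly.
  by rewrite lexx orbT.
rewrite leNgt; apply/negP => h; apply: jB; exists n; exact: h.
Unshelve. all: end_near. Qed.

End maximal_inequality.

(** * Averages over balls *)

Section ereal_null_sequences.
Context (R : realType) (u : (\bar R)^nat).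

Lemma cvge0_small (e : R) : (u n @[n --> \oo] --> 0)%E -> 0 < e ->
  \forall n \near \oo, (u n < e%:E)%E.
Proof.
move=> /fine_cvgP[fu /cvgr0Pnorm_lt u0] e0; move: (u0 e e0) fu.
apply: filterS2 => n /= un fn; rewrite -(fineK fn) lte_fin.
exact: le_lt_trans (ler_norm _) un.
Qed.

Lemma cvge0_of_small : (forall n, (0 <= u n)%E) ->
  (forall e : R, 0 < e -> \forall n \near \oo, (u n < e%:E)%E) ->
  (u n @[n --> \oo] --> 0)%E.
Proof.
move=> u0 small; apply/fine_cvgP; split.
  have := small 1 ltr01; apply: filterS => n un.
  by rewrite ge0_fin_numE// (lt_trans un)// ltry.
apply/cvgr0Pnorm_lt => e e0; have := small e e0; apply: filterS => n un.
rewrite /= ger0_norm ?fine_ge0// -lte_fin fineK// ge0_fin_numE//.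
by rewrite (lt_trans un)// ltry.
Qed.

End ereal_null_sequences.

Section ball_averages.
Context (R : realType) (d : nat).
Hypothesis d0 : (0 < d)%N.
Local Notation E := (d.-tuple (measurableTypeR R)).
Local Notation lam := (lebesgue_tuple R d).
Local Notation v := (unit_ball_volume R d).
Implicit Types (g h : E -> R) (r : R).

Let near_pairs r : set (E * E) := [set p | euclid_dist p.1 p.2 <= r].

Let measurable_near_pairs r : measurable (near_pairs r).
Proof. exact: measurable_euclid_dist_le. Qed.

Let integral_eball_kernel r (g : E -> \bar R) (x : E) :
  (\int[lam]_(y in eball x r) g y = \int[lam]_y (g y * (\1_(near_pairs r) (x, y))%:E))%E.
Proof.
rewrite integral_mkcond; apply: eq_integral => y _; rewrite patchE indicE.
case: ifPn => [/set_mem h|/negP h]; first by rewrite mem_set// mule1.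
by rewrite memNset ?mule0// => h'; apply: h; exact: mem_set.
Qed.

Let measurable_kernel r (g : E -> \bar R) : measurable_fun setT g ->
  measurable_fun setT (fun p : E * E => (g p.2 * (\1_(near_pairs r) p)%:E)%E).
Proof.
move=> mg; apply: emeasurable_funM; first exact: (measurableT_comp mg).
by apply/measurable_EFinP; exact: measurable_indic.
Qed.

Lemma measurable_ge0_integral_eball r (g : E -> \bar R) : measurable_fun setT g ->
  (forall x, (0 <= g x)%E) ->
  measurable_fun setT (fun x => \int[lam]_(y in eball x r) g y)%E.
Proof.
move=> mg g0; under eq_fun do rewrite integral_eball_kernel.
apply: (measurable_fun_fubini_tonelli_F
  (fun p : E * E => (g p.2 * (\1_(near_pairs r) p)%:E)%E)).
  exact: measurable_kernel.
by move=> p; rewrite mule_ge0// lee_fin.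
Qed.

(** The kernel of the ball average is symmetric, so averaging preserves the
    integral. *)
Lemma ge0_integral_integral_eball r (g : E -> \bar R) : 0 <= r ->
  measurable_fun setT g -> (forall x, (0 <= g x)%E) ->
  (\int[lam]_x \int[lam]_(y in eball x r) g y =
   (r ^+ d * v)%:E * \int[lam]_y g y)%E.
Proof.
move=> r0 mg g0; under eq_integral do rewrite integral_eball_kernel.
rewrite (fubini_tonelli (fun p : E * E => (g p.2 * (\1_(near_pairs r) p)%:E)%E)); last 2 first.
- exact: measurable_kernel.
- by move=> p; rewrite mule_ge0// lee_fin.
have c0 : 0 <= r ^+ d * v by rewrite mulr_ge0 ?exprn_ge0// ltW// unit_ball_volume_gt0.
rewrite -ge0_integralZl ?lee_fin//.
apply: eq_integral => y _ /=.
rewrite ge0_integralZl//; last first.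
  have m1 : measurable_fun setT (\1_(near_pairs r) : E * E -> R) by exact: measurable_indic.
  by apply/measurable_EFinP; exact: (measurable_fun_pair1 y m1).
rewrite muleC; congr (_ * _)%E.
rewrite -(lebesgue_eball y d0 r0) -[X in _ = lam X]setIT -integral_indic//; last first.
  exact: measurable_eball.
apply: eq_integral => x _; congr EFin; rewrite !indicE.
suff -> : ((x, y) \in near_pairs r) = (x \in eball y r) by [].
by apply/idP/idP => /set_mem h; apply: mem_set; move: h;
  rewrite /near_pairs /eball/= euclid_distC.
Qed.

Definition ball_average r g (x : E) : R :=
  (r ^+ d * v)^-1 * \int[lam]_(y in eball x r) g y.

Local Notation integrable g := (lam.-integrable setT (EFin \o g)).

Lemma integrable_eball g x r : integrable g ->
  lam.-integrable (eball x r) (EFin \o g).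
Proof. by move=> ig; apply: integrableS ig => //; exact: measurable_eball. Qed.

Lemma measurable_ball_average r g : 0 <= r -> integrable g ->
  measurable_fun setT (ball_average r g).
Proof.
move=> r0 ig; have [mg goo] := integrableP _ _ _ ig.
apply: measurable_funM => //.
suff : measurable_fun setT (fun x => \int[lam]_(y in eball x r) (g y)%:E)%E.
  by move=> mI; apply: (measurableT_comp (fine_measurable measurableT) mI).
under eq_fun do rewrite integral_eball_kernel.
apply: (@measurable_fubini_F _ _ _ _ _ lam lam
  (fun p : E * E => ((g p.2)%:E * (\1_(near_pairs r) p)%:E)%E)).
apply/integrable12ltyP; first by apply: (@measurable_kernel r (EFin \o g)).
have -> : (\int[lam]_x \int[lam]_y `|(g (x, y).2)%:E * (\1_(near_pairs r) (x, y))%:E| =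
   \int[lam]_x \int[lam]_(y in eball x r) `|(g y)%:E|)%E.
  apply: eq_integral => x _; rewrite integral_eball_kernel.
  by apply: eq_integral => y _; rewrite abseM [X in (_ * X)%E]gee0_abs.
rewrite ge0_integral_integral_eball//; last exact: measurableT_comp.
rewrite lte_mul_pinfty// lee_fin mulr_ge0 ?exprn_ge0// ltW//.
exact: unit_ball_volume_gt0.
Qed.

(** Averaging over balls is a contraction of L1. *)
Lemma ball_average_contraction r g : 0 < r -> integrable g ->
  (\int[lam]_x `|(ball_average r g x)%:E| <= \int[lam]_x `|(g x)%:E|)%E.
Proof.
move=> r0 ig; have [mg goo] := integrableP _ _ _ ig.
have c0 : 0 < r ^+ d * v by rewrite mulr_gt0 ?exprn_gt0 ?unit_ball_volume_gt0.
have mag : measurable_fun setT (fun x => `|(g x)%:E|%E) by exact: measurableT_comp.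
apply: (@le_trans _ _ (\int[lam]_x (((r ^+ d * v)^-1)%:E *
    \int[lam]_(y in eball x r) `|(g y)%:E|))%E).
  apply: ge0_le_integral => //.
  - apply: measurableT_comp => //; apply/measurable_EFinP.
    by apply: measurable_ball_average => //; exact: ltW.
  - apply: emeasurable_funM => //; exact: measurable_ge0_integral_eball.
  move=> x _; rewrite /ball_average EFinM abseM gee0_abs ?lee_fin ?invr_ge0 ?(ltW c0)//.
  apply: lee_wpmul2l; first by rewrite lee_fin invr_ge0 ltW.
  rewrite /Rintegral fineK; last first.
    by apply: integrable_fin_num; [exact: measurable_eball|exact: integrable_eball].
  apply: le_abse_integral; first exact: measurable_eball.
  exact: measurable_funTS.
rewrite ge0_integralZl ?lee_fin ?invr_ge0 ?(ltW c0)//; last 2 first.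
- exact: measurable_ge0_integral_eball.
- by move=> x _; apply: integral_ge0.
rewrite ge0_integral_integral_eball ?(ltW r0)// muleA -EFinM mulVf ?gt_eqF//.
by rewrite mul1e.
Qed.

Definition average_deviation r g := (\int[lam]_x `|(ball_average r g x - g x)%:E|)%E.

Lemma measurable_deviation r g : 0 <= r -> integrable g ->
  measurable_fun setT (fun x => `|(ball_average r g x - g x)%:E|%E).
Proof.
move=> r0 ig; have [mg goo] := integrableP _ _ _ ig.
apply: measurableT_comp => //; apply/measurable_EFinP; apply: measurable_funB.
  exact: measurable_ball_average.
exact/measurable_EFinP.
Qed.

Lemma average_deviationD r g h : 0 <= r -> integrable g -> integrable h ->
  (average_deviation r (g \+ h)%R <= average_deviation r g + average_deviation r h)%E.
Proof.
move=> r0 ig ih; rewrite /average_deviation -ge0_integralD//; last 2 first.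
- exact: measurable_deviation.
- exact: measurable_deviation.
apply: ge0_le_integral => //.
- apply: measurable_deviation => //.
  by rewrite (_ : EFin \o _ = (EFin \o g) \+ (EFin \o h))%E//; exact: integrableD.
- by apply: emeasurable_funD; exact: measurable_deviation.
move=> x _ /=; rewrite -EFinD lee_fin /ball_average RintegralD//; last 3 first.
- exact: measurable_eball.
- exact: integrable_eball.
- exact: integrable_eball.
rewrite mulrDr opprD addrACA; exact: ler_normD.
Qed.

Lemma average_deviationZ r c g : 0 <= r -> integrable g ->
  average_deviation r (fun x => c * g x) = (`|c|%:E * average_deviation r g)%E.
Proof.
move=> r0 ig; rewrite /average_deviation -ge0_integralZl//; last first.
  exact: measurable_deviation.
apply: eq_integral => x _; rewrite /= -EFinM -normrM /ball_average RintegralZl//.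
- by congr (`|_|%:E); ring.
- exact: measurable_eball.
- exact: integrable_eball.
Qed.

(** The contraction property makes the deviation Lipschitz in L1. *)
Lemma average_deviation_approx r g h : 0 < r -> integrable g -> integrable h ->
  (average_deviation r g <=
    average_deviation r h + 2%:E * \int[lam]_x `|(g x - h x)%:E|)%E.
Proof.
move=> r0 ig ih.
have igh : integrable (g \- h)%R.
  by rewrite (_ : EFin \o _ = (EFin \o g) \- (EFin \o h))%E//; exact: integrableB.
have [mgh _] := integrableP _ _ _ igh.
have -> : average_deviation r g = average_deviation r (h \+ (g \- h))%R.
  by congr (average_deviation r _); apply/funext => x /=; rewrite addrC subrK.
apply: (le_trans (average_deviationD (ltW r0) ih igh)); apply: leeD => //.
apply: (@le_trans _ _ (\int[lam]_x (`|(ball_average r (g \- h) x)%:E| +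
    `|((g \- h) x)%:E|))%E).
  apply: ge0_le_integral => //.
  - by apply: measurable_deviation => //; exact: ltW.
  - apply: emeasurable_funD; apply: measurableT_comp => //.
    apply/measurable_EFinP; apply: measurable_ball_average => //; exact: ltW.
  move=> x _; rewrite EFinB; exact: lee_abs_sub.
rewrite ge0_integralD//; last 2 first.
- apply: measurableT_comp => //.
  apply/measurable_EFinP; apply: measurable_ball_average => //; exact: ltW.
- exact: measurableT_comp.
have -> : 2%:E = (1 + 1 : \bar R)%E by rewrite -EFinD.
rewrite ge0_muleDl ?lee_fin// mul1e; apply: leeD => //.
exact: ball_average_contraction.
Qed.

Definition small_radii (r_ : nat -> R) :=
  (forall n, 0 < r_ n <= 1) /\ r_ n @[n --> \oo] --> (0 : R).

(** The functions whose ball averages converge to them in L1. *)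
Definition averages_converge g := integrable g /\ forall r_ : nat -> R, small_radii r_ ->
  (average_deviation (r_ n) g @[n --> \oo] --> 0)%E.

Lemma average_deviation_ge0 r g : (0 <= average_deviation r g)%E.
Proof. exact: integral_ge0. Qed.

Lemma averages_convergeD g h : averages_converge g -> averages_converge h ->
  averages_converge (g \+ h).
Proof.
move=> [ig cg] [ih ch]; split.
  by rewrite (_ : EFin \o _ = (EFin \o g) \+ (EFin \o h))%E//; exact: integrableD.
move=> r_ sr; apply: (@squeeze_cvge _ _ _ _ (cst 0%E) _
  (fun n => average_deviation (r_ n) g + average_deviation (r_ n) h)%E).
- apply: nearW => n; rewrite average_deviation_ge0/=; apply: average_deviationD => //.
  by case: sr => /(_ n)/andP[/ltW].
- exact: cvg_cst.
- by rewrite -(adde0 0%E); apply: cvgeD => //; [exact: cg|exact: ch].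
Qed.

Lemma averages_convergeZ c g : averages_converge g ->
  averages_converge (fun x => c * g x).
Proof.
move=> [ig cg]; split.
  rewrite (_ : EFin \o _ = (fun x => c%:E * (EFin \o g) x)%E); first exact: integrableZl.
  by apply/funext => x.
move=> r_ sr; rewrite (_ : (fun n => _) = (fun n => `|c|%:E * average_deviation (r_ n) g)%E).
  by rewrite -(mule0 `|c|%:E); apply: cvgeZl => //; exact: cg.
apply/funext => n; apply: average_deviationZ => //.
by case: sr => /(_ n)/andP[/ltW].
Qed.

Lemma averages_converge_limit g (h_ : nat -> E -> R) : integrable g ->
  (forall k, averages_converge (h_ k)) ->
  (\int[lam]_x `|(g x - h_ k x)%:E| @[k --> \oo] --> 0)%E ->
  averages_converge g.
Proof.
move=> ig ch gh; split=> // r_ sr.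
apply: cvge0_of_small => [n|e e0]; first exact: average_deviation_ge0.
have e4 : 0 < e / 4 by lra.
have [k ghk] : exists k, (\int[lam]_x `|(g x - h_ k x)%:E| < (e / 4)%:E)%E.
  have [k _ hk] := cvge0_small gh e4.
  by exists k; apply: hk => /=.
have [_ /(_ _ sr) chk] := ch k.
have e2 : 0 < e / 2 by lra.
have := cvge0_small chk e2; apply: filterS => n hn.
apply: (le_lt_trans (average_deviation_approx _ ig (ch k).1)).
  by case: sr => /(_ n)/andP[].
have -> : e%:E = ((e / 2)%:E + 2%:E * (e / 4)%:E)%E.
  by rewrite -EFinM -EFinD; congr EFin; lra.
apply: lte_leD => //.
  by rewrite fin_numM// ge0_fin_numE ?integral_ge0// (lt_trans ghk)// ltry.
by apply: lee_wpmul2l => //; rewrite ?lee_fin// ltW.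
Qed.

End ball_averages.

(** * Lebesgue differentiation in mean *)

Section l1_convergence.
Context (R : realType) (d : nat).
Hypothesis d0 : (0 < d)%N.
Local Notation E := (d.-tuple (measurableTypeR R)).
Local Notation lam := (lebesgue_tuple R d).
Local Notation v := (unit_ball_volume R d).
Local Notation integrable g := (lam.-integrable setT (EFin \o g)).
Implicit Types (A B : set E).

Lemma hyperplane_null (i : 'I_d) (a : R) : lam [set x : E | tnth x i = a] = 0%E.
Proof.
pose B (j : 'I_d) : set (measurableTypeR R) := if j == i then [set a] else setT.
rewrite (_ : mkset _ = box B); last first.
  apply/seteqP; split => x /= xa; last by have := xa i; rewrite /B eqxx.
  by move=> j; rewrite /B; case: eqP => // ->.
rewrite lebesgue_box => [|j]; last by rewrite /B; case: ifP.
by rewrite (bigD1 i)//= {1}/B eqxx lebesgue_measure_set1 mul0e.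
Qed.

Lemma measurable_hyperplane (i : 'I_d) (a : R) : measurable [set x : E | tnth x i = a].
Proof.
rewrite (_ : mkset _ = (fun x : E => tnth x i) @^-1` [set a])//.
by apply: preimage_measurable => //; exact: measurable_tnth.
Qed.

Lemma integrable_indic_lty A : measurable A -> (lam A < +oo)%E ->
  integrable (\1_A : E -> R).
Proof.
move=> mA Aoo; apply/integrableP; split.
  by apply/measurable_EFinP; exact: measurable_indic.
rewrite (eq_integral (fun x => (\1_A x)%:E)); last first.
  by move=> x _ /=; rewrite ger0_norm.
by rewrite integral_indic// setIT.
Qed.

Lemma ball_average_indic A (r : R) x : measurable A ->
  ball_average r (\1_A : E -> R) x = (r ^+ d * v)^-1 * fine (lam (A `&` eball x r)).
Proof.
move=> mA; rewrite /ball_average /Rintegral integral_indic//.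
exact: measurable_eball.
Qed.

Lemma ball_average_indic_ge0 A (r : R) x : measurable A -> 0 <= r ->
  0 <= ball_average r (\1_A : E -> R) x.
Proof.
move=> mA r0; rewrite ball_average_indic// mulr_ge0 ?fine_ge0//.
by rewrite invr_ge0 mulr_ge0 ?exprn_ge0// ltW// unit_ball_volume_gt0.
Qed.

Lemma ball_average_indic_sub A (r : R) x : measurable A -> 0 < r ->
  eball x r `<=` A -> ball_average r (\1_A : E -> R) x = 1.
Proof.
move=> mA r0 xA; rewrite ball_average_indic// setIidr// (lebesgue_eball _ d0 (ltW r0)).
by rewrite /= mulVf// gt_eqF// mulr_gt0 ?exprn_gt0// unit_ball_volume_gt0.
Qed.

Lemma ball_average_indic_disjoint A (r : R) x : measurable A ->
  A `&` eball x r = set0 -> ball_average r (\1_A : E -> R) x = 0.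
Proof. by move=> mA xA; rewrite ball_average_indic// xA measure0 mulr0. Qed.

Lemma ball_average_indic_le1 A (r : R) x : measurable A -> 0 < r ->
  ball_average r (\1_A : E -> R) x <= 1.
Proof.
move=> mA r0; have c0 : 0 < r ^+ d * v by rewrite mulr_gt0 ?exprn_gt0// unit_ball_volume_gt0.
rewrite ball_average_indic// mulrC ler_pdivrMr// mul1r.
rewrite -lee_fin -(lebesgue_eball x d0 (ltW r0)) fineK; last first.
  rewrite ge0_fin_numE//; apply: le_lt_trans (lebesgue_eball_lty x r).
  apply: measure_mono; [|exact: measurable_eball|exact: subIsetr].
  by apply: measurableI => //; exact: measurable_eball.
apply: measure_mono; [|exact: measurable_eball|exact: subIsetr].
by apply: measurableI => //; exact: measurable_eball.
Qed.

Definition open_box (lo hi : 'I_d -> R) : set E := box (fun i => `]lo i, hi i[%classic).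

Lemma measurable_open_box lo hi : measurable (open_box lo hi).
Proof. by apply: measurable_box => i; exact: measurable_itv. Qed.

Lemma lebesgue_bounded_box (lo hi : 'I_d -> R) :
  (lam (box (fun i => `[lo i, hi i]%classic)) < +oo)%E.
Proof.
rewrite lebesgue_box; last by move=> i; exact: measurable_itv.
rewrite ltey_eq prode_fin_num// => i _.
by rewrite lebesgue_measure_itv/=; case: ifP.
Qed.

Lemma open_box_lty lo hi : (lam (open_box lo hi) < +oo)%E.
Proof.
apply: le_lt_trans (lebesgue_bounded_box lo hi).
apply: measure_mono; first exact: measurable_open_box.
  by apply: measurable_box => i; exact: measurable_itv.
by move=> x xB i; have := xB i; rewrite /= !in_itv/= => /andP[/ltW-> /ltW->].
Qed.

Lemma open_box_radius lo hi x : open_box lo hi x ->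
  exists2 e : R, 0 < e & eball x e `<=` open_box lo hi.
Proof.
move=> xB.
pose m i := Num.min (tnth x i - lo i) (hi i - tnth x i).
have m0 i : 0 < m i.
  by have := xB i; rewrite /= in_itv/= /m lt_min !subr_gt0.
pose e := (\big[Num.min/1]_i m i) / 2.
have e0 : 0 < \big[Num.min/1]_i m i.
  by apply: lt_bigmin => // i _; exact: m0.
exists e; first by rewrite divr_gt0.
move=> y /= xy i; rewrite /= in_itv/=.
have := le_trans (le_coord_euclid_dist x y i) xy.
have : \big[Num.min/1]_i m i <= m i by exact: bigmin_le.
rewrite {2}/m /e le_min ler_norml => /andP[h1 h2] /andP[h3 h4].
by apply/andP; split; lra.
Qed.

Lemma eball_off_box lo hi x i (r : R) :
  tnth x i + r <= lo i \/ hi i <= tnth x i - r ->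
  open_box lo hi `&` eball x r = set0.
Proof.
move=> xi; apply/seteqP; split => // y [yB /= xy].
have := le_trans (le_coord_euclid_dist x y i) xy.
have := yB i; rewrite /= in_itv/= ler_norml => /andP[h1 h2] /andP[h3 h4].
by case: xi => h; lra.
Qed.

(** Off the boundary, which is null, the averages over small balls equal the
    indicator; all of them vanish outside the box enlarged by 1. *)
Lemma averages_converge_open_box lo hi : averages_converge (\1_(open_box lo hi) : E -> R).
Proof.
set B := open_box lo hi.
have mB : measurable B by exact: measurable_open_box.
have iB : integrable (\1_B : E -> R).
  by apply: integrable_indic_lty => //; exact: open_box_lty.
split => // r_ [r1 r_0].
have rp n : 0 < r_ n by have /andP[] := r1 n.
pose Q : set E := box (fun i => `[lo i - 1, hi i + 1]%classic).
have mQ : measurable Q by apply: measurable_box => i; exact: measurable_itv.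
have iQ : integrable (\1_Q : E -> R).
  by apply: integrable_indic_lty => //; exact: lebesgue_bounded_box.
rewrite (_ : 0%E = \int[lam]_x (cst 0%E x))%E; last by rewrite integral0.
have aeN : {ae lam, forall x : E, forall k : nat, forall i : 'I_d, i = k :> nat ->
    tnth x i <> lo i /\ tnth x i <> hi i}.
  apply/ae_foralln => k; have [kd|kd] := ltnP k d; last first.
    by apply: aeW => x i ik; move: (ltn_ord i); rewrite ik ltnNge kd.
  pose i0 := Ordinal kd.
  exists ([set x : E | tnth x i0 = lo i0] `|` [set x : E | tnth x i0 = hi i0]); split.
  - by apply: measurableU; apply: measurable_hyperplane.
  - by rewrite null_set_setU//; first [exact: hyperplane_null|exact: measurable_hyperplane].
  - move=> x /= xk; apply: contrapT => /not_orP[x1 x2]; apply: xk => i ik.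
    by rewrite (_ : i = i0)//; exact: val_inj.
have [] := @dominated_convergence _ _ _ lam setT measurableT
  (fun n x => `|(ball_average (r_ n) (\1_B) x - \1_B x)%:E|%E) (cst 0%E)
  (fun x => (\1_Q x)%:E) => //.
- by move=> n; apply: measurable_deviation => //; exact: ltW.
- move: aeN; apply: filterS => x xN _; apply: cvg_near_cst.
  have [e e0 He] : exists2 e : R, 0 < e & forall r : R, 0 < r -> r < e ->
      ball_average r (\1_B) x = \1_B x.
    have [xB|xB] := pselect (B x).
      have [e e0 eB] := open_box_radius xB; exists e => // r r0 re.
      rewrite ball_average_indic_sub//; first by rewrite indicE mem_set.
      by move=> y xy; apply: eB; exact: le_trans xy (ltW re).
    have [i xi] : exists i, ~ (`]lo i, hi i[%classic (tnth x i)).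
      by apply: contrapT => /forallNP h; apply: xB => i; exact: contrapT.
    have [xlo xhi] := xN i i erefl.
    have [xl|xl] := leP (tnth x i) (lo i).
      exists (lo i - tnth x i) => [|r r0 re].
        by rewrite subr_gt0 lt_neqAle xl andbT; apply/eqP.
      rewrite ball_average_indic_disjoint//; first by rewrite indicE memNset.
      by apply: (@eball_off_box _ _ _ i); left; lra.
    have {}xi : hi i <= tnth x i.
      by rewrite leNgt; apply/negP => h; apply: xi; rewrite /= in_itv/= xl.
    exists (tnth x i - hi i) => [|r r0 re].
      by rewrite subr_gt0 lt_neqAle xi andbT; apply/eqP => h; apply: xhi.
    rewrite ball_average_indic_disjoint//; first by rewrite indicE memNset.
    by apply: (@eball_off_box _ _ _ i); right; lra.
  have /cvgr0Pnorm_lt/(_ e e0) := r_0; apply: filterS => n.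
  rewrite ger0_norm ?(ltW (rp n))// => re.
  by rewrite He// subrr abse0.
- apply: aeW => x n _; rewrite abse_id lee_fin.
  have a0 := ball_average_indic_ge0 x mB (ltW (rp n)).
  have a1 := ball_average_indic_le1 x mB (rp n).
  rewrite [leRHS]indicE; have [xQ|xQ] := boolP (x \in Q).
    rewrite ler_norml; rewrite indicE; case: (x \in B) => /=; apply/andP; split; lra.
  have {}xQ : ~ Q x by move=> h; move/negP: xQ; apply; exact: mem_set.
  have [i xi] : exists i, ~ (`[lo i - 1, hi i + 1]%classic (tnth x i)).
    by apply: contrapT => /forallNP h; apply: xQ => i; exact: contrapT.
  have xB : ~ B x.
    move=> xB; apply: xi; have := xB i; rewrite /= !in_itv/= => /andP[h1 h2].
    by apply/andP; split; lra.
  rewrite ball_average_indic_disjoint//; last first.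
    apply: (@eball_off_box _ _ _ i); move: xi; rewrite /= in_itv/= => /negP.
    rewrite negb_and -!ltNge; have /andP[_ rn1] := r1 n.
    by case/orP => h; [left|right]; lra.
  by rewrite indicE memNset// subrr normr0.
Qed.

Lemma indic_ndseq_cvg (F : (set E)^nat) : nondecreasing_seq F ->
  (forall k, measurable (F k)) -> (lam (\bigcup_k F k) < +oo)%E ->
  (\int[lam]_x `|(\1_(\bigcup_k F k) x - \1_(F k) x)%:E| @[k --> \oo] --> 0)%E.
Proof.
move=> ndF mF UF; have mU : measurable (\bigcup_k F k) by exact: bigcupT_measurable.
rewrite (_ : 0%E = \int[lam]_x (cst 0%E x))%E; last by rewrite integral0.
have sub k : F k `<=` \bigcup_k F k by move=> x; exists k.
have [] := @dominated_convergence _ _ _ lam setT measurableT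
  (fun k x => `|(\1_(\bigcup_k F k) x - \1_(F k) x)%:E|%E) (cst 0%E)
  (fun x => (\1_(\bigcup_k F k) x)%:E) => //.
- move=> k; apply: measurableT_comp => //; apply/measurable_EFinP.
  by apply: measurable_funB; exact: measurable_indic.
- apply: aeW => x _; apply: cvg_near_cst.
  have [[k _ Fx]|xU] := pselect ((\bigcup_k F k) x); last first.
    apply: nearW => k; rewrite !indicE !memNset//; last by move=> /sub.
    by rewrite subrr; exact: abse0.
  near=> n; have Fn : F n x.
    have : F k `<=` F n by apply/subsetPset/ndF; near: n; exact: nbhs_infty_ge.
    exact.
  by rewrite !indicE !mem_set//; [rewrite subrr; exact: abse0|exact: (sub k)].
- exact: integrable_indic_lty.
- apply: aeW => x k _; rewrite abse_id lee_fin !indicE.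
  have [xF|xF] := boolP (x \in F k); last first.
    by rewrite subr0 normr_nat.
  by rewrite mem_set ?subrr ?normr0//; apply: (sub k); exact: set_mem.
Unshelve. all: end_near. Qed.

(** The sets whose indicators, cut by a bounded box, have convergent ball
    averages form a lambda-system that contains the boxes. *)
Lemma averages_converge_bounded (M : R) A : measurable A ->
  averages_converge (\1_(A `&` open_box (fun=> - M) (fun=> M)) : E -> R).
Proof.
set Q := open_box _ _.
have mQ : measurable Q by exact: measurable_open_box.
have AQoo X : measurable X -> (lam (X `&` Q) < +oo)%E.
  move=> mX; apply: le_lt_trans (open_box_lty (fun=> - M) (fun=> M)).
  by apply: measure_mono => //; exact: measurableI.
pose G0 : set (set (measurableTypeR R)) := [set X | X = setT \/ exists a, X = `]-oo, a[%classic].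
have G0m : measurable = <<s G0 >>.
  have -> : measurable = <<s @RGenInftyO.G R >> :> set (set (measurableTypeR R)).
    exact: RGenInftyO.measurableE.
  apply/seteqP; split.
    apply: smallest_sub; first exact: smallest_sigma_algebra.
    by move=> X [a ->]; apply: sub_sigma_algebra; right; exists a.
  apply: smallest_sub; first exact: smallest_sigma_algebra.
  move=> X [->|[a ->]]; last by apply: sub_sigma_algebra; exists a.
  exact: (@measurableT _ (g_sigma_algebraType (@RGenInftyO.G R))).
pose G := [set box A | A in [set A : 'I_d -> set (measurableTypeR R) | forall i, G0 (A i)]].
pose H := [set X : set E | measurable X /\ averages_converge (\1_(X `&` Q) : E -> R)].
suff : <<s G >> `<=` H.
  have G0T : G0 setT by left.
  by rewrite /G -(measurable_tuple_boxes d G0T G0m) => GH mA; case: (GH A mA).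
apply: lambda_system_subset => //.
- move=> _ _ [X GX <-] [Y GY <-]; rewrite boxI; exists (fun i => X i `&` Y i) => // i.
  have [->|[a ->]] := GX i; have [->|[b ->]] := GY i; rewrite ?setTI ?setIT.
  + by left.
  + by right; exists b.
  + by right; exists a.
  + right; exists (Num.min a b); apply/seteqP; split => z /=; rewrite !in_itv/= lt_min.
      by case=> -> ->.
    by case/andP.
- split=> //.
  + split=> //; rewrite setTI; exact: averages_converge_open_box.
  + move=> X Y YX [mX cX] [mY cY]; split; first exact: measurableD.
    rewrite (_ : \1_((X `\` Y) `&` Q) =
        (\1_(X `&` Q) \+ (fun x => (-1) * \1_(Y `&` Q) x)) :> (E -> R)).
      by apply: averages_convergeD => //; exact: averages_convergeZ.
    apply/funext => x /=; rewrite mulN1r !indicE.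
    have [xQ|xQ] := pselect (Q x); last first.
      by rewrite !memNset ?subr0//= => -[].
    have [xY|xY] := pselect (Y x).
      by rewrite memNset ?mem_set ?subrr//=; [split=> //; exact: YX|case=> -[]].
    rewrite (memNset (A := Y `&` Q)) ?subr0; last by case.
    have [xX|xX] := pselect (X x); first by rewrite !mem_set.
    by rewrite !memNset//; [case|case=> -[]].
  + move=> F ndF HF; split; first by apply: bigcupT_measurable => k; case: (HF k).
    apply: (averages_converge_limit d0 (h_ := fun k => \1_(F k `&` Q))).
    * have mU : measurable (\bigcup_k F k).
        by apply: bigcupT_measurable => k; case: (HF k).
      by apply: integrable_indic_lty; [exact: measurableI|exact: AQoo].
    * by move=> k; case: (HF k).
    * rewrite setI_bigcupl; apply: (@indic_ndseq_cvg (fun k => F k `&` Q)).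
      - by move=> m n mn; apply/subsetPset; apply: setSI; exact/subsetPset/ndF.
      - by move=> k; apply: measurableI => //; case: (HF k).
      - by rewrite -setI_bigcupl; apply: AQoo; apply: bigcupT_measurable => k; case: (HF k).
- move=> _ [X GX <-]; split.
    by apply: measurable_box => i; have [->|[a ->]] := GX i.
  have /choice[hi hiE] i : exists b, X i `&` `]- M, M[%classic = `]-M, b[%classic.
    have [->|[a ->]] := GX i; first by exists M; rewrite setTI.
    exists (Num.min a M); apply/seteqP; split => z /=; rewrite !in_itv/= lt_min.
      by case=> -> /andP[-> ->].
    by case/and3P => -> -> ->.
  rewrite (_ : box X `&` Q = open_box (fun=> - M) hi).
    exact: averages_converge_open_box.
  by rewrite boxI; congr box; apply/funext => i; rewrite hiE.
Qed.

Lemma averages_converge_indic A : measurable A -> (lam A < +oo)%E ->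
  averages_converge (\1_A : E -> R).
Proof.
move=> mA Aoo; pose Q (k : nat) : set E := open_box (fun=> - k%:R) (fun=> k%:R).
have mQ k : measurable (Q k) by exact: measurable_open_box.
have ndQ : nondecreasing_seq Q.
  move=> m n mn; apply/subsetPset => x xQ i; have := xQ i.
  rewrite /= !in_itv/= => /andP[h1 h2].
  have : m%:R <= n%:R :> R by rewrite ler_nat.
  by move=> mn'; apply/andP; split; lra.
have UQ : A = \bigcup_k (A `&` Q k).
  rewrite -setI_bigcupr; apply/esym/setIidPl => x _.
  exists (Num.truncn (euclid_dist (evec0 R d) x)).+1 => // i.
  rewrite /= in_itv/= -ltr_norml; apply: le_lt_trans (truncnS_gt _).
  have := le_coord_euclid_dist (evec0 R d) x i.
  by rewrite tnth_mktuple sub0r normrN.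
rewrite UQ; apply: (averages_converge_limit d0 (h_ := fun k => \1_(A `&` Q k))).
- by rewrite -UQ; exact: integrable_indic_lty.
- by move=> k; exact: averages_converge_bounded.
- apply: (@indic_ndseq_cvg (fun k => A `&` Q k)).
  + by move=> m n mn; apply/subsetPset; apply: setIS; exact/subsetPset/ndQ.
  + by move=> k; exact: measurableI.
  + by rewrite -UQ.
Qed.

Import HBSimple.

Lemma averages_converge_sfun (g : {sfun E >-> R}) : integrable g -> averages_converge g.
Proof.
move=> ig.
have mg y : measurable (g @^-1` [set y]) by exact: preimage_measurable.
have zero : averages_converge ((fun=> 0) : E -> R).
  have := averages_convergeZ d0 0 (@averages_converge_indic set0 measurable0 _).
  rewrite measure0 => /(_ (ltry _)).
  by rewrite (_ : (fun _ => _) = (fun=> 0))//; apply/funext => x; rewrite mul0r.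
have -> : (g : E -> R) = (fun x => \sum_(y <- fset_set (range g)) y * \1_(g @^-1` [set y]) x).
  by apply/funext => x; rewrite {1}fimfunE fsbig_finite.
elim: (fset_set (range g) : seq R) => [|y s IH].
  by under eq_fun do rewrite big_nil.
under eq_fun do rewrite big_cons.
apply: (@averages_convergeD _ _ d0 (fun x => y * \1_(g @^-1` [set y]) x)) => //.
have [->|y0] := eqVneq y 0.
  by under eq_fun do rewrite mul0r.
apply: averages_convergeZ => //; apply: averages_converge_indic => //.
have [_ goo] := integrableP _ _ _ ig.
rewrite -(@lte_pmul2l _ `|y|%:E) ?lte_fin ?normr_gt0//.
rewrite gt0_muley ?lte_fin ?normr_gt0//; apply: le_lt_trans goo.
rewrite -[X in (_ * lam X)%E]setIT -integral_indic// -ge0_integralZl//; last first.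
  by apply/measurable_EFinP; exact: measurable_indic.
apply: ge0_le_integral => //.
- apply: emeasurable_funM => //.
  by apply/measurable_EFinP; exact: measurable_indic.
- by apply: measurableT_comp => //; exact/measurable_EFinP.
move=> x _; rewrite -EFinM lee_fin indicE.
have [/set_mem/= <-|_] := boolP (x \in _); first by rewrite mulr1.
by rewrite mulr0.
Qed.

(** Lebesgue differentiation in mean. *)
Theorem averages_converge_integrable (g : E -> R) : integrable g -> averages_converge g.
Proof.
move=> ig; have [h_ [ih _ hg]] := approximation_sfun_integrable measurableT ig.
apply: (averages_converge_limit d0 (h_ := h_)) => // k.
exact: averages_converge_sfun.
Qed.

End l1_convergence.

(** * The law of a nearest neighbour distance *)

Section density_change.
Context d (T : measurableType d) (R : realType).
Context (mu : {finite_measure set T -> \bar R}) (nu : {sigma_finite_measure set T -> \bar R}).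
Variable f : T -> R.
Hypothesis mf : measurable_fun setT f.
Hypothesis f0 : forall x, 0 <= f x.
Hypothesis density : forall A, measurable A -> mu A = (\int[nu]_(x in A) (f x)%:E)%E.

Let mEf : measurable_fun setT (EFin \o f). Proof. exact/measurable_EFinP. Qed.

(** [f] is almost everywhere the Radon-Nikodym derivative of [mu]. *)
Lemma ge0_integral_density (g : T -> \bar R) : measurable_fun setT g ->
  (forall x, (0 <= g x)%E) -> (\int[mu]_x g x = \int[nu]_x (g x * (f x)%:E))%E.
Proof.
move=> mg g0; have dom : mu `<< nu.
  apply/null_content_dominatesP => A mA A0.
  by rewrite density// null_set_integral//; exact: measurable_funTS.
rewrite -(Radon_Nikodym_SigmaFinite.change_of_variables dom)//.
apply: ae_eq_integral => //.
- apply: emeasurable_funM => //.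
  exact: measurable_int (Radon_Nikodym_SigmaFinite.f_integrable dom).
- exact: emeasurable_funM.
- apply: ae_eqe_mul2l; apply: integral_ae_eq => //.
    exact: Radon_Nikodym_SigmaFinite.f_integrable.
  move=> A _ mA; rewrite -Radon_Nikodym_SigmaFinite.f_integral//.
  exact: density.
Qed.

Lemma integral_density (g : T -> R) : mu.-integrable setT (EFin \o g) ->
  (\int[mu]_x (g x)%:E = \int[nu]_x (g x * f x)%:E)%E.
Proof.
move=> /integrableP[mg _].
have partE (h : T -> \bar R) (k : T -> \bar R) : measurable_fun setT h ->
    (forall x, (0 <= h x)%E) -> (forall x, (h x * (f x)%:E = k x)%E) ->
    (\int[mu]_x h x = \int[nu]_x k x)%E.
  by move=> mh h0 hk; rewrite ge0_integral_density//; apply: eq_integral => x _.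
rewrite integralE [RHS]integralE; congr (_ - _)%E; apply: partE.
- exact: measurable_funepos.
- by move=> x; exact: funepos_ge0.
- by move=> x; rewrite !funeposE /= -!EFin_max -EFinM maxr_pMl// mul0r.
- exact: measurable_funeneg.
- by move=> x; exact: funeneg_ge0.
- by move=> x; rewrite !funenegE /= -!EFin_max -EFinM maxr_pMl// mul0r mulNr.
Qed.

End density_change.

Section nearest_neighbour_law.
Context (R : realType) (d : nat).
Hypothesis d0 : (0 < d)%N.
Local Notation E := (d.-tuple (measurableTypeR R)).
Local Notation lam := (lebesgue_tuple R d).
Local Notation v := (unit_ball_volume R d).
Variable f : E -> R.
Hypothesis mf : measurable_fun setT f.
Hypothesis f0 : forall x, 0 <= f x.
Hypothesis f1 : (\int[lam]_x (f x)%:E)%E = 1%E.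
Context dT (T : measurableType dT) (P : probability T R) (X : nat -> {RV P >-> E}).
Hypothesis hind : mutually_independent X.
Hypothesis hX : forall i A, measurable A ->
  P (X i @^-1` A) = (\int[lam]_(x in A) (f x)%:E)%E.

Local Notation mu := (distribution P (X 0%N)).

Lemma law_eq i A : measurable A -> P (X i @^-1` A) = mu A.
Proof. by move=> mA; rewrite hX//; symmetry; exact: hX. Qed.

Lemma law_density A : measurable A -> mu A = (\int[lam]_(x in A) (f x)%:E)%E.
Proof. exact: hX. Qed.

Let mEf : measurable_fun setT (EFin \o f). Proof. exact/measurable_EFinP. Qed.

Lemma integrable_density : lam.-integrable setT (EFin \o f).
Proof.
apply/integrableP; split => //.
rewrite (eq_integral (EFin \o f)) ?f1 ?ltry// => x _.
by rewrite /= ger0_norm.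
Qed.

Lemma ge0_integral_law (g : E -> \bar R) : measurable_fun setT g ->
  (forall x, (0 <= g x)%E) -> (\int[mu]_x g x = \int[lam]_x (g x * (f x)%:E))%E.
Proof. by move=> mg g0; apply: ge0_integral_density => // A; exact: law_density. Qed.

Definition ball_mass (r : R) (x : E) : R := fine (mu (eball x r)).

Lemma ball_massE r x : mu (eball x r) = (ball_mass r x)%:E.
Proof. by rewrite /ball_mass fineK// fin_num_measure//; exact: measurable_eball. Qed.

Lemma ball_mass_ge0 r x : 0 <= ball_mass r x.
Proof. by rewrite fine_ge0. Qed.

Lemma ball_mass_le1 r x : ball_mass r x <= 1.
Proof. by rewrite -lee_fin -ball_massE; apply: probability_le1; exact: measurable_eball. Qed.

Lemma measurable_ball_mass r : measurable_fun setT (ball_mass r).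
Proof.
apply/measurable_EFinP.
rewrite (_ : _ \o _ = (fun x => \int[lam]_(y in eball x r) (f y)%:E)%E).
  by apply: measurable_ge0_integral_eball => // x; rewrite lee_fin.
apply/funext => x /=; rewrite -ball_massE law_density//.
exact: measurable_eball.
Qed.

Lemma ball_mass_average r x : 0 < r ->
  ball_mass r x = r ^+ d * v * ball_average r f x.
Proof.
move=> r0; rewrite /ball_average mulVKf; last first.
  by rewrite gt_eqF// mulr_gt0 ?exprn_gt0// unit_ball_volume_gt0.
by rewrite /ball_mass law_density//; exact: measurable_eball.
Qed.

Let swap0 (i k : nat) := if k == 0%N then i else if k == i then 0%N else k.

Let swap0K i : involutive (swap0 i).
Proof.
move=> k; rewrite /swap0; have [->|k0] := eqVneq k 0%N.
  by have [->|i0] := eqVneq i 0%N; rewrite ?eqxx.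
by have [->|ki] := eqVneq k i; rewrite ?eqxx// (negbTE k0) (negbTE ki).
Qed.

Let swap0_lt i k n : (i < n)%N -> (k < n)%N -> (swap0 i k < n)%N.
Proof.
move=> ilt klt; rewrite /swap0; case: (k == 0)%N => //.
by case: (k == i) => //; exact: leq_ltn_trans klt.
Qed.

(** Given [X i = x], the other points are independent and each avoids the ball
    around [x] with the same probability. *)
Lemma nn_dist_gt_probability m (i : 'I_m.+1) A (r : R) : (0 < m)%N -> measurable A ->
  P [set w | A (X i w) /\ r < nn_dist (fun j => X j w) i (X i w)] =
  (\int[mu]_(x in A) ((1 - ball_mass r x) ^+ m)%:E)%E.
Proof.
move=> m0 mA; have swI : injective (swap0 i) := inv_inj (swap0K i).
pose C := [set t : m.+1.-tuple E | A (thead t) /\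
  forall k : 'I_m, r < euclid_dist (thead t) (tnth t (lift ord0 k))].
have mC : measurable C.
  have -> : C = (fun t => tnth t ord0) @^-1` A `&` \bigcap_(k : 'I_m)
      ((fun t : m.+1.-tuple E =>
         euclid_dist (tnth t ord0) (tnth t (lift ord0 k))) @^-1` `]r, +oo[%classic).
    apply/seteqP; split => t [tA tr]; split => //.
      by move=> k _ /=; rewrite in_itv/= andbT; exact: tr.
    by move=> k; have := tr k I; rewrite /= in_itv/= andbT.
  apply: measurableI; first by apply: preimage_measurable => //; exact: measurable_tnth.
  apply: fin_bigcap_measurable => // k _; apply: preimage_measurable => //.
  by apply: measurable_euclid_dist; exact: measurable_tnth.
have -> : [set w | A (X i w) /\ r < nn_dist (fun j => X j w) i (X i w)] =
    sample X (swap0 i) m.+1 @^-1` C.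
  have sw0 : swap0 i 0 = i by [].
  apply/seteqP; split => w /=; rewrite /C /= /thead tnth_mktuple sw0 => -[Aw].
    move=> /nn_dist_gtP h; split => // k; rewrite tnth_mktuple.
    have swlt : (swap0 i (lift ord0 k) < m.+1)%N.
      by apply: swap0_lt; exact: ltn_ord.
    apply: (h _ (Ordinal swlt)) => //.
    apply/eqP => /(congr1 val)/= /(congr1 (swap0 i)); rewrite swap0K.
    by rewrite /swap0 eqxx; case: ifP => [/eqP->|].
  move=> h; split => //; apply/nn_dist_gtP => // j ji.
  have [k kE] : exists k : 'I_m, swap0 i (lift ord0 k) = j.
    have jlt : (swap0 i j < m.+1)%N.
      by apply: swap0_lt; exact: ltn_ord.
    have j0 : swap0 i j != 0%N.
      apply/eqP => /(congr1 (swap0 i)); rewrite swap0K /swap0 eqxx => ij.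
      by move/eqP: ji; apply; apply: val_inj.
    have k0 : (ord0 : 'I_m.+1) != Ordinal jlt by rewrite -val_eqE/= eq_sym.
    have [k kE _] := unlift_some k0; exists k.
    by rewrite -kE /= swap0K.
  by have := h k; rewrite tnth_mktuple kE.
rewrite (sample_same_law hind law_eq swI mC).
have -> : sample_law X m.+1 C = (\int[sample_law X m.+1]_t (\1_C t)%:E)%E.
  by rewrite integral_indic// setIT.
rewrite (ge0_integral_sample_lawS hind law_eq); last 2 first.
- by apply/measurable_EFinP; exact: measurable_indic.
- by move=> t; rewrite lee_fin.
rewrite [RHS]integral_mkcond; apply: eq_integral => x _.
rewrite patchE; pose B (k : 'I_m) : set E := ~` eball x r.
have mB k : measurable (B k) by apply: measurableC; exact: measurable_eball.
have CE (t : m.-tuple E) : (\1_C [tuple of x :: t])%:E =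
    ((\1_A x)%:E * (\1_(box B) t)%:E)%E :> \bar R.
  rewrite -EFinM !indicE -natrM mulnb; congr ((nat_of_bool _)%:R%:E).
  have CB : C [tuple of x :: t] <-> A x /\ box B t.
    split => -[Ax h]; split => // k.
      by have := h k; rewrite theadE tnthS /B /eball /= => /lt_geF ->.
    have := h k; rewrite theadE tnthS /B /eball /= => /negP.
    by rewrite -ltNge.
  apply/idP/andP => [/set_mem/CB[? ?]|[/set_mem ? /set_mem ?]].
    by split; apply: mem_set.
  by apply: mem_set; apply/CB.
under eq_integral do rewrite CE.
rewrite ge0_integralZl//; last first.
  by apply/measurable_EFinP; apply: measurable_indic; exact: measurable_box.
rewrite integral_indic//; last exact: measurable_box.
rewrite setIT [X in (_ * X)%E](_ : _ = (\prod_(k < m) mu (B k))%E); last first.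
  exact: (sample_law_box hind law_eq mB).
rewrite indicE.
case: ifPn => xA; last by rewrite mul0e.
rewrite mul1e (eq_bigr (fun=> (1 - ball_mass r x)%:E)).
  by rewrite prodEFin prodr_const card_ord.
move=> k _; rewrite /B EFinB -ball_massE; apply: probability_setC.
exact: measurable_eball.
Qed.

End nearest_neighbour_law.

(** * Tails of the logarithmic volume *)

Section scalar_estimates.
Context (R : realType).
Implicit Types b c x y : R.

Lemma bernoulli c m : 0 <= c <= 1 -> 1 - m%:R * c <= (1 - c) ^+ m.
Proof.
move=> /andP[c0 c1]; elim: m => [|m IH]; first by rewrite mul0r subr0 expr0.
have c2 : 0 <= 1 - c by lra.
apply: le_trans (_ : (1 - c) * (1 - m%:R * c) <= _); last by rewrite exprS ler_wpM2l.
rewrite -natr1; have : 0 <= m%:R * c ^+ 2 by rewrite mulr_ge0// sqr_ge0.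
by nra.
Qed.

Lemma exprB_le_expR b m : b <= 1 -> (1 - b) ^+ m <= expR (- (m%:R * b)).
Proof.
move=> b1; have -> : expR (- (m%:R * b)) = expR (- b) ^+ m.
  by rewrite -expRM_natl mulrN.
by apply: lerXn2r; rewrite ?nnegrE ?expR_ge0 ?subr_ge0//; exact: expR_ge1Dx.
Qed.

(** The error of the exponential approximation is uniform in the success
    probability [b]. *)
Lemma expR_le_exprB b m : (0 < m)%N -> 0 <= b <= 1 ->
  expR (- (m%:R * b)) <= (1 - b) ^+ m + 2 / m%:R.
Proof.
move=> m0 /andP[b0 b1]; have mR : (0 : R) < m%:R by rewrite ltr0n.
set e := expR (m%:R * b); have e0 : 0 < e by exact: expR_gt0.
have eX : e = expR b ^+ m by rewrite -expRM_natl.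
have h1 : 1 - m%:R * b ^+ 2 <= (1 - b) ^+ m * e.
  rewrite eX -exprMn; apply: (@le_trans _ _ ((1 - b ^+ 2) ^+ m)).
    by apply: bernoulli; rewrite sqr_ge0 expr_le1.
  have b2 : b ^+ 2 <= 1 by rewrite expr_le1.
  have be : 1 - b ^+ 2 <= (1 - b) * expR b.
    by have := expR_ge1Dx b; nra.
  by apply: lerXn2r; rewrite ?nnegrE//; lra.
have h2 : m%:R * b ^+ 2 <= e * (2 / m%:R).
  have mb0 : 0 <= m%:R * b by rewrite mulr_ge0// ltW.
  have := expR_ge1Dxn 1 mb0; rewrite -/e exprMn (_ : 2`! = 2%N)// => h.
  rewrite [leRHS]mulrA ler_pdivlMr//; have -> : m%:R * b ^+ 2 * m%:R = m%:R ^+ 2 * b ^+ 2 by ring.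
  by lra.
rewrite expRN -/e -[e^-1]div1r ler_pdivrMr// mulrDl (mulrC (2 / _)).
by move: h1 h2; set p := _ * e; set q := e * _; lra.
Qed.

Lemma expRN_lipschitz x y : 0 <= x -> 0 <= y -> expR (- x) <= expR (- y) + `|x - y|.
Proof.
move=> x0 y0; have [xy|xy] := leP y x.
  by rewrite (@le_trans _ _ (expR (- y)))// ?ler_expR ?lerN2// lerDl.
have -> : expR (- y) = expR (- x) * expR (- (y - x)) by rewrite -expRD; congr expR; ring.
have h1 := expR_ge1Dx (- (y - x)); have h2 : expR (- x) <= 1 by rewrite expR_le1 oppr_le0.
have h3 := expR_gt0 (- x); rewrite ltr0_norm ?subr_lt0//; nra.
Qed.

End scalar_estimates.

Lemma measurable_nn_dist (R : realType) (d : nat) dT (T : measurableType dT)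
    (u : nat -> T -> d.-tuple (measurableTypeR R)) n (i : 'I_n) :
  (forall j, measurable_fun setT (u j)) ->
  measurable_fun setT (fun w => nn_dist (u ^~ w) i (u i w)).
Proof.
move=> mu; rewrite /nn_dist.
apply: (measurableT_comp (fine_measurable measurableT)).
elim: (index_enum _) => [|j s IH].
  by under eq_fun do rewrite big_nil; exact: measurable_cst.
under eq_fun do rewrite big_cons.
case: (j != i) => //; apply: measurable_mine => //.
by apply/measurable_EFinP; exact: measurable_euclid_dist.
Qed.

Section nearest_neighbour_tails.
Context (R : realType) (d : nat).
Hypothesis d0 : (0 < d)%N.
Local Notation E := (d.-tuple (measurableTypeR R)).
Local Notation lam := (lebesgue_tuple R d).
Local Notation v := (unit_ball_volume R d).
Variable f : E -> R.
Hypothesis mf : measurable_fun setT f.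
Hypothesis f0 : forall x, 0 <= f x.
Hypothesis f1 : (\int[lam]_x (f x)%:E)%E = 1%E.
Context dT (T : measurableType dT) (P : probability T R) (X : nat -> {RV P >-> E}).
Hypothesis hind : mutually_independent X.
Hypothesis hX : forall i A, measurable A ->
  P (X i @^-1` A) = (\int[lam]_(x in A) (f x)%:E)%E.

Local Notation mu := (distribution P (X 0%N)).
Local Notation mass := (ball_mass X).

Let v0 : 0 < v. Proof. exact: unit_ball_volume_gt0. Qed.

Let mEf : measurable_fun setT (EFin \o f). Proof. exact/measurable_EFinP. Qed.

(** The radius [r] with [m * r ^ d * v = e ^ s]. *)
Definition nn_radius (m : nat) (s : R) : R := expR ((s - ln (m%:R * v)) / d%:R).

Lemma nn_radius_gt0 m s : 0 < nn_radius m s. Proof. exact: expR_gt0. Qed.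

Lemma nn_radiusX m s : (0 < m)%N -> m%:R * (nn_radius m s ^+ d * v) = expR s.
Proof.
move=> m0; have mv : 0 < m%:R * v by rewrite mulr_gt0// ltr0n.
have -> : nn_radius m s ^+ d = expR (s - ln (m%:R * v)).
  by rewrite /nn_radius -expRM_natl mulrC divfK// pnatr_eq0 -lt0n.
rewrite expRD expRN lnK// mulrCA [X in _ * X]mulrC mulrA.
by rewrite -mulrA [X in _ * X]mulrC -mulrA mulVf ?mulr1// gt_eqF.
Qed.

Lemma nn_radius_cvg0 s : nn_radius m s @[m --> \oo] --> (0 : R).
Proof.
apply/cvgr0Pnorm_lt => e e0; near=> m.
rewrite ger0_norm ?(ltW (nn_radius_gt0 _ _))//.
have m0 : (0 < m)%N by near: m; exact: nbhs_infty_gt.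
rewrite -(ltr_pXn2r d0) ?nnegrE ?(ltW (nn_radius_gt0 _ _)) ?(ltW e0)//.
rewrite -(ltr_pM2r v0) -(@ltr_pM2l _ m%:R) ?ltr0n// nn_radiusX//.
have c0 : 0 < e ^+ d * v by rewrite mulr_gt0// exprn_gt0.
rewrite -ltr_pdivrMr// (lt_le_trans (truncnS_gt _))// ler_nat.
by near: m; exact: nbhs_infty_ge.
Unshelve. all: end_near. Qed.

(** By [nn_dist_gt_probability], the probability that a given point is farther
    than [nn_radius m s] from [m] other ones. *)
Definition survival m s : \bar R := (\int[mu]_x ((1 - mass (nn_radius m s) x) ^+ m)%:E)%E.

Let mass01 r x : 0 <= mass r x <= 1.
Proof. by rewrite ball_mass_ge0 ball_mass_le1. Qed.

Let pow01 r x m : 0 <= (1 - mass r x) ^+ m <= 1.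
Proof.
have /andP[b0 b1] := mass01 r x.
by rewrite exprn_ge0 ?subr_ge0// exprn_ile1 ?subr_ge0// gerBl.
Qed.

Let measurable_pow r m : measurable_fun setT (fun x => (1 - mass r x) ^+ m).
Proof.
apply: measurable_funX; apply: measurable_funB => //.
exact: (measurable_ball_mass mf f0 hX).
Qed.

Let Rn m (i : 'I_m.+1) w := nn_dist (fun j => X j w) i (X i w).

Let mRn m (i : 'I_m.+1) : measurable_fun setT (Rn i).
Proof. by apply: (measurable_nn_dist (u := fun j => X j)) => j. Qed.

Let measurable_gt m (i : 'I_m.+1) (A : set E) r : measurable A ->
  measurable [set w | A (X i w) /\ r < Rn i w].
Proof.
move=> mA; have mXA : measurable (X i @^-1` A) by exact: preimage_measurable.
exact: measurableI mXA (measurable_gt_set r (mRn i)).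
Qed.

Let measurable_le m (i : 'I_m.+1) (A : set E) r : measurable A ->
  measurable [set w | A (X i w) /\ Rn i w <= r].
Proof.
move=> mA; have mXA : measurable (X i @^-1` A) by exact: preimage_measurable.
exact: measurableI mXA (measurable_le_set r (mRn i)).
Qed.

(** The union bound over the other points, averaged with Tonelli: a density
    at most [K] at the first point leaves [m] times the volume of the ball. *)
Lemma nn_dist_small_probability m (i : 'I_m.+1) (A : set E) (r K : R) : (0 < m)%N ->
  measurable A -> 0 <= r -> 0 <= K -> (forall x, A x -> f x <= K) ->
  (P [set w | A (X i w) /\ (Rn i w <= r)%R] <= (m%:R * K * (r ^+ d * v))%:E)%E.
Proof.
move=> m0 mA r0 K0 AK.
have hgt := nn_dist_gt_probability hind hX i r m0 mA.
have split : (P [set w | A (X i w) /\ (Rn i w <= r)%R] +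
    P [set w | A (X i w) /\ (r < Rn i w)%R] = mu A)%E.
  rewrite -measureU; last 3 first.
  - exact: measurable_le.
  - exact: measurable_gt.
  - by apply/seteqP; split => // w [[_ h1] [_]]; rewrite ltNge h1.
  rewrite -(law_eq hX i mA); congr (P _); apply/seteqP; split => w /=.
    by case=> -[].
  by move=> Aw; have [h|h] := leP (Rn i w) r; [left|right].
have mb := measurable_ball_mass mf f0 hX r.
have muA : mu A = (\int[mu]_(x in A) (1 - (1 - mass r x) ^+ m)%:E +
    \int[mu]_(x in A) ((1 - mass r x) ^+ m)%:E)%E.
  rewrite -ge0_integralD//; last 4 first.
  - by move=> x _; rewrite lee_fin subr_ge0; have /andP[] := pow01 r x m.
  - by apply/measurable_EFinP/measurable_funTS; apply: measurable_funB.
  - by move=> x _; rewrite lee_fin; have /andP[] := pow01 r x m.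
  - by apply/measurable_EFinP/measurable_funTS.
  under eq_integral do rewrite -EFinD subrK.
  by rewrite integral_cst// mul1e.
have fin : (\int[mu]_(x in A) ((1 - mass r x) ^+ m)%:E)%E \is a fin_num.
  by rewrite -hgt fin_num_measure//; exact: measurable_gt.
rewrite -(leeD2rE _ _ fin) -[in leLHS]hgt split muA; apply: leeD => //.
apply: (@le_trans _ _ (\int[mu]_(x in A) (m%:R%:E * (mass r x)%:E))%E).
  apply: ge0_le_integral => //.
  - by move=> x _; rewrite lee_fin subr_ge0; have /andP[] := pow01 r x m.
  - by apply/measurable_EFinP/measurable_funTS; apply: measurable_funB.
  - by apply: emeasurable_funM => //; apply/measurable_EFinP/measurable_funTS.
  - move=> x _; rewrite -EFinM lee_fin lerBlDr -lerBlDl.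
    by apply: bernoulli; exact: mass01.
rewrite ge0_integralZl ?lee_fin//; last 2 first.
- by apply/measurable_EFinP/measurable_funTS.
- by move=> x _; rewrite lee_fin ball_mass_ge0.
rewrite -mulrA EFinM; apply: lee_wpmul2l; first by rewrite lee_fin.
have mres : measurable_fun setT ((fun x => (mass r x)%:E) \_ A).
  by apply/(measurable_restrictT _ mA)/measurable_EFinP/measurable_funTS.
rewrite integral_mkcond (ge0_integral_law mf hX)//; last first.
  by move=> x; apply: erestrict_ge0 => y _; rewrite lee_fin ball_mass_ge0.
apply: (@le_trans _ _ (\int[lam]_x (K%:E * (mass r x)%:E))%E).
  apply: ge0_le_integral => //.
  - move=> x _; rewrite mule_ge0 ?lee_fin//.
    by apply: erestrict_ge0 => y _; rewrite lee_fin ball_mass_ge0.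
  - exact: emeasurable_funM.
  - by apply: emeasurable_funM => //; exact/measurable_EFinP.
  move=> x _; rewrite patchE; case: ifPn => [/set_mem Ax|_]; last first.
    by rewrite mul0e mule_ge0 ?lee_fin// ball_mass_ge0.
  by rewrite muleC; apply: lee_wpmul2r; rewrite lee_fin ?ball_mass_ge0// AK.
rewrite ge0_integralZl ?lee_fin//; last 2 first.
- exact/measurable_EFinP.
- by move=> x _; rewrite lee_fin ball_mass_ge0.
rewrite EFinM; apply: lee_wpmul2l; first by rewrite lee_fin.
have -> : (\int[lam]_x (mass r x)%:E =
    \int[lam]_x \int[lam]_(y in eball x r) (f y)%:E)%E.
  by apply: eq_integral => x _; rewrite -ball_massE (law_density hX)//; exact: measurable_eball.
by rewrite ge0_integral_integral_eball// f1 mule1.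
Qed.

Definition log_volume m (r : R) : R := ln (m%:R * r ^+ d * v).

Lemma measurable_log_volume m : measurable_fun setT (log_volume m).
Proof.
apply: (measurableT_comp (@measurable_ln R)).
by apply: measurable_funM => //; apply: measurable_funM.
Qed.

Lemma log_volume_gt m s r : (0 < m)%N -> 0 < r ->
  (s < log_volume m r) = (nn_radius m s < r).
Proof.
move=> m0 r0; have mR : (0 : R) < m%:R by rewrite ltr0n.
have c0 : 0 < m%:R * r ^+ d * v by rewrite !mulr_gt0// exprn_gt0.
rewrite /log_volume -ltr_expR lnK// -(nn_radiusX s m0) -mulrA ltr_pM2l// ltr_pM2r//.
by rewrite ltr_pXn2r// nnegrE ltW// nn_radius_gt0.
Qed.

Lemma log_volume_gt_ge0 m s r : (0 < m)%N -> 0 <= s -> 0 <= r ->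
  (s < log_volume m r) = (nn_radius m s < r).
Proof.
move=> m0 s0; rewrite le_eqVlt => /predU1P[<-|]; last exact: log_volume_gt.
rewrite ltNge [RHS]ltNge (ltW (nn_radius_gt0 _ _))/=; apply/negbTE; rewrite negbK.
by rewrite /log_volume expr0n gtn_eqF// mulr0 mul0r ln0.
Qed.

(** For [K = e ^ (s / 2)] the union bound is [e ^ (s / 2) * e ^ (- s)], while
    the points where the density exceeds [K] are rare when [f * ln (f + 1)] is
    integrable. *)
Lemma log_volume_lower_tail m (i : 'I_m.+1) (s : R) : (0 < m)%N -> 0 < s ->
  (P [set w | (f (X i w) <= expR (s / 2))%R /\ (log_volume m (Rn i w) <= - s)%R] <=
    (expR (- (s / 2)))%:E)%E.
Proof.
move=> m0 s0; pose A := [set x | f x <= expR (s / 2)].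
have mA : measurable A by exact: measurable_le_set.
apply: (@le_trans _ _ (P [set w | A (X i w) /\ (Rn i w <= nn_radius m (- s))%R])).
  apply: measure_mono; [|exact: measurable_le|]; last first.
    move=> w [Aw h]; split => //; rewrite leNgt; apply/negP => h'.
    have R0 := lt_trans (nn_radius_gt0 m (- s)) h'.
    by move: h'; rewrite -log_volume_gt// ltNge h.
  have mXA : measurable (X i @^-1` A) by exact: preimage_measurable.
  have mY := measurableT_comp (measurable_log_volume m) (mRn i).
  exact: measurableI mXA (measurable_le_set (- s) mY).
apply: (le_trans (nn_dist_small_probability (K := expR (s / 2)) i m0 mA _ _ _)) => //.
  exact/ltW/nn_radius_gt0.
rewrite lee_fin mulrAC nn_radiusX// -expRD.
by rewrite le_eqVlt; apply/orP; left; apply/eqP; congr expR; lra.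
Qed.

End nearest_neighbour_tails.

(** * The limiting survival function *)

Section survival_limit.
Context (R : realType) (d : nat).
Hypothesis d0 : (0 < d)%N.
Local Notation E := (d.-tuple (measurableTypeR R)).
Local Notation lam := (lebesgue_tuple R d).
Local Notation v := (unit_ball_volume R d).
Variable f : E -> R.
Hypothesis mf : measurable_fun setT f.
Hypothesis f0 : forall x, 0 <= f x.
Hypothesis f1 : (\int[lam]_x (f x)%:E)%E = 1%E.
Context dT (T : measurableType dT) (P : probability T R) (X : nat -> {RV P >-> E}).
Hypothesis hind : mutually_independent X.
Hypothesis hX : forall i A, measurable A ->
  P (X i @^-1` A) = (\int[lam]_(x in A) (f x)%:E)%E.

Local Notation mu := (distribution P (X 0%N)).
Local Notation mass := (ball_mass X).

Let mEf : measurable_fun setT (EFin \o f). Proof. exact/measurable_EFinP. Qed.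

(** The survival function of [ln t - ln (f x)], for [x] of law [mu] and [t]
    exponential, independent of [x]. *)
Definition limit_survival (s : R) : \bar R := (\int[mu]_x (expR (- (expR s * f x)))%:E)%E.

(** Where the density is at most [k], integrating against [mu] costs at most
    [k] times integrating against Lebesgue measure; the remaining points are
    negligible. *)
Lemma density_tail_cvg0 :
  (\int[lam]_x (f x * (if k%:R < f x then 1 else 0))%:E @[k --> \oo] --> 0)%E.
Proof.
rewrite (_ : 0%E = \int[lam]_x (cst 0%E x))%E; last by rewrite integral0.
have [] := @dominated_convergence _ _ _ lam setT measurableT
  (fun k x => (f x * (if k%:R < f x then 1 else 0))%:E) (cst 0%E) (EFin \o f) => //.
- move=> k; apply/measurable_EFinP; apply: measurable_funM => //.
  apply: measurable_fun_ifT => //; exact: measurable_fun_ltr.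
- apply: aeW => x _; apply: cvg_near_cst; near=> k.
  rewrite ifF ?mulr0//; apply/negbTE; rewrite -leNgt.
  rewrite (le_trans (ltW (truncnS_gt _)))// ler_nat.
  by near: k; exact: nbhs_infty_ge.
- exact: (integrable_density mf f0 f1).
- apply: aeW => x k _; rewrite /= ger0_norm; last by rewrite mulr_ge0//; case: ifP.
  by rewrite lee_fin; case: ifP => _; rewrite ?mulr1// mulr0.
Unshelve. all: end_near. Qed.

Let z (s : R) := expR s.
(** The error of the limit at [x]: the error of the ball average times the
    Lipschitz constant, capped by 1 since it compares probabilities. *)
Let gap s m x : R := Num.min 1 (z s * `|ball_average (nn_radius d m s) f x - f x|).

Let gap01 s m x : 0 <= gap s m x <= 1.
Proof.
by rewrite /gap le_min ler01 ge_min lexx mulr_ge0// expR_ge0.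
Qed.

Let massE s m x : (0 < m)%N ->
  m%:R * mass (nn_radius d m s) x = z s * ball_average (nn_radius d m s) f x.
Proof.
by move=> m0; rewrite (ball_mass_average hX)// ?nn_radius_gt0// mulrA nn_radiusX.
Qed.

Let average_ge0 s m x : (0 < m)%N -> 0 <= z s * ball_average (nn_radius d m s) f x.
Proof. by move=> m0; rewrite -massE// mulr_ge0// ball_mass_ge0. Qed.

Let zf_ge0 s x : 0 <= z s * f x. Proof. by rewrite mulr_ge0// expR_ge0. Qed.

Let distE s m x : `|z s * ball_average (nn_radius d m s) f x - z s * f x| =
  z s * `|ball_average (nn_radius d m s) f x - f x|.
Proof. by rewrite -mulrBr normrM ger0_norm// expR_ge0. Qed.

Let pow_le s m x : (0 < m)%N ->
  (1 - mass (nn_radius d m s) x) ^+ m <= expR (- (z s * f x)) + gap s m x.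
Proof.
move=> m0; rewrite /gap; set r := nn_radius d m s.
have /andP[b0 b1] : 0 <= mass r x <= 1 by rewrite ball_mass_ge0 ball_mass_le1.
rewrite -lerBlDl le_min; apply/andP; split.
  rewrite lerBlDr (@le_trans _ _ 1)// ?exprn_ile1 ?subr_ge0// ?gerBl//.
  by rewrite lerDl expR_ge0.
rewrite lerBlDl (le_trans (exprB_le_expR m b1))// massE// -distE.
exact: expRN_lipschitz (average_ge0 _ _ m0) (zf_ge0 _ _).
Qed.

Let le_pow s m x : (0 < m)%N -> expR (- (z s * f x)) <=
  (1 - mass (nn_radius d m s) x) ^+ m + (2 / m%:R + gap s m x).
Proof.
move=> m0; rewrite /gap; set r := nn_radius d m s.
have b01 : 0 <= mass r x <= 1 by rewrite ball_mass_ge0 ball_mass_le1.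
have p0 : 0 <= (1 - mass r x) ^+ m by rewrite exprn_ge0// subr_ge0; case/andP: b01.
have m2 : 0 <= 2 / m%:R :> R by rewrite divr_ge0.
rewrite addrA -lerBlDl le_min; apply/andP; split.
  rewrite lerBlDr (@le_trans _ _ 1)// ?lerDl ?addr_ge0//.
  by rewrite expR_le1 oppr_le0.
rewrite lerBlDl -distE distrC.
apply: (le_trans (expRN_lipschitz (zf_ge0 s x) (average_ge0 s x m0))).
rewrite lerD2r -massE//; exact: expR_le_exprB.
Qed.

Let measurable_gap s m : measurable_fun setT (gap s m).
Proof.
apply: measurable_minr => //; apply: measurable_funM => //.
apply: measurableT_comp => //; apply: measurable_funB => //.
apply: (measurable_ball_average d0); first exact: ltW (nn_radius_gt0 _ _ _).
exact: (integrable_density mf f0 f1).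
Qed.

Let measurable_pow s m : measurable_fun setT (fun x => (1 - mass (nn_radius d m s) x) ^+ m).
Proof.
apply: measurable_funX; apply: measurable_funB => //.
exact: (measurable_ball_mass mf f0 hX).
Qed.

Let measurable_lim s : measurable_fun setT (fun x => expR (- (z s * f x))).
Proof. by apply: measurableT_comp => //; apply: measurableT_comp => //; exact: measurable_funM. Qed.

Let pow_ge0 s m x : 0 <= (1 - mass (nn_radius d m s) x) ^+ m.
Proof. by rewrite exprn_ge0// subr_ge0 ball_mass_le1. Qed.

Let error s m : \bar R := ((2 / m%:R)%:E + \int[mu]_x (gap s m x)%:E)%E.

Let survival_le s m : (0 < m)%N -> (survival X m s <= limit_survival s + error s m)%E.
Proof.
move=> m0; apply: (@le_trans _ _ (limit_survival s + \int[mu]_x (gap s m x)%:E)%E).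
  rewrite -ge0_integralD//; last 3 first.
  - exact/measurable_EFinP.
  - by move=> x _; rewrite lee_fin; have /andP[] := gap01 s m x.
  - exact/measurable_EFinP.
  apply: ge0_le_integral => //.
  - by move=> x _; rewrite lee_fin.
  - exact/measurable_EFinP.
  - by apply: emeasurable_funD; exact/measurable_EFinP.
  - by move=> x _; rewrite -EFinD lee_fin; exact: pow_le.
by apply: leeD => //; rewrite /error leeDr// lee_fin divr_ge0.
Qed.

Let limit_survival_le s m : (0 < m)%N -> (limit_survival s <= survival X m s + error s m)%E.
Proof.
move=> m0; have m2 : 0 <= 2 / m%:R :> R by rewrite divr_ge0.
have -> : error s m = (\int[mu]_x (2 / m%:R + gap s m x)%:E)%E.
  rewrite /error -(integral_prob_cst mu (2 / m%:R)) -ge0_integralD//.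
  - by move=> x _; rewrite lee_fin; have /andP[] := gap01 s m x.
  - exact/measurable_EFinP.
rewrite -ge0_integralD//; last 4 first.
- by move=> x _; rewrite lee_fin.
- exact/measurable_EFinP.
- by move=> x _; rewrite lee_fin addr_ge0//; have /andP[] := gap01 s m x.
- by apply/measurable_EFinP; exact: measurable_funD.
apply: ge0_le_integral => //.
- exact/measurable_EFinP.
- by apply: emeasurable_funD; apply/measurable_EFinP => //; exact: measurable_funD.
by move=> x _; rewrite -!EFinD lee_fin; exact: le_pow.
Qed.

Let error_cvg0 s : (error s m @[m --> \oo] --> 0)%E.
Proof.
pose r_ m := Num.min 1 (nn_radius d m s).
have rs : small_radii r_.
  split=> [m|]; first by rewrite /r_ lt_min ltr01 nn_radius_gt0 ge_min lexx.
  apply/cvgr0Pnorm_lt => e e0.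
  have /cvgr0Pnorm_lt/(_ e e0) := nn_radius_cvg0 d0 s; apply: filterS => m.
  apply: le_lt_trans; rewrite /r_ !ger0_norm ?ge_min ?lexx ?orbT// ?ltW ?nn_radius_gt0//.
  by rewrite lt_min ltr01 nn_radius_gt0.
have [_ /(_ _ rs) dev0] := averages_converge_integrable d0 (integrable_density mf f0 f1).
apply: cvge0_of_small => [m|e e0].
  rewrite adde_ge0// ?lee_fin ?divr_ge0//; apply: integral_ge0 => x _.
  by rewrite lee_fin; have /andP[] := gap01 s m x.
have e3 : 0 < e / 3 by rewrite divr_gt0.
have [k _ /(_ k (leqnn k)) tailk] := cvge0_small density_tail_cvg0 e3.
have kz0 : 0 < k.+1%:R * z s by rewrite mulr_gt0// expR_gt0.
have ek : 0 < e / 3 / (k.+1%:R * z s) by rewrite divr_gt0.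
have /cvgr0Pnorm_lt/(_ _ ltr01) near1 := nn_radius_cvg0 d0 s.
near=> m.
have m0 : (0 < m)%N by near: m; exact: nbhs_infty_gt.
have rm1 : nn_radius d m s < 1.
  rewrite -[ltLHS]ger0_norm ?(ltW (nn_radius_gt0 _ _ _))//.
  by near: m; exact: near1.
have devm : (average_deviation (r_ m) f < (e / 3 / (k.+1%:R * z s))%:E)%E.
  by near: m; exact: cvge0_small.
have m3 : 2 / m%:R < e / 3.
  have mR : (0 : R) < m%:R by rewrite ltr0n.
  rewrite ltr_pdivrMr// mulrC -ltr_pdivrMr//.
  rewrite (lt_le_trans (truncnS_gt _))// ler_nat.
  by near: m; exact: nbhs_infty_ge.
have int_gap : (\int[mu]_x (gap s m x)%:E <=
    \int[lam]_x (f x * (if k%:R < f x then 1 else 0))%:E +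
    (k.+1%:R * z s)%:E * average_deviation (r_ m) f)%E.
  have -> : r_ m = nn_radius d m s by apply/min_idPr; exact: ltW.
  have mdev : measurable_fun setT (fun x => `|ball_average (nn_radius d m s) f x - f x|).
    apply: measurableT_comp => //; apply: measurable_funB => //.
    apply: (measurable_ball_average d0); first exact: ltW (nn_radius_gt0 _ _ _).
    exact: (integrable_density mf f0 f1).
  have mtail : measurable_fun setT (fun x => f x * (if k%:R < f x then 1 else 0)).
    apply: measurable_funM => //.
    by apply: measurable_fun_ifT => //; exact: measurable_fun_ltr.
  rewrite (ge0_integral_law mf hX); last 2 first.
  - exact/measurable_EFinP.
  - by move=> x; rewrite lee_fin; have /andP[] := gap01 s m x.
  rewrite /average_deviation -ge0_integralZl ?lee_fin ?(ltW kz0)//; last first.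
    exact/measurable_EFinP.
  have tail_ge0 x : 0 <= f x * (if k%:R < f x then 1 else 0).
    by rewrite mulr_ge0//; case: ifP.
  rewrite -ge0_integralD//; last 4 first.
  - by move=> x _; rewrite lee_fin.
  - exact/measurable_EFinP.
  - by move=> x _; rewrite mule_ge0 ?lee_fin// ltW.
  - by apply: emeasurable_funM => //; exact/measurable_EFinP.
  apply: ge0_le_integral => //.
  - by move=> x _; rewrite mule_ge0 ?lee_fin//; have /andP[] := gap01 s m x.
  - by apply: emeasurable_funM => //; exact/measurable_EFinP.
  - apply: emeasurable_funD; first exact/measurable_EFinP.
    by apply: emeasurable_funM => //; exact/measurable_EFinP.
  move=> x _; rewrite -!EFinM -EFinD lee_fin.
  have /andP[g0 g1] := gap01 s m x.
  have dev_ge0 : 0 <= k.+1%:R * z s * `|ball_average (nn_radius d m s) f x - f x|.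
    by rewrite mulr_ge0// ltW.
  have [fk|fk] := ltP k%:R (f x).
    by rewrite mulr1 -[leLHS]addr0 lerD// ler_piMl.
  rewrite mulr0 add0r mulrC -mulrA; apply: ler_pM => //.
    by rewrite (le_trans fk)// ler_nat.
  by rewrite /gap ge_min lexx orbT.
apply: (@le_lt_trans _ _ ((2 / m%:R)%:E +
    (\int[lam]_x (f x * (if k%:R < f x then 1 else 0))%:E +
    (k.+1%:R * z s)%:E * average_deviation (r_ m) f))%E).
  exact: leeD.
have -> : e%:E = ((e / 3)%:E + ((e / 3)%:E + (e / 3)%:E))%E.
  by rewrite -!EFinD; congr EFin; lra.
apply: lteD; first by rewrite lte_fin.
apply: lteD => //.
move: devm; rewrite -(@lte_pmul2l _ (k.+1%:R * z s)%:E) ?lte_fin//.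
by rewrite -EFinM [X in (_ < X%:E)%E]mulrC divfK// gt_eqF.
Unshelve. all: end_near. Qed.

(** The ball averages converge to [f] in mean only, which is enough for the
    integrated error to vanish. *)
Lemma survival_cvg s : (survival X m s @[m --> \oo] --> limit_survival s)%E.
Proof.
have lfin : limit_survival s \is a fin_num.
  rewrite ge0_fin_numE; last by apply: integral_ge0 => x _; rewrite lee_fin expR_ge0.
  apply: (@le_lt_trans _ _ (\int[mu]_x 1%:E)%E).
    apply: ge0_le_integral => //; first exact/measurable_EFinP.
    by move=> x _; rewrite lee_fin expR_le1 oppr_le0.
  by rewrite integral_prob_cst ltry.
have err0 : (error s m @[m --> \oo] --> 0)%E by exact: error_cvg0.
have [finE _] := (fine_cvgP _ _).1 err0.
apply: (@squeeze_cvge _ _ _ _ (fun m => limit_survival s - error s m)%E _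
  (fun m => limit_survival s + error s m)%E).
- near=> m; have m0 : (0 < m)%N by near: m; exact: nbhs_infty_gt.
  have efin : error s m \is a fin_num.
    by near: m; exact: finE.
  by rewrite leeBlDr// limit_survival_le// survival_le.
- rewrite -[X in _ --> X]sube0; apply: (cvgeB _ (cvg_cst _) err0).
  by rewrite oppe0 fin_num_adde_defl.
- rewrite -[X in _ --> X]adde0; apply: (cvgeD _ (cvg_cst _) err0).
  by rewrite fin_num_adde_defl.
Unshelve. all: end_near. Qed.

End survival_limit.

(** * The logarithm of an exponential variable *)

Section log_exponential.
Context (R : realType).
Local Notation leb := (@lebesgue_measure R).

Definition expo : probability (measurableTypeR R) R :=
  exponential_distribution_exponential_prob__canonical__probability_measure_Probability
    (ltr01 : 0 < 1 :> R).

Let pdf (t : R) : R := exponential_pdf 1 t.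

Let mpdf : measurable_fun setT pdf. Proof. exact: measurable_exponential_pdf. Qed.

Let pdf0 t : 0 <= pdf t. Proof. exact: exponential_pdf_ge0. Qed.

Lemma expo_density (A : set (measurableTypeR R)) :
  expo A = (\int[leb]_(t in A) (pdf t)%:E)%E.
Proof. by []. Qed.

Lemma pdfE t : 0 <= t -> pdf t = expR (- t).
Proof. by move=> t0; rewrite /pdf exponential_pdfE// mul1r mulN1r. Qed.

Lemma expo_le0 : expo `]-oo, 0]%classic = 0%E.
Proof.
have -> : `]-oo, 0]%classic = `]-oo, 0[%classic `|` [set (0 : R)].
  apply/seteqP; split => t /=; rewrite !in_itv/=.
    by rewrite le_eqVlt => /predU1P[->|]; [right|left].
  by case=> [/ltW//|->].
transitivity (expo `]-oo, 0%R[%classic + expo [set (0%R : R)])%E.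
  apply: measureU => //.
  by apply/seteqP; split => // t []; rewrite /= in_itv/= => h t0; rewrite t0 ltxx in h.
rewrite !expo_density integral0_eq; last first.
  by move=> t /=; rewrite in_itv/= => t0; rewrite /pdf lt0_exponential_pdf.
rewrite add0e null_set_integral//.
- by apply/measurable_EFinP; exact: measurable_funTS.
- exact: lebesgue_measure_set1.
Qed.

Lemma expo_pos (A : set (measurableTypeR R)) : measurable A ->
  expo A = expo (A `&` `]0, +oo[%classic).
Proof.
move=> mA.
have mpos : measurable (`]0, +oo[%classic : set (measurableTypeR R)) by exact: measurable_itv.
have mneg : measurable (`]-oo, 0]%classic : set (measurableTypeR R)) by exact: measurable_itv.
have {1}-> : A = (A `&` `]0, +oo[%classic) `|` (A `&` `]-oo, 0]%classic).
  rewrite -setIUr (_ : _ `|` _ = setT) ?setIT//.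
  by apply/seteqP; split => // t _ /=; rewrite !in_itv/= andbT; case: leP; [right|left].
rewrite measureU; last 3 first.
- exact: measurableI.
- exact: measurableI.
- apply/seteqP; split => // t [[_ /=]]; rewrite in_itv/= andbT => t0 [_ /=].
  by rewrite in_itv/= leNgt t0.
rewrite -[RHS]adde0; congr (_ + _)%E; apply/eqP; rewrite eq_le measure_ge0 andbT.
rewrite -[leRHS]expo_le0; apply: measure_mono => //; exact: measurableI.
Qed.

Lemma expo_ray (a : R) : 0 < a -> expo `]a, +oo[%classic = (expR (- a))%:E.
Proof.
move=> a0.
have m1 : measurable (`]-oo, a]%classic : set (measurableTypeR R)) by exact: measurable_itv.
have m2 : measurable (`[0, a]%classic : set (measurableTypeR R)) by exact: measurable_itv.
have e : expo `]-oo, a]%classic = (1 - expR (- a))%:E.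
  rewrite EFinB -[in expR _](mul1r a) -mulNr -exponential_prob_itv0c//.
  rewrite -[RHS]/(expo `[0, a]%classic) [LHS]expo_pos// [RHS]expo_pos//.
  congr (expo _); apply/seteqP; split => t /=; rewrite !in_itv/= !andbT.
    by case=> -> /[dup] /ltW ->.
  by case=> /andP[_ ->].
have -> : `]a, +oo[%classic = ~` `]-oo, a]%classic.
  by apply/seteqP; split => t /=; rewrite !in_itv/= andbT ltNge => h; apply/negP.
by rewrite probability_setC// [X in (_ - X)%E]e -EFinB; congr EFin; ring.
Qed.

Lemma integral_expRN (c : R) : 0 < c ->
  (\int[leb]_(s in `[0%R, +oo[) (expR (- (c * s)))%:E = (c^-1)%:E)%E.
Proof.
move=> c0; have mexp : measurable_fun setT (fun s => (expR (- (c * s)))%:E).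
  apply/measurable_EFinP; apply: measurableT_comp => //.
  by apply: measurableT_comp => //; exact: measurable_funM.
have : (c%:E * \int[leb]_(s in `[0%R, +oo[) (expR (- (c * s)))%:E = 1)%E.
  rewrite -(@integral_exponential_pdf R c c0) -ge0_integralZl//; last 2 first.
  - exact: measurable_funTS.
  - by rewrite lee_fin ltW.
  rewrite [LHS]integral_mkcond; apply: eq_integral => s _.
  by rewrite patchE /exponential_pdf patchE; case: ifP; rewrite -?EFinM ?mulNr.
have cN0 : c != 0 by rewrite gt_eqF.
move=> h; rewrite -[LHS]mul1e -[1%E]/(1%:E) -(mulVf cN0) EFinM -muleA.
by rewrite h mule1.
Qed.

Lemma integral_expR_neg (c : R) : 0 < c ->
  (\int[leb]_(s in `]-oo, 0%R[) (expR (c * s))%:E = (c^-1)%:E)%E.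
Proof.
move=> c0; have mexp : measurable_fun setT (fun s => (expR (- (c * s)))%:E).
  apply/measurable_EFinP; apply: measurableT_comp => //.
  by apply: measurableT_comp => //; exact: measurable_funM.
rewrite -(integral_expRN c0).
rewrite (@ge0_integration_by_substitution0 R (fun s => (expR (- (c * s)))%:E)).
- rewrite -integral_itv_bndo_bndc//=.
    by apply: eq_integral => s _; rewrite mulrN opprK.
  by apply: measurable_funTS; apply: (measurableT_comp mexp).
- exact: measurable_funTS.
- by move=> r; rewrite lee_fin expR_ge0.
Qed.

Definition log_expo (a : R) (t : measurableTypeR R) : R := ln t - ln a.

Lemma measurable_log_expo a : measurable_fun setT (log_expo a).
Proof. by apply: measurable_funB => //; exact: measurable_ln. Qed.

Definition log_expoRV a : {RV expo >-> R} :=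
  HB.pack (log_expo a) (isMeasurableFun.Build _ _ _ _ _ (measurable_log_expo a)).

Lemma log_expo_ccdf a s : 0 < a ->
  ccdf (log_expoRV a) s = (expR (- (expR s * a)))%:E.
Proof.
move=> a0; rewrite /ccdf /distribution /pushforward expo_pos; last first.
  by apply: preimage_measurable => //; exact: measurable_log_expo.
have sa0 : 0 < expR s * a by rewrite mulr_gt0// expR_gt0.
rewrite -(expo_ray sa0); congr (expo _); apply/seteqP; split => t /=; rewrite !in_itv/= !andbT.
  move=> [h t0]; move: h; rewrite /log_expo ltrBrDr -ltr_expR lnK//.
  by rewrite expRD lnK.
move=> h; have t0 := lt_trans sa0 h; split => //.
by rewrite /log_expo ltrBrDr -ltr_expR [ltRHS]lnK// expRD lnK.
Qed.

Lemma log_expo_cdf a s : 0 < a ->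
  cdf (log_expoRV a) s = (1 - expR (- (expR s * a)))%:E.
Proof. by move=> a0; rewrite cdf_1_ccdf log_expo_ccdf. Qed.

Let upper_tail_bound (s : R) : 0 <= s -> expR (- (expR s * 1)) <= expR (- s).
Proof. by move=> s0; rewrite mulr1 ler_expR lerN2; have := expR_ge1Dx s; lra. Qed.

Let lower_tail_bound (s : R) : 1 - expR (- (expR s * 1)) <= expR s :> R.
Proof. by rewrite mulr1; have := expR_ge1Dx (- expR s); lra. Qed.

Lemma integral_expRN1 : (\int[leb]_(s in `[0%R, +oo[) (expR (- s))%:E = 1)%E.
Proof.
have := integral_expRN ltr01; rewrite invr1 => <-.
by under [RHS]eq_integral do rewrite mul1r.
Qed.

Let integrable_ge0 (h : measurableTypeR R -> R) : measurable_fun setT h ->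
  (forall t, 0 <= h t) -> (\int[expo]_t (h t)%:E <= 1)%E ->
  expo.-integrable setT (EFin \o h).
Proof.
move=> mh h0 hI; apply/integrableP; split; first exact/measurable_EFinP.
rewrite (eq_integral (EFin \o h)); last by move=> t _; rewrite /= ger0_norm.
exact: le_lt_trans hI (ltry _).
Qed.

(** The double exponential decay of the distribution of the logarithm makes
    both of its tail integrals finite. *)
Lemma integrable_log_expo a : expo.-integrable setT (EFin \o log_expo a).
Proof.
have i1 : expo.-integrable setT (EFin \o log_expo 1).
  pose Z := log_expoRV 1.
  have ip : expo.-integrable setT (EFin \o (Z : _ -> R)^\+%R).
    apply: integrable_ge0.
    - exact: measurable_funrpos.
    - by move=> t; exact: funrpos_ge0.
    have := @ge0_expectation_ccdf _ _ _ expo (Z^\+)%R.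
    rewrite unlock => -> //; last by move=> t; exact: funrpos_ge0.
    rewrite -integral_expRN1; apply: ge0_le_integral => //.
    - apply: measurable_funTS; exact: ccdf_measurable.
    - by apply/measurable_EFinP/measurable_funTS; apply: measurableT_comp.
    move=> s /=; rewrite in_itv/= andbT => s0.
    apply: (@le_trans _ _ (ccdf Z s)); last first.
      by rewrite log_expo_ccdf// lee_fin; exact: upper_tail_bound.
    apply: (@measure_mono _ _ _ expo ((Z^\+)%R @^-1` `]s, +oo[) (Z @^-1` `]s, +oo[)).
    - by apply: preimage_measurable => //; exact: measurable_funrpos.
    - by apply: preimage_measurable => //; exact: measurable_log_expo.
    move=> t; rewrite /= !in_itv/= !andbT /funrpos lt_max (ltNge s 0) s0 orbF.
    exact.
  have im : expo.-integrable setT (EFin \o (Z : _ -> R)^\-%R).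
    apply: integrable_ge0.
    - exact: measurable_funrneg.
    - by move=> t; exact: funrneg_ge0.
    have := @ge0_expectation_ccdf _ _ _ expo (Z^\-)%R.
    rewrite unlock => -> //; last by move=> t; exact: funrneg_ge0.
    rewrite -integral_expRN1; apply: ge0_le_integral => //.
    - apply: measurable_funTS; exact: ccdf_measurable.
    - by apply/measurable_EFinP/measurable_funTS; apply: measurableT_comp.
    move=> s /=; rewrite in_itv/= andbT => s0.
    apply: (@le_trans _ _ (cdf Z (- s))); last first.
      by rewrite log_expo_cdf// lee_fin; exact: lower_tail_bound.
    apply: (@measure_mono _ _ _ expo ((Z^\-)%R @^-1` `]s, +oo[) (Z @^-1` `]-oo, (- s)%R])).
    - by apply: preimage_measurable => //; exact: measurable_funrneg.
    - by apply: preimage_measurable => //; exact: measurable_log_expo.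
    move=> t; rewrite /= !in_itv/= andbT /funrneg lt_max (ltNge s 0) s0 orbF => h.
    by rewrite lerNr ltW.
  rewrite (_ : EFin \o log_expo 1 = (EFin \o (Z : _ -> R)^\+%R) \- (EFin \o (Z : _ -> R)^\-%R))%E.
    exact: integrableB.
  apply/funext => t /=; rewrite -EFinB; congr EFin.
  exact: (esym (congr1 (@^~ t) (funrposBneg Z))).
rewrite (_ : EFin \o _ = (EFin \o log_expo 1) \- (EFin \o cst (ln a)))%E.
  apply: integrableB => //; exact: finite_measure_integrable_cst.
by apply/funext => t /=; rewrite /log_expo ln1 subr0.
Qed.

Lemma mean_ln_expo : (\int[expo]_t (ln t)%:E)%E = (- C_E R)%:E.
Proof.
have il : expo.-integrable setT (EFin \o (fun t : measurableTypeR R => ln t)).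
  have := integrable_log_expo 1; congr (_.-integrable _ _).
  by apply/funext => t /=; rewrite /log_expo ln1 subr0.
have e1 : (\int[expo]_t (ln t)%:E =
    \int[leb]_(t in `]0%R, +oo[) (expR (- t) * ln t)%:E)%E.
  rewrite (@integral_density _ _ _ expo leb pdf)//.
  rewrite [RHS]integral_mkcond; apply: eq_integral => t _; rewrite patchE.
  have [t0|t0] := ltP 0 t.
    by rewrite mem_set/= ?in_itv/= ?t0// pdfE ?ltW// mulrC.
  by rewrite memNset/= ?in_itv/= ?andbT ?ltNge ?t0// ln0// mul0r.
rewrite e1 /C_E opprK /Rintegral fineK// -e1.
exact: integrable_fin_num.
Qed.

Definition upper_log_mass (a : R) : \bar R :=
  (\int[leb]_(s in `[0%R, +oo[) (expR (- (expR s * a)))%:E)%E.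

Definition lower_log_mass (a : R) : \bar R :=
  (\int[leb]_(s in `]-oo, 0%R[) (1 - expR (- (expR s * a)))%:E)%E.

(** The tail formula for the mean of [ln t - ln a], [t] exponential. *)
Lemma log_mass_sub a : 0 < a ->
  (upper_log_mass a - lower_log_mass a)%E = (- C_E R - ln a)%:E.
Proof.
move=> a0; have ia := integrable_log_expo a.
have := @expectation_cdf_ccdf _ _ _ expo (log_expoRV a).
have -> : (\int[leb]_(r in `[0%R, +oo[) ccdf (log_expoRV a) r)%E = upper_log_mass a.
  by apply: eq_integral => s _; rewrite log_expo_ccdf.
have -> : (\int[leb]_(r in `]-oo, 0%R[) cdf (log_expoRV a) r)%E = lower_log_mass a.
  by apply: eq_integral => s _; rewrite log_expo_cdf.
move=> <-; last by apply/Lfun1_integrable.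
rewrite unlock EFinB -mean_ln_expo -(integral_prob_cst expo (ln a)).
have il : expo.-integrable setT (EFin \o (fun t : measurableTypeR R => ln t)).
  have := integrable_log_expo 1; congr (_.-integrable _ _).
  by apply/funext => t /=; rewrite /log_expo ln1 subr0.
rewrite -integralB//; last exact: finite_measure_integrable_cst.
Qed.

End log_exponential.

(** * Truncated logarithmic volumes *)

Section log_volume_law.
Context (R : realType) (d : nat).
Hypothesis d0 : (0 < d)%N.
Local Notation E := (d.-tuple (measurableTypeR R)).
Local Notation lam := (lebesgue_tuple R d).
Local Notation v := (unit_ball_volume R d).
Local Notation leb := (@lebesgue_measure R).
Variable f : E -> R.
Hypothesis mf : measurable_fun setT f.
Hypothesis f0 : forall x, 0 <= f x.
Hypothesis f1 : (\int[lam]_x (f x)%:E)%E = 1%E.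
Context dT (T : measurableType dT) (P : probability T R) (X : nat -> {RV P >-> E}).
Hypothesis hind : mutually_independent X.
Hypothesis hX : forall i A, measurable A ->
  P (X i @^-1` A) = (\int[lam]_(x in A) (f x)%:E)%E.

Local Notation mu := (distribution P (X 0%N)).
Local Notation mass := (ball_mass X).

Let v0 : 0 < v. Proof. exact: unit_ball_volume_gt0. Qed.

Let mEf : measurable_fun setT (EFin \o f). Proof. exact/measurable_EFinP. Qed.

Definition sample_log_volume m (i : 'I_m.+1) w : R :=
  log_volume d m (nn_dist (fun j => X j w) i (X i w)).

Let Rn m (i : 'I_m.+1) w := nn_dist (fun j => X j w) i (X i w).

Let mRn m (i : 'I_m.+1) : measurable_fun setT (Rn i).
Proof. by apply: (measurable_nn_dist (u := fun j => X j)) => j. Qed.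

Lemma measurable_sample_log_volume m (i : 'I_m.+1) : measurable_fun setT (sample_log_volume i).
Proof. exact: (measurableT_comp (measurable_log_volume d m) (mRn i)). Qed.

Let measurable_ray m (i : 'I_m.+1) s : measurable [set w | s < sample_log_volume i w].
Proof. by apply: measurable_gt_set; exact: measurable_sample_log_volume. Qed.

Let radius_probability m (i : 'I_m.+1) r : (0 < m)%N ->
  P [set w | r < Rn i w] = (\int[mu]_x ((1 - mass r x) ^+ m)%:E)%E.
Proof.
move=> m0; rewrite -(nn_dist_gt_probability hind hX i r m0 measurableT).
by congr (P _); apply/seteqP; split => w //= -[].
Qed.

(** Coincident points, for which the logarithm takes its default value, have
    probability zero because singletons are null. *)
Lemma nn_dist_pos_probability m (i : 'I_m.+1) : (0 < m)%N ->
  P [set w | 0 < nn_dist (fun j => X j w) i (X i w)] = 1%E.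
Proof.
move=> m0; rewrite (radius_probability i 0 m0).
rewrite -[RHS](integral_prob_cst mu 1); apply: eq_integral => x _.
have -> : mass 0 x = 0; last by rewrite subr0 expr1n.
rewrite /ball_mass (law_density hX); last exact: measurable_eball.
rewrite null_set_integral//.
- exact: measurable_eball.
- exact: measurable_funTS.
- transitivity (0 ^+ d * v)%:E; first exact: lebesgue_eball.
  by rewrite expr0n gtn_eqF// mul0r.
Qed.

Lemma log_volume_ccdf m (i : 'I_m.+1) s : (0 < m)%N ->
  P [set w | s < sample_log_volume i w] = survival X m s.
Proof.
move=> m0; rewrite /survival -(radius_probability i _ m0).
have mgt r : measurable [set w | r < Rn i w] by exact: measurable_gt_set.
rewrite (_ : [set w | s < _] = [set w | nn_radius d m s < Rn i w] `|`
    ([set w | s < sample_log_volume i w] `&` ~` [set w | 0 < Rn i w])).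
  rewrite measureU; last 3 first.
  - exact: mgt.
  - by apply: measurableI; [exact: measurable_ray|apply: measurableC; exact: mgt].
  - apply/seteqP; split => // w [h [_ /= h']]; apply: h'.
    exact: lt_trans (nn_radius_gt0 _ _ _) h.
  rewrite -[RHS]adde0; congr (_ + _)%E; apply/eqP; rewrite eq_le measure_ge0 andbT.
  apply: (@le_trans _ _ (P (~` [set w | 0 < Rn i w]))).
    apply: measure_mono => //; last by apply: measurableC; exact: mgt.
    by apply: measurableI; [exact: measurable_ray|apply: measurableC; exact: mgt].
  rewrite probability_setC; last exact: mgt.
  by rewrite [X in (_ - X)%E](nn_dist_pos_probability i m0) subee.
apply/seteqP; split => w /=.
  have [R0 h|R0 h] := ltP 0 (Rn i w); last by right; split => //; apply/negP; rewrite -leNgt.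
  by left; rewrite -log_volume_gt.
case=> [h|[]//]; have R0 := lt_trans (nn_radius_gt0 d m s) h.
by rewrite /sample_log_volume log_volume_gt.
Qed.

Lemma log_volume_cdf m (i : 'I_m.+1) s : (0 < m)%N ->
  P [set w | sample_log_volume i w <= s] = (1 - survival X m s)%E.
Proof.
move=> m0; rewrite -(log_volume_ccdf i s m0) -probability_setC; last exact: measurable_ray.
by congr (P _); apply/seteqP; split => w /=; rewrite leNgt => /negP.
Qed.

Lemma survival_ge0 m s : (0 <= survival X m s)%E.
Proof.
by apply: integral_ge0 => x _; rewrite lee_fin exprn_ge0// subr_ge0 ball_mass_le1.
Qed.

Lemma survival_le1 m s : (0 < m)%N -> (survival X m s <= 1)%E.
Proof.
by move=> m0; rewrite -(log_volume_ccdf ord0 s m0) probability_le1.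
Qed.

Variable M : R.
Hypothesis M0 : 0 <= M.
Hypothesis hM : {ae P, forall w i, eball (evec0 R d) M (X i w)}.

(** Markov's inequality, after averaging over the points: the balls of the
    nearest neighbours pack into a bounded region. *)
Lemma survival_upper m s : (0 < m)%N -> 0 <= s ->
  (survival X m s <= ((6 * M) ^+ d * v * expR (- s))%:E)%E.
Proof.
move=> m0 s0; set K := (6 * M) ^+ d * v.
have mR : (0 : R) < m%:R by rewrite ltr0n.
have K0 : 0 <= K by rewrite mulr_ge0 ?exprn_ge0 ?mulr_ge0// ltW.
have sumE : (\sum_(i < m.+1) P [set w | (s < sample_log_volume i w)%R] =
    m.+1%:R%:E * survival X m s)%E.
  under eq_bigr do rewrite log_volume_ccdf//.
  have fin : survival X m s \is a fin_num.
    by rewrite ge0_fin_numE ?survival_ge0// (le_lt_trans (survival_le1 s m0)) ?ltry.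
  by rewrite -[survival X m s]fineK// sumEFin sumr_const card_ord -EFinM mulr_natl.
have sumI : (\sum_(i < m.+1) P [set w | (s < sample_log_volume i w)%R] =
    \int[P]_w (\sum_(i < m.+1) \1_[set w | s < sample_log_volume i w] w)%:E)%E.
  under [RHS]eq_integral do rewrite -sumEFin.
  rewrite ge0_integral_sum//.
    by apply: eq_bigr => i _; rewrite integral_indic ?setIT.
  by move=> i; apply/measurable_EFinP; exact: measurable_indic.
have bound : (\int[P]_w (\sum_(i < m.+1) \1_[set w | s < sample_log_volume i w] w)%:E <=
    (m%:R * K * expR (- s))%:E)%E.
  rewrite -(integral_prob_cst P (m%:R * K * expR (- s))).
  apply: ae_ge0_le_integral => //.
  - by move=> w _; rewrite lee_fin; apply: sumr_ge0 => i _; rewrite indicE.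
  - by apply/measurable_EFinP; apply: measurable_sum => i; exact: measurable_indic.
  - by move=> w _; rewrite lee_fin mulr_ge0 ?expR_ge0// mulr_ge0// ltW.
  move: hM; apply: filterS => w wM _; rewrite lee_fin.
  apply: (@le_trans _ _ (\sum_(i < m.+1) m%:R * (Rn i w ^+ d * v) * expR (- s))).
    apply: ler_sum => i _; rewrite indicE; have R0 : 0 <= Rn i w by exact: nn_dist_ge0.
    have rd0 : 0 <= m%:R * (Rn i w ^+ d * v) by rewrite !mulr_ge0 ?exprn_ge0// ltW.
    case: (boolP (_ \in _)) => [/set_mem/= h|_]; last by rewrite mulr_ge0// expR_ge0.
    move: h; rewrite /sample_log_volume log_volume_gt_ge0// => h.
    rewrite expRN -(nn_radiusX d0 s m0) ler_pdivlMr ?mul1r; last first.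
      by rewrite !mulr_gt0 ?exprn_gt0// nn_radius_gt0.
    rewrite ler_pM2l// ler_pM2r// lerXn2r ?nnegrE// ?ltW// nn_radius_gt0//.
  rewrite -mulr_suml -mulr_sumr ler_wpM2r ?expR_ge0// ler_wpM2l ?(ltW mR)//.
  exact: (sum_nn_volume_le (x := fun j => X j w)).
move: bound; rewrite -sumI sumE => bound.
rewrite -(@lee_pmul2l _ m.+1%:R%:E) ?lte_fin//; apply: (le_trans bound).
by rewrite -EFinM lee_fin -mulrA ler_wpM2r ?ler_nat// mulr_ge0// expR_ge0.
Qed.

(** The density exceeds the threshold [e ^ (- s / 2)], or the union bound of the
    lower tail applies. *)
Lemma survival_lower m s : (0 < m)%N -> s < 0 ->
  (1 - survival X m s <= (expR (s / 2))%:E + mu [set x | (expR (- s / 2) < f x)%R])%E.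
Proof.
move=> m0 s0; rewrite -(log_volume_cdf ord0 s m0).
pose A := [set x | expR (- s / 2) < f x].
pose B := [set w | f (X (@ord0 m) w) <= expR (- s / 2) /\ sample_log_volume (@ord0 m) w <= s].
have mA : measurable A by exact: measurable_gt_set.
have mY : measurable [set w | sample_log_volume (@ord0 m) w <= s].
  by apply: measurable_le_set; exact: measurable_sample_log_volume.
have mXA : measurable (X (@ord0 m) @^-1` A) by exact: preimage_measurable.
have mB : measurable B.
  have mfX : measurable_fun setT (f \o X (@ord0 m)) by exact: measurableT_comp.
  exact: measurableI (measurable_le_set _ mfX) mY.
have hB : (P B <= (expR (s / 2))%:E)%E.
  have s0' : 0 < - s by rewrite oppr_gt0.
  have := log_volume_lower_tail d0 mf f0 f1 hind hX (@ord0 m) m0 s0'.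
  by rewrite [X in expR (- X)]mulNr !opprK.
apply: (@le_trans _ _ (P (B `|` X (@ord0 m) @^-1` A))).
  apply: measure_mono => //; first exact: measurableU.
  move=> w /= h; have [h'|h'] := leP (f (X (@ord0 m) w)) (expR (- s / 2)); last by right.
  by left.
apply: (le_trans (measureU2 _ mB mXA)).
by apply: leeD => //; rewrite (law_eq hX (@ord0 m) mA).
Qed.

Definition clip (L y : R) : R := Num.max (- L) (Num.min y L).

Lemma clip_bounds L y : 0 <= L -> - L <= clip L y <= L.
Proof. by move=> L0; rewrite /clip le_max lexx ge_max ge_min lexx orbT andbT; lra. Qed.

Lemma measurable_clip L : measurable_fun setT (clip L).
Proof. by apply: measurable_maxr => //; exact: measurable_minr. Qed.

Lemma integrable_clip L (Z : T -> R) : 0 <= L -> measurable_fun setT Z ->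
  P.-integrable setT (fun w => (clip L (Z w))%:E).
Proof.
move=> L0 mZ; have mc : measurable_fun setT (fun w => clip L (Z w)).
  exact: (measurableT_comp (measurable_clip L)).
apply/integrableP; split; first exact/measurable_EFinP.
apply: (@le_lt_trans _ _ (\int[P]_w L%:E)%E); last by rewrite integral_prob_cst ltry.
apply: ge0_le_integral => //.
- by apply/measurable_EFinP; apply: measurableT_comp.
- by move=> w _; rewrite lee_fin ler_norml; exact: clip_bounds.
Qed.

(** The tail formula for the mean, for the truncated logarithm. *)
Lemma mean_clip m (i : 'I_m.+1) L : (0 < m)%N -> 0 <= L ->
  (\int[P]_w (clip L (sample_log_volume i w))%:E =
    \int[leb]_(s in `[0%R, +oo[) (if (s < L)%R then survival X m s else 0) -
    \int[leb]_(s in `]-oo, 0%R[) (if (- L <= s)%R then 1 - survival X m s else 0))%E.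
Proof.
move=> m0 L0; pose Z0 w := clip L (sample_log_volume i w).
have mZ : measurable_fun setT Z0.
  exact: (measurableT_comp (measurable_clip L) (measurable_sample_log_volume i)).
pose Z : {RV P >-> R} := HB.pack Z0 (isMeasurableFun.Build _ _ _ _ _ mZ).
have ZL1 : Lfun P 1 Z.
  apply/Lfun1_integrable; apply: integrable_clip => //.
  exact: measurable_sample_log_volume.
have := expectation_cdf_ccdf ZL1; rewrite unlock => ->; congr (_ - _)%E.
  apply: eq_integral => s /set_mem /=; rewrite in_itv/= andbT => s0.
  rewrite /ccdf /distribution /pushforward -(log_volume_ccdf i s m0).
  case: ifPn => sL.
    congr (P _); apply/seteqP; split => w /=;
        rewrite in_itv/= andbT /Z0 /clip lt_max lt_min sL andbT.
      by case/orP => //; lra.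
    by move=> ->; rewrite orbT.
  rewrite -[RHS](measure0 P); congr (P _); apply/seteqP; split => w //=.
  rewrite in_itv/= andbT /Z0 => sZ; have /andP[_ ZL] := clip_bounds (sample_log_volume i w) L0.
  by move: sL; rewrite (lt_le_trans sZ ZL).
apply: eq_integral => s /set_mem /=; rewrite in_itv/= => s0.
rewrite /cdf /distribution /pushforward -(log_volume_cdf i s m0).
case: ifPn => sL.
  congr (P _); apply/seteqP; split => w /=; rewrite in_itv/= /Z0 /clip ge_max sL/= ge_min.
    by case/orP => //; lra.
  by move=> ->.
rewrite -[RHS](measure0 P); congr (P _); apply/seteqP; split => w //=.
rewrite in_itv/= /Z0 => Zs; have /andP[LZ _] := clip_bounds (sample_log_volume i w) L0.
by move: sL; rewrite (le_trans LZ Zs).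
Qed.

End log_volume_law.

(** * The limit of the truncated means *)

Lemma tonelli_on d (S : measurableType d) (R : realType) (mu : probability S R)
    (D : set (measurableTypeR R)) (h : measurableTypeR R * S -> R) :
  measurable D -> measurable_fun setT h -> (forall p, 0 <= h p) ->
  measurable_fun setT (fun x => \int[lebesgue_measure]_(s in D) (h (s, x))%:E)%E /\
  (\int[lebesgue_measure]_(s in D) \int[mu]_x (h (s, x))%:E =
    \int[mu]_x \int[lebesgue_measure]_(s in D) (h (s, x))%:E)%E.
Proof.
move=> mD mh h0; pose k (p : measurableTypeR R * S) : \bar R := (h p * \1_D p.1)%:E.
have mk : measurable_fun setT k.
  apply/measurable_EFinP; apply: measurable_funM => //.
  by apply: (measurableT_comp (measurable_indic mD)).
have k0 p : (0 <= k p)%E by rewrite lee_fin mulr_ge0// indicE.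
have kE x : (\int[lebesgue_measure]_(s in D) (h (s, x))%:E =
    \int[lebesgue_measure]_s k (s, x))%E.
  rewrite integral_mkcond; apply: eq_integral => s _; rewrite patchE /k indicE/=.
  by case: ifP => _; rewrite ?mulr1 ?mulr0.
split.
  rewrite (_ : (fun x => _) = fubini_G lebesgue_measure k).
    exact: measurable_fun_fubini_tonelli_G.
  by apply/funext => x; exact: kE.
rewrite (eq_integral (fun x => \int[lebesgue_measure]_s k (s, x))%E) => [|x _]; last exact: kE.
rewrite -(fubini_tonelli (m1 := lebesgue_measure))//= integral_mkcond; apply: eq_integral => s _.
rewrite patchE; case: ifPn => sD.
  by apply: eq_integral => x _; rewrite /k/= indicE sD mulr1.
by rewrite integral0_eq// => x _; rewrite /k/= indicE (negbTE sD) mulr0.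
Qed.

Section mean_limit.
Context (R : realType) (d : nat).
Hypothesis d0 : (0 < d)%N.
Local Notation E := (d.-tuple (measurableTypeR R)).
Local Notation lam := (lebesgue_tuple R d).
Local Notation v := (unit_ball_volume R d).
Local Notation leb := (@lebesgue_measure R).
Variable f : E -> R.
Hypothesis mf : measurable_fun setT f.
Hypothesis f0 : forall x, 0 <= f x.
Hypothesis f1 : (\int[lam]_x (f x)%:E)%E = 1%E.
Hypothesis flnf : (\int[lam]_x (f x * ln (f x + 1))%:E < +oo)%E.
Context dT (T : measurableType dT) (P : probability T R) (X : nat -> {RV P >-> E}).
Hypothesis hind : mutually_independent X.
Hypothesis hX : forall i A, measurable A ->
  P (X i @^-1` A) = (\int[lam]_(x in A) (f x)%:E)%E.
Variable M : R.
Hypothesis M0 : 0 <= M.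
Hypothesis hM : {ae P, forall w i, eball (evec0 R d) M (X i w)}.

Local Notation mu := (distribution P (X 0%N)).

Let v0 : 0 < v. Proof. exact: unit_ball_volume_gt0. Qed.

Let mEf : measurable_fun setT (EFin \o f). Proof. exact/measurable_EFinP. Qed.

(** Integrable when [f * ln (f + 1)] is; its tail dominates the lower tail of
    the logarithmic volume. *)
Definition log_excess (x : E) : R := Num.max (2 * ln (f x)) 0.

Lemma measurable_log_excess : measurable_fun setT log_excess.
Proof.
apply: measurable_maxr => //; apply: measurable_funM => //.
exact: (measurableT_comp (@measurable_ln R)).
Qed.

Lemma log_excess_ge0 x : 0 <= log_excess x.
Proof. by rewrite /log_excess le_max lexx orbT. Qed.

Lemma mean_log_excess_lty : (\int[mu]_x (log_excess x)%:E < +oo)%E.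
Proof.
have f10 x : 0 <= ln (f x + 1) by rewrite ln_ge0// lerDr.
have mln : measurable_fun setT (fun x => ln (f x + 1)).
  by apply: (measurableT_comp (@measurable_ln R)); exact: measurable_funD.
apply: (@le_lt_trans _ _ (\int[mu]_x (2%:E * (ln (f x + 1))%:E))%E).
  apply: ge0_le_integral => //.
  - by move=> x _; rewrite lee_fin log_excess_ge0.
  - by apply/measurable_EFinP; exact: measurable_log_excess.
  - by apply: emeasurable_funM => //; exact/measurable_EFinP.
  move=> x _; rewrite -EFinM lee_fin ge_max mulr_ge0// andbT ler_wpM2l//.
  have [fx|fx] := ltP 0 (f x); last by rewrite ln0.
  by rewrite ler_ln ?posrE ?lerDl ?ltr_wpDl.
rewrite ge0_integralZl//; last 2 first.
- exact/measurable_EFinP.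
- by move=> x _; rewrite lee_fin.
rewrite lte_mul_pinfty// (ge0_integral_law mf hX); last 2 first.
- exact/measurable_EFinP.
- by move=> x; rewrite lee_fin.
by under eq_integral do rewrite -EFinM mulrC.
Qed.

Let tail (s : R) : \bar R := mu [set x | (expR (- s / 2) < f x)%R].

Let tailE s : s < 0 -> tail s = mu [set x | - s < log_excess x].
Proof.
move=> s0; congr (mu _); apply/seteqP; split => x /=; rewrite /log_excess lt_max.
  move=> h; have fx := lt_trans (expR_gt0 _) h.
  by move: h; rewrite -[X in _ < X]lnK// ltr_expR => h; apply/orP; left; lra.
case/orP; last by lra.
have [fx h|fx] := ltP 0 (f x); last by rewrite ln0//; lra.
by rewrite -[X in _ < X]lnK// ltr_expR; lra.
Qed.

Let excessRV : {RV mu >-> R} :=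
  HB.pack log_excess (isMeasurableFun.Build _ _ _ _ _ measurable_log_excess).

Let tail_ccdf s : s < 0 -> tail s = ccdf excessRV (- s).
Proof.
move=> s0; rewrite tailE//; congr (mu _); apply/seteqP; split => x /=;
  by rewrite in_itv/= andbT.
Qed.

Let integral_tail : (\int[leb]_(s in `]-oo, 0%R[) tail s = \int[mu]_x (log_excess x)%:E)%E.
Proof.
have := @ge0_expectation_ccdf _ _ _ mu excessRV log_excess_ge0.
rewrite unlock => ->; rewrite (@ge0_integration_by_substitution0 R (ccdf excessRV)).
- rewrite -integral_itv_bndo_bndc//=.
  + by apply: eq_integral => s /set_mem /=; rewrite in_itv/= => /tail_ccdf.
  + apply: measurable_funTS.
    by apply: (measurableT_comp (ccdf_measurable excessRV)).
- apply: measurable_funTS; exact: ccdf_measurable.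
- by move=> r; exact: measure_ge0.
Qed.

Let measurable_tail : measurable_fun (`]-oo, 0%R[%classic : set R) tail.
Proof.
apply: (eq_measurable_fun (ccdf excessRV \o -%R)).
  by move=> s /set_mem /=; rewrite in_itv/= => /tail_ccdf.
by apply: measurable_funTS; apply: (measurableT_comp (ccdf_measurable excessRV)).
Qed.

Let upper_dom (s : R) : \bar R := ((6 * M) ^+ d * v * expR (- s))%:E.

Let lower_dom (s : R) : \bar R := ((expR (s / 2))%:E + tail s)%E.

Let integrable_upper_dom : leb.-integrable `[0%R, +oo[ upper_dom.
Proof.
apply/integrableP; split.
  by apply/measurable_EFinP/measurable_funTS; apply: measurable_funM => //; apply: measurableT_comp.
have K0 : 0 <= (6 * M) ^+ d * v by rewrite mulr_ge0 ?exprn_ge0 ?mulr_ge0// ltW.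
rewrite (eq_integral
  (fun s : measurableTypeR R => ((6 * M) ^+ d * v)%:E * (expR (- s))%:E)%E); last first.
  by move=> s _; rewrite -EFinM /= ger0_norm// mulr_ge0// expR_ge0.
rewrite ge0_integralZl ?lee_fin//.
- by rewrite integral_expRN1 mule1 ltry.
- by apply/measurable_EFinP/measurable_funTS; apply: measurableT_comp.
Qed.

Let integrable_lower_dom : leb.-integrable `]-oo, 0%R[ lower_dom.
Proof.
have mh : measurable_fun setT (fun s : R => (expR (s / 2))%:E).
  apply/measurable_EFinP; apply: measurableT_comp => //; exact: measurable_funM.
have half : (\int[leb]_(s in `]-oo, 0%R[) (expR (s / 2))%:E < +oo)%E.
  rewrite (eq_integral (fun s : measurableTypeR R => (expR (2^-1 * s))%:E)) => [|s _].
    by rewrite integral_expR_neg ?ltry ?invr_gt0.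
  by rewrite mulrC.
apply/integrableP; split; first by apply: emeasurable_funD => //; exact: measurable_funTS.
rewrite (eq_integral (lower_dom : measurableTypeR R -> \bar R)) => [|s _]; last first.
  by rewrite gee0_abs// adde_ge0// lee_fin expR_ge0.
rewrite ge0_integralD//.
- by rewrite lte_add_pinfty// integral_tail mean_log_excess_lty.
- exact: measurable_funTS.
Qed.

Let log_volumeRV m : {RV P >-> R} := HB.pack (sample_log_volume X (@ord0 m.+1))
  (isMeasurableFun.Build _ _ _ _ _ (measurable_sample_log_volume X (@ord0 m.+1))).

Let measurable_survival m : measurable_fun setT (fun s : R => survival X m.+1 s).
Proof.
rewrite (_ : (fun _ => _) = ccdf (log_volumeRV m)); first exact: ccdf_measurable.
apply/funext => s; rewrite -(log_volume_ccdf d0 mf hind hX (@ord0 m.+1) s)//.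
by congr (P _); apply/seteqP; split => w /=; rewrite in_itv/= andbT.
Qed.

Let survival_cvgS s : (survival X m.+1 s @[m --> \oo] --> limit_survival f X s)%E.
Proof.
have h := @survival_cvg _ _ d0 _ mf f0 f1 _ _ _ _ hX s.
by rewrite -(cvg_shiftS (fun m => survival X m s)) in h.
Qed.

Let measurable_limit_survival : measurable_fun setT (fun s : R => limit_survival f X s).
Proof.
apply: (emeasurable_fun_cvg (fun m (s : R) => survival X m.+1 s)) => //.
Qed.

Let near_lt (L : nat -> R) (s : R) : (forall j : nat, \forall m \near \oo, j%:R <= L m) ->
  \forall m \near \oo, s < L m.
Proof.
move=> Loo; have := Loo (Num.truncn s).+1; apply: filterS => m; exact: lt_le_trans (truncnS_gt _).
Qed.

Let survival_int_fin m s : survival X m.+1 s \is a fin_num.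
Proof.
rewrite ge0_fin_numE ?survival_ge0//.
exact: le_lt_trans (survival_le1 d0 mf hind hX s (ltn0Sn m)) (ltry _).
Qed.

Let upper_cvg (L : nat -> R) : (forall j : nat, \forall m \near \oo, j%:R <= L m) ->
  leb.-integrable `[0%R, +oo[ (fun s => limit_survival f X s) /\
  (\int[leb]_(s in `[0%R, +oo[) (if (s < L m)%R then survival X m.+1 s else 0) @[m --> \oo] -->
    \int[leb]_(s in `[0%R, +oo[) limit_survival f X s)%E.
Proof.
move=> Loo.
have [] // := @dominated_convergence _ _ _ leb `[0%R, +oo[%classic (measurable_itv _)
  (fun m s => if (s < L m)%R then survival X m.+1 s else 0%E)
  (fun s => limit_survival f X s) upper_dom.
- move=> m; apply: measurable_funTS; apply: measurable_fun_ifT => //.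
    exact: measurable_fun_ltr.
  exact: measurable_survival.
- exact: measurable_funTS.
- apply: aeW => s _.
  apply: (@cvg_trans _ (survival X m.+1 s @[m --> \oo])); last exact: survival_cvgS.
  by apply: near_eq_cvg; apply: filterS (near_lt s Loo) => m ->.
- apply: aeW => s m; rewrite /= in_itv/= andbT => s0.
  have ub := survival_upper d0 mf hind hX M0 hM (ltn0Sn m) s0.
  case: ifP => _; first by rewrite gee0_abs ?survival_ge0.
  by rewrite abse0; apply: le_trans ub; exact: survival_ge0.
Qed.

Let lower_cvg (L : nat -> R) : (forall j : nat, \forall m \near \oo, j%:R <= L m) ->
  leb.-integrable `]-oo, 0%R[ (fun s => 1 - limit_survival f X s)%E /\
  (\int[leb]_(s in `]-oo, 0%R[) (if (- L m <= s)%R then 1 - survival X m.+1 s else 0)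
    @[m --> \oo] --> \int[leb]_(s in `]-oo, 0%R[) (1 - limit_survival f X s))%E.
Proof.
move=> Loo; have sub_ge0 m s : (0 <= 1 - survival X m.+1 s)%E.
  rewrite sube_ge0 ?survival_int_fin//.
  exact: (survival_le1 d0 mf hind hX s (ltn0Sn m)).
have [] // := @dominated_convergence _ _ _ leb `]-oo, 0%R[%classic (measurable_itv _)
  (fun m s => if (- L m <= s)%R then 1 - survival X m.+1 s else 0)%E
  (fun s => 1 - limit_survival f X s)%E lower_dom.
- move=> m; apply: measurable_funTS; apply: measurable_fun_ifT => //.
    exact: measurable_fun_ler.
  apply: emeasurable_funB => //; exact: measurable_survival.
- apply: measurable_funTS; apply: emeasurable_funB => //; exact: measurable_limit_survival.
- apply: aeW => s _.
  have sub_cvg : ((1 - survival X m.+1 s) @[m --> \oo] --> 1 - limit_survival f X s)%E.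
    apply: cvgeB; [|exact: cvg_cst|exact: survival_cvgS].
    by rewrite fin_num_adde_defr.
  apply: (@cvg_trans _ ((1 - survival X m.+1 s)%E @[m --> \oo])); last exact: sub_cvg.
  apply: near_eq_cvg; apply: filterS (near_lt (- s) Loo) => m.
  by rewrite ltrNl => /ltW ->.
- apply: aeW => s m; rewrite /= in_itv/= => s0.
  have lb := survival_lower d0 mf f0 f1 hind hX (ltn0Sn m) s0.
  case: ifP => _; first by rewrite gee0_abs.
  by rewrite abse0; apply: le_trans lb; exact: sub_ge0.
Qed.

Let h (p : measurableTypeR R * E) : R := expR (- (expR p.1 * f p.2)).

Let mh : measurable_fun setT h.
Proof.
apply: measurableT_comp => //; apply: measurableT_comp => //.
apply: measurable_funM; first exact: measurableT_comp.
exact: measurableT_comp.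
Qed.

Let h01 p : 0 <= h p <= 1.
Proof. by rewrite expR_ge0 expR_le1 oppr_le0 mulr_ge0// expR_ge0. Qed.

Let limit_survival_subE s :
  (1 - limit_survival f X s = \int[mu]_x (1 - h (s, x))%:E)%E.
Proof.
have mhs : measurable_fun setT (fun x => h (s, x)).
  by apply: (measurableT_comp mh); exact: pair1_measurable.
have ih : mu.-integrable setT (fun x => (h (s, x))%:E).
  apply/integrableP; split; first exact/measurable_EFinP.
  apply: (@le_lt_trans _ _ (\int[mu]_x 1%:E)%E); last by rewrite integral_prob_cst ltry.
  apply: ge0_le_integral => //.
  - by apply/measurable_EFinP; apply: measurableT_comp.
  - by move=> x _; have /andP[h0 h1] := h01 (s, x); rewrite lee_fin ger0_norm.
rewrite -(integral_prob_cst mu 1) -integralB//; last exact: finite_measure_integrable_cst.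
Qed.

Lemma density_pos_ae : {ae mu, forall x, 0 < f x}.
Proof.
have mA : measurable [set x | f x <= 0] by exact: measurable_le_set.
exists [set x | f x <= 0]; split => //.
  rewrite (law_density hX)// integral0_eq// => x /= fx.
  by apply/eqP; rewrite eqe; apply/eqP/le_anti; rewrite fx f0.
by move=> x /=; rewrite leNgt => /negP.
Qed.

(** By Tonelli both tail integrals are means over [x] of the tail integrals of
    [ln t - ln (f x)], with [t] exponential, whose difference is
    [- C_E - ln (f x)]. *)
Lemma log_density_mean :
  mu.-integrable setT (fun x => (ln (f x))%:E) /\
  (\int[leb]_(s in `[0%R, +oo[) limit_survival f X s -
    \int[leb]_(s in `]-oo, 0%R[) (1 - limit_survival f X s) =
    (- C_E R)%:E + diff_entropy f)%E.
Proof.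
have [mU tonU] := tonelli_on mu (D := `[0%R, +oo[%classic) (measurable_itv _) mh
  (fun p => proj1 (andP (h01 p))).
have mh' : measurable_fun setT (fun p => 1 - h p) by exact: measurable_funB.
have h'0 p : 0 <= 1 - h p by rewrite subr_ge0; case/andP: (h01 p).
have [mV tonV] := tonelli_on mu (D := `]-oo, 0%R[%classic) (measurable_itv _) mh' h'0.
have natoo (j : nat) : \forall m \near \oo, j%:R <= m%:R :> R.
  by near=> m; rewrite ler_nat; near: m; exact: nbhs_infty_ge.
have [iU _] := upper_cvg natoo; have [iV _] := lower_cvg natoo.
have U_ge0 x : (0 <= upper_log_mass (f x))%E.
  by apply: integral_ge0 => s _; rewrite lee_fin expR_ge0.
have V_ge0 x : (0 <= lower_log_mass (f x))%E.
  by apply: integral_ge0 => s _; exact: (h'0 (s, x)).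
have UE : (\int[leb]_(s in `[0%R, +oo[) limit_survival f X s =
    \int[mu]_x upper_log_mass (f x))%E := tonU.
have VE : (\int[leb]_(s in `]-oo, 0%R[) (1 - limit_survival f X s) =
    \int[mu]_x lower_log_mass (f x))%E.
  by rewrite -[RHS]tonV; apply: eq_integral => s _; exact: limit_survival_subE.
have iU' : mu.-integrable setT (fun x => upper_log_mass (f x)).
  apply/integrableP; split; first exact: mU.
  rewrite (eq_integral (fun x => upper_log_mass (f x))) => [|x _]; last exact: gee0_abs.
  by rewrite -ge0_fin_numE ?integral_ge0// -UE; exact: integrable_fin_num.
have iV' : mu.-integrable setT (fun x => lower_log_mass (f x)).
  apply/integrableP; split; first exact: mV.
  rewrite (eq_integral (fun x => lower_log_mass (f x))) => [|x _]; last exact: gee0_abs.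
  by rewrite -ge0_fin_numE ?integral_ge0// -VE; exact: integrable_fin_num.
have UVE : ae_eq mu setT (fun x => upper_log_mass (f x) - lower_log_mass (f x))%E
    (fun x => (- C_E R - ln (f x))%:E).
  by apply: filterS density_pos_ae => x fx _; rewrite log_mass_sub.
have mln : measurable_fun setT (fun x => ln (f x)).
  exact: (measurableT_comp (@measurable_ln R)).
have iW : mu.-integrable setT (fun x => (- C_E R - ln (f x))%:E).
  have /integrableP[mUV] := integrableB measurableT iU' iV'.
  have mW : measurable_fun setT (fun x => (- C_E R - ln (f x))%:E).
    by apply/measurable_EFinP; exact: measurable_funB.
  move=> UVoo; apply/integrableP; split => //; apply: le_lt_trans UVoo.
  rewrite le_eqVlt; apply/orP; left; apply/eqP; apply: ae_eq_integral => //.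
  - exact: measurableT_comp.
  - exact: measurableT_comp.
  - by apply: filterS UVE => x /(_ I) -> _.
have iC : mu.-integrable setT (cst (- C_E R)%:E) by exact: finite_measure_integrable_cst.
have iln : mu.-integrable setT (fun x => (ln (f x))%:E).
  have := integrableB measurableT iC iW; congr (_.-integrable _ _).
  by apply/funext => x /=; rewrite -EFinB; congr EFin; ring.
split => //.
rewrite UE VE -integralB//.
transitivity (\int[mu]_x (- C_E R - ln (f x))%:E)%E.
  apply: ae_eq_integral => //; first exact: emeasurable_funB.
  by apply/measurable_EFinP; exact: measurable_funB.
under eq_integral do rewrite EFinB.
rewrite integralB// integral_prob_cst /diff_entropy; congr (_ - _)%E.
rewrite (integral_density mf f0 (law_density hX))//.
by apply: eq_integral => x _; rewrite mulrC.
Unshelve. all: end_near. Qed.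

Lemma diff_entropy_fin_num : diff_entropy f \is a fin_num.
Proof.
have [iln _] := log_density_mean.
rewrite /diff_entropy fin_numN (eq_integral (fun x => (ln (f x) * f x)%:E)) => [|x _]; last first.
  by rewrite mulrC.
by rewrite -(integral_density mf f0 (law_density hX))//; exact: integrable_fin_num.
Qed.

(** Dominated convergence in the two tail integrals: the packing bound
    dominates the upper one, the union bound the lower one. *)
Lemma mean_clip_cvg (L : nat -> R) : (forall m, 0 <= L m) ->
  (forall j : nat, \forall m \near \oo, j%:R <= L m) ->
  (\int[P]_w (clip (L m) (sample_log_volume X (@ord0 m.+1) w))%:E @[m --> \oo] -->
    (- C_E R)%:E + diff_entropy f)%E.
Proof.
move=> L0 Loo; have [_ <-] := log_density_mean.
have [iU Ucvg] := upper_cvg Loo; have [iV Vcvg] := lower_cvg Loo.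
under eq_fun do rewrite (mean_clip d0 mf hind hX ord0 (ltn0Sn _) (L0 _)).
apply: cvgeB Ucvg Vcvg; rewrite fin_num_adde_defl// fin_numN.
exact: integrable_fin_num.
Qed.

End mean_limit.

(** * The support of a density *)

Section support.
Context (R : realType) (d : nat).
Local Notation E := (d.-tuple (measurableTypeR R)).
Local Notation lam := (lebesgue_tuple R d).
Implicit Types (x y : d.-tuple R) (r : R).

Lemma euclid_dist_le_coord x y (e : R) : 0 <= e ->
  (forall i, `|tnth x i - tnth y i| <= e) -> euclid_dist x y <= d.+1%:R * e.
Proof.
move=> e0 xye; have de0 : 0 <= d.+1%:R * e by rewrite mulr_ge0.
rewrite -[leRHS](ger0_norm de0) -sqrtr_sqr ler_wsqrtr//.
apply: (@le_trans _ _ (\sum_(i < d) e ^+ 2)).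
  by apply: ler_sum => i _; rewrite -real_normK ?num_real// lerXn2r ?nnegrE.
rewrite sumr_const card_ord exprMn -[leLHS]mulr_natl ler_wpM2r ?sqr_ge0//.
by rewrite -natrX ler_nat; nia.
Qed.

Lemma rational_ball x r : 0 < r -> exists (q : d.-tuple rat) (s : rat),
  eball [tuple ratr (tnth q i) | i < d] (ratr s) x /\
  eball [tuple ratr (tnth q i) | i < d] (ratr s) `<=` eball x r.
Proof.
move=> r0; pose e := r / (4 * d.+1%:R).
have e0 : 0 < e by rewrite divr_gt0// mulr_gt0.
have /choice[q qP] (i : 'I_d) : exists a : rat, `|tnth x i - ratr a| <= e.
  have /rat_in_itvoo[a] : tnth x i - e < tnth x i + e by lra.
  by rewrite in_itv/= -ltr_distlC => /ltW; exists a.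
have /rat_in_itvoo[s] : r / 4 < r / 2 by lra.
rewrite in_itv/= => /andP[s1 s2].
exists [tuple q i | i < d], s; set c := [tuple _ | _ < _].
have xc : euclid_dist x c <= r / 4.
  have -> : r / 4 = d.+1%:R * e.
    have : d.+1%:R != 0 :> R by rewrite pnatr_eq0.
    by rewrite /e; move: d.+1%:R => k k0; field.
  apply: euclid_dist_le_coord => [|i]; first exact: ltW.
  by rewrite !tnth_mktuple.
split; first by rewrite /eball/= euclid_distC; lra.
move=> y; rewrite /eball/= => cy.
by have := euclid_dist_triangle c x y; lra.
Qed.

Variable f : E -> R.
Variable mu : {measure set E -> \bar R}.
Hypothesis density : forall A, measurable A -> mu A = (\int[lam]_(x in A) (f x)%:E)%E.

(** Every point off the support lies in a null ball with rational centre and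
    radius, and there are countably many of these. *)
Lemma ae_density_support : {ae mu, forall x, density_support f x}.
Proof.
pose ball (n : nat) : set E := if (choice.unpickle n : option (d.-tuple rat * rat)) is Some (q, s)
  then eball [tuple ratr (tnth q i) | i < d] (ratr s) else set0.
have mball n : measurable (ball n).
  by rewrite /ball; case: choice.unpickle => [[q s]|//]; exact: measurable_eball.
pose null n := if mu (ball n) == 0%E then ball n else set0.
have null0 n : mu.-negligible (null n).
  rewrite /null; case: ifPn => [/eqP h|_]; last exact: negligible_set0.
  by apply/negligibleP.
apply: (negligibleS _ (negligible_bigcup null0)).
move=> x /= /existsNP[r /not_implyP[r0 /negP]]; rewrite -leNgt => xr0.
have [q [s [qx qr]]] := rational_ball x r0.
exists (choice.pickle (q, s)) => //; rewrite /null /ball choice.pickleK.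
rewrite ifT// eq_le measure_ge0 andbT; apply: le_trans xr0.
rewrite -density; last exact: measurable_eball.
by apply: measure_mono => //; exact: measurable_eball.
Qed.

End support.

(** * Almost sure limit of the estimate *)

Section almost_sure_limit.
Context (R : realType) (d : nat).
Hypothesis d0 : (0 < d)%N.
Local Notation E := (d.-tuple (measurableTypeR R)).
Local Notation lam := (lebesgue_tuple R d).
Local Notation v := (unit_ball_volume R d).
Variable f : E -> R.
Hypothesis mf : measurable_fun setT f.
Hypothesis f0 : forall x, 0 <= f x.
Hypothesis f1 : (\int[lam]_x (f x)%:E)%E = 1%E.
Hypothesis flnf : (\int[lam]_x (f x * ln (f x + 1))%:E < +oo)%E.
Context dT (T : measurableType dT) (P : probability T R) (X : nat -> {RV P >-> E}).
Hypothesis hind : mutually_independent X.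
Hypothesis hX : forall i A, measurable A ->
  P (X i @^-1` A) = (\int[lam]_(x in A) (f x)%:E)%E.
Variable M : R.
Hypothesis M0 : 0 <= M.
Hypothesis hM : {ae P, forall w i, eball (evec0 R d) M (X i w)}.

Local Notation mu := (distribution P (X 0%N)).
Local Notation L := (root4 R).

Let v0 : 0 < v. Proof. exact: unit_ball_volume_gt0. Qed.

Definition log_volume_at (x : nat -> E) n (i : 'I_n) : R :=
  log_volume d n.-1 (nn_dist x i (x i)).

Local Notation Y w i := (log_volume_at (X ^~ w) i).

Let Loo (j : nat) : \forall n \near \oo, j%:R <= L n.
Proof.
near=> n; rewrite -(@ler_pXn2r _ 4) ?nnegrE ?root4_ge0// root4X -natrX ler_nat.
by near: n; exact: nbhs_infty_ge.
Unshelve. all: end_near. Qed.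

(** The terms are shifted by [L n] to become nonnegative. *)
Definition clipped_sum n (t : n.-tuple E) : R :=
  \sum_(i < n) (clip (L n) (log_volume_at (nth (evec0 R d) t) i) + L n).

Lemma measurable_clipped_sum n : measurable_fun setT (@clipped_sum n).
Proof.
apply: measurable_sum => i; apply: measurable_funD => //.
apply: (measurableT_comp (measurable_clip _)).
apply: (measurableT_comp (measurable_log_volume d _)).
have eqnth (t : n.-tuple E) (j : 'I_n) : nth (evec0 R d) t j = tnth t j.
  by rewrite (tnth_nth (evec0 R d)).
pose u (j : nat) (t : n.-tuple E) := tnth t (insubd i j).
rewrite (_ : (fun _ => _) = fun t => nn_dist (u ^~ t) i (u i t)).
  by apply: measurable_nn_dist => j; exact: measurable_tnth.
apply/funext => t; rewrite eqnth /u valKd; apply: eq_nn_dist => j ji.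
by rewrite eqnth valKd.
Qed.

Lemma clipped_sum_bounds n (t : n.-tuple E) : 0 <= clipped_sum t <= n%:R * (2 * L n).
Proof.
have h (i : 'I_n) := clip_bounds (log_volume_at (nth (evec0 R d) t) i) (root4_ge0 R n).
apply/andP; split.
  by apply: sumr_ge0 => i _; have /andP[] := h i; lra.
rewrite mulr_natl -[X in _ *+ X]card_ord -sumr_const ler_sum// => i _.
by have /andP[] := h i; lra.
Qed.

Lemma clipped_sum_bounded_differences n : (1 < n)%N ->
  bounded_differences (@clipped_sum n) (2 * (2 * kissing_bound d + 1)%:R * L n).
Proof.
move=> n1 i t t' tt'; rewrite /clipped_sum !big_split/= opprD addrACA subrr addr0.
rewrite [leRHS]mulrAC.
apply: (nn_sum_bounded_difference (c := fun r => clip (L n) (log_volume d n.-1 r)) (j0 := i)) => //.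
  by move=> j ji; rewrite -!tnth_nth; exact: tt'.
by move=> r; rewrite ler_norml; exact: clip_bounds (root4_ge0 R n).
Qed.

(* The mean makes sense for two points at least. *)
Let meanY n : \bar R := if n is k.+2 then
  (\int[P]_w (clip (L n) (sample_log_volume X (@ord0 k.+1) w))%:E)%E else 0%E.

Let meanY_cvg : (meanY n @[n --> \oo] --> (- C_E R)%:E + diff_entropy f)%E.
Proof.
rewrite -cvg_shiftS -cvg_shiftS.
apply: (mean_clip_cvg d0 mf f0 f1 flnf hind hX M0 hM (L := fun k => L k.+2)).
  by move=> k; exact: root4_ge0.
move=> j; have [N _ LN] := Loo j; exists N => // k /= Nk.
by apply: LN => /=; exact: leq_trans Nk (leqW (leqnSn k)).
Qed.

Let meanY_fin n : meanY n \is a fin_num.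
Proof.
case: n => [|[|k]] //=; apply: integrable_fin_num => //.
apply: integrable_clip; first exact: root4_ge0.
exact: measurable_sample_log_volume.
Qed.

Let clipped_sum_sample n w :
  clipped_sum (sample X id n w) = \sum_(i < n) (clip (L n) (Y w i) + L n).
Proof.
have nthE (j : 'I_n) : nth (evec0 R d) (sample X id n w) j = X j w.
  by rewrite -tnth_nth tnth_mktuple.
apply: eq_bigr => i _; rewrite /log_volume_at nthE; congr (clip _ (log_volume _ _ _) + _).
by apply: eq_nn_dist => j _; exact: nthE.
Qed.

Let mean_clipped_sum n : (2 <= n)%N ->
  (\int[sample_law X n]_t (clipped_sum t)%:E = (n%:R * (fine (meanY n) + L n))%:E)%E.
Proof.
case: n => [|[|k]] // _; set n := k.+2.
rewrite -(ge0_integral_sample hind (law_eq hX) (s := id))//; last 2 first.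
- by apply/measurable_EFinP; exact: measurable_clipped_sum.
- by move=> t; rewrite lee_fin; have /andP[] := clipped_sum_bounds t.
under eq_integral do rewrite clipped_sum_sample -sumEFin.
have mYi (i : 'I_n) : measurable_fun setT (fun w => clip (L n) (Y w i)).
  exact: (measurableT_comp (measurable_clip _) (measurable_sample_log_volume X (m := k.+1) i)).
have Yi (i : 'I_n) w := clip_bounds (Y w i) (root4_ge0 R n).
rewrite ge0_integral_sum//; last 2 first.
- by move=> i; apply/measurable_EFinP; exact: measurable_funD.
- by move=> i w _; rewrite lee_fin; have /andP[] := Yi i w; lra.
rewrite (eq_bigr (fun=> (fine (meanY n) + L n)%:E)) => [|i _].
  by rewrite sumEFin sumr_const card_ord mulr_natl.
under eq_integral do rewrite EFinD.
rewrite integralD//; last 2 first.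
- apply: integrable_clip; first exact: root4_ge0.
  exact: (measurable_sample_log_volume X (m := k.+1) i).
- exact: finite_measure_integrable_cst.
rewrite [X in (_ + X)%E]integral_prob_cst.
rewrite [RHS]EFinD.
congr (_ + _)%E.
rewrite (fineK (meanY_fin n)).
transitivity (\int[P]_w (clip (L n) (sample_log_volume X (i : 'I_k.+2) w))%:E)%E; first by [].
have meanE := mean_clip d0 mf hind hX _ (ltn0Sn k) (root4_ge0 R n).
rewrite [LHS]meanE.
by rewrite [RHS]meanE.
Qed.

(** The truncated average is insensitive to a change of one point, and its mean
    converges. *)
Lemma ae_clip_average : {ae P, forall w,
  n%:R^-1 * \sum_(i < n) clip (L n) (Y w i) @[n --> \oo] -->
    - C_E R + fine (diff_entropy f)}.
Proof.
have C0 : 0 < 2 * (2 * kissing_bound d + 1)%:R :> R by rewrite mulr_gt0// ltr0n addn1.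
have := ae_concentration hind (law_eq hX) (n0 := 2) isT
  (fun n _ => @measurable_clipped_sum n) (fun n _ t => clipped_sum_bounds t)
  (fun n n1 => clipped_sum_bounded_differences n1) mean_clipped_sum C0.
apply: filterS => w dev.
have fmean : fine (meanY n) @[n --> \oo] --> - C_E R + fine (diff_entropy f).
  have Hfin : diff_entropy f \is a fin_num.
    exact: (diff_entropy_fin_num d0 mf f0 f1 flnf hind hX M0 hM).
  by have := meanY_cvg; rewrite -[X in (_ + X)%E](fineK Hfin) -EFinD => /fine_cvg.
rewrite -[X in _ --> X]add0r; apply: cvg_trans (cvgD dev fmean).
apply: near_eq_cvg; near=> n.
have n0 : (0 < n)%N by near: n; exact: nbhs_infty_gt.
rewrite fctE clipped_sum_sample big_split/= sumr_const card_ord -[L n *+ n]mulr_natl.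
have : n%:R != 0 :> R by rewrite pnatr_eq0 -lt0n.
move: n%:R (\sum_(_ < _) _) => a b a0.
by field.
Unshelve. all: end_near. Qed.

Lemma ln_excess (z l : R) : 0 <= z -> 0 <= l -> Num.max (ln z - l) 0 <= z * expR (- l).
Proof.
move=> z0 l0; rewrite ge_max [0 <= _]mulr_ge0 ?expR_ge0// andbT.
move: z0; rewrite le_eqVlt => /predU1P[<-|z0]; first by rewrite ln0// mul0r; lra.
have zl : 0 < z * expR (- l) by rewrite mulr_gt0// expR_gt0.
have -> : ln z - l = ln (z * expR (- l)) by rewrite lnM ?posrE ?expR_gt0// expRK.
exact/ltW/ln_sublinear.
Qed.

(** The packing bound on the volumes of the nearest neighbour balls. *)
Lemma upper_excess_le (x : nat -> E) n : (1 < n)%N ->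
  (forall i, eball (evec0 R d) M (x i)) ->
  n%:R^-1 * \sum_(i < n) Num.max (log_volume_at x i - L n) 0 <=
    (6 * M) ^+ d * v * expR (- L n).
Proof.
move=> n1 xM; have n0 : (0 : R) < n%:R by rewrite ltr0n (ltn_trans _ n1).
rewrite ler_pdivrMl//.
apply: (@le_trans _ _ (\sum_(i < n) n%:R * (nn_dist x i (x i) ^+ d * v) * expR (- L n))).
  apply: ler_sum => i _; have R0 := nn_dist_ge0 x i (x i) n1.
  have Rd0 : 0 <= nn_dist x i (x i) ^+ d by rewrite exprn_ge0.
  apply: le_trans (ln_excess _ (root4_ge0 R n)) _; first by rewrite !mulr_ge0// ltW.
  rewrite ler_wpM2r ?expR_ge0// -mulrA ler_wpM2r ?ler_nat ?leq_pred//.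
  by rewrite mulr_ge0// ltW.
rewrite -mulr_suml -mulr_sumr mulrA ler_wpM2r ?expR_ge0// ler_wpM2l//.
exact: sum_nn_volume_le.
Qed.

(** The point [X i] has a neighbour much closer than [f (X i)] accounts for. *)
Definition unlikely_close (n : nat) (i : 'I_n) (k : nat) : set T :=
  [set w | f (X i w) <= expR ((L n + k%:R) / 2) /\ Y w i <= - (L n + k%:R)].

Let measurable_unlikely_close m (i : 'I_m.+1) k : measurable (unlikely_close i k).
Proof.
have mfX : measurable_fun setT (f \o X i) by exact: measurableT_comp.
have mY := measurable_sample_log_volume X i.
exact: measurableI (measurable_le_set _ mfX) (measurable_le_set _ mY).
Qed.

Let q := expR (- (1 / 2)) : R.

Let q01 : 0 < q < 1.
Proof. by rewrite expR_gt0 expR_lt1; lra. Qed.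

Let unlikely_close_probability m (i : 'I_m.+2) k :
  (P (unlikely_close i k) <= (expR (- (1 / 2 * L m.+2)) * q ^+ k)%:E)%E.
Proof.
have s0 : 0 < L m.+2 + k%:R.
  by rewrite (lt_le_trans ltr01)// (le_trans (root4_ge1 R (ltn0Sn m.+1)))// lerDl.
apply: le_trans (log_volume_lower_tail d0 mf f0 f1 hind hX i (ltn0Sn m) s0) _.
rewrite lee_fin /q -expRM_natl -expRD le_eqVlt; apply/orP; left; apply/eqP.
by congr expR; lra.
Qed.

Let unlikely_close_union m (i : 'I_m.+2) :
  (P (\bigcup_k unlikely_close i k) <= (expR (- (1 / 2 * L m.+2)) / (1 - q))%:E)%E.
Proof.
have /andP[q0 q1] := q01; set a := expR _; have a0 : 0 < a by exact: expR_gt0.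
have q'0 : 0 < 1 - q by rewrite subr_gt0.
have mU : measurable (\bigcup_k unlikely_close i k) by exact: bigcupT_measurable.
apply: (le_trans (generalized_Boole_inequality P (measurable_unlikely_close i) mU)).
apply: lime_le; first by apply: is_cvg_nneseries => k _ _; exact: measure_ge0.
apply: nearW => N; apply: (@le_trans _ _ (a * (1 - q ^+ N) / (1 - q))%:E); last first.
  by rewrite lee_fin ler_pM2r ?invr_gt0// ler_piMr ?(ltW a0)// gerBl exprn_ge0// ltW.
elim: N => [|N IH]; first by rewrite big_geq// subrr mulr0 mul0r.
rewrite big_nat_recr//= (le_trans (leeD IH (unlikely_close_probability i N)))//.
rewrite -EFinD lee_fin le_eqVlt; apply/orP; left; apply/eqP.
have : 1 - q != 0 by rewrite gt_eqF.
by rewrite exprS -/a; move: (q ^+ N) => ? ?; field.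
Qed.

(** The union bound over the points and over the integer steps [k]. *)
Lemma ae_finally_not_close : {ae P, forall w, \forall n \near \oo,
  ~ exists (i : 'I_n) k, unlikely_close i k w}.
Proof.
have /andP[q0 q1] := q01; have q'0 : 0 < 1 - q by rewrite subr_gt0.
have [C C0 HC] := @root4_rate R (1 / 2) ltac:(lra).
apply: (@ae_finally_not _ _ _ P (fun n => [set w | exists (i : 'I_n) k, unlikely_close i k w])
  (C / (1 - q)) 2); first by rewrite divr_ge0// ltW.
  move=> [|[|m]]// _; rewrite (_ : mkset _ =
      \bigcup_(i : 'I_m.+2) \bigcup_k unlikely_close i k); last first.
    by apply/seteqP; split => w /= => [[i [k h]]|[i _ [k _ h]]]; exists i => //; exists k.
  apply: fin_bigcup_measurable => // i _; apply: bigcupT_measurable => k.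
  exact: measurable_unlikely_close.
move=> [|[|m]]// _; set n := m.+2.
pose B (i : nat) := \bigcup_k @unlikely_close n (inord i) k.
have mB i : measurable (B i).
  by apply: bigcupT_measurable => k; exact: measurable_unlikely_close.
rewrite (_ : mkset _ = \big[setU/set0]_(i < n) B i); last first.
  rewrite -bigcup_mkord; apply/seteqP; split => w /=.
    by move=> [i [k h]]; exists i => //=; exists k => //; rewrite inord_val.
  by move=> [i _ [k _ h]]; exists (inord i), k.
apply: (le_trans (Boole_inequality P (fun i _ => mB i))).
apply: (@le_trans _ _ (\sum_(i < n) (expR (- (1 / 2 * L n)) / (1 - q))%:E)%E).
  by apply: lee_sum => i _; exact: unlikely_close_union.
rewrite sumEFin sumr_const card_ord lee_fin -[leLHS]mulr_natl mulrA [leRHS]mulrAC.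
by rewrite ler_pM2r ?invr_gt0//; exact: HC.
Qed.

(** Rounding [- Y - L] down to an integer costs the extra unit. *)
Lemma lower_excess_le n w (i : 'I_n) : ~ (exists (i : 'I_n) k, unlikely_close i k w) ->
  Num.max (- Y w i - L n) 0 <= Num.max (log_excess f (X i w) - (L n - 1)) 0.
Proof.
move=> hw; rewrite ge_max le_max [X in _ && X]le_max lexx orbT andbT.
have [h|h] := leP (- Y w i - L n) 0; first by rewrite orbT.
rewrite orbF; have h' := ltW h; have /andP[t1 t2] := truncn_itv h'.
set k := Num.truncn _ in t1 t2.
have fk : expR ((L n + k%:R) / 2) < f (X i w).
  rewrite ltNge; apply/negP => fk; apply: hw; exists i, k; split => //.
  by move: t1; lra.
have fpos := lt_trans (expR_gt0 _) fk.
move: fk; rewrite -[X in _ < X]lnK// ltr_expR => fk.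
have : 2 * ln (f (X i w)) <= log_excess f (X i w) by rewrite /log_excess le_max lexx.
by move: t2; rewrite -natr1; lra.
Qed.

Let expRN_root4_cvg0 : expR (- L n) @[n --> \oo] --> (0 : R).
Proof.
apply/cvgr0Pnorm_lt => e e0; have := Loo (Num.truncn e^-1).+1; apply: filterS => n Ln.
have eL : e^-1 < L n by exact: lt_le_trans (truncnS_gt _) Ln.
rewrite ger0_norm ?expR_ge0// expRN invf_plt ?posrE ?expR_gt0//.
by have := expR_ge1Dx (L n); lra.
Qed.

(** Each term is its truncation, plus the upper excess, minus the lower
    excess. *)
Lemma ae_KL_estimate_cvg : {ae P, forall w,
  (KL_estimate (X ^~ w) n)%:E @[n --> \oo] --> diff_entropy f}.
Proof.
have Woo := mean_log_excess_lty mf f0 flnf hX.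
have L1oo (j : nat) : \forall n \near \oo, j%:R <= L n - 1.
  by have := Loo j.+1; apply: filterS => n; rewrite -natr1; lra.
have aeW := ae_excess_average hind (law_eq hX) (measurable_log_excess mf)
  (log_excess_ge0 f) Woo L1oo.
move: ae_clip_average aeW; apply: filter_app2; move: hM ae_finally_not_close; apply: filterS2.
move=> w wM closew clipw excessw.
have upper0 : n%:R^-1 * \sum_(i < n) Num.max (Y w i - L n) 0 @[n --> \oo] --> (0 : R).
  apply: (@squeeze_cvgr _ _ _ _ (cst 0) (fun n => (6 * M) ^+ d * v * expR (- L n))).
  - near=> n; apply/andP; split.
      by rewrite mulr_ge0// sumr_ge0// => i _; rewrite le_max lexx orbT.
    by apply: upper_excess_le => //; near: n; exact: nbhs_infty_gt.
  - exact: cvg_cst.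
  - rewrite -[X in _ --> X](mulr0 ((6 * M) ^+ d * v)).
    by apply: cvgM => //; exact: cvg_cst.
have lower0 : n%:R^-1 * \sum_(i < n) Num.max (- Y w i - L n) 0 @[n --> \oo] --> (0 : R).
  apply: (@squeeze_cvgr _ _ _ _ (cst 0)
    (fun n => n%:R^-1 * \sum_(i < n) Num.max (log_excess f (X i w) - (L n - 1)) 0)) => //.
  - near=> n; apply/andP; split.
      by rewrite mulr_ge0// sumr_ge0// => i _; rewrite le_max lexx orbT.
    rewrite ler_wpM2l// ler_sum// => i _; apply: lower_excess_le.
    by near: n.
  - exact: cvg_cst.
have Hfin : diff_entropy f \is a fin_num.
  exact: (diff_entropy_fin_num d0 mf f0 f1 flnf hind hX M0 hM).
rewrite -(fineK Hfin); apply/cvg_EFin; first by near=> n.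
have -> : fine (diff_entropy f) = - C_E R + fine (diff_entropy f) + 0 - 0 + C_E R by ring.
apply: cvg_trans (cvgD (cvgB (cvgD clipw upper0) lower0) (cvg_cst (C_E R))).
apply: near_eq_cvg; near=> n; rewrite fctE/=.
have n1 : (1 < n)%N by near: n; exact: nbhs_infty_gt.
rewrite /KL_estimate; congr (_ + _); rewrite !fctE -mulrDr -mulrBr -big_split/= -sumrB.
congr (_ * _); apply: eq_bigr => i _.
have -> : n%:R - 1 = n.-1%:R :> R by rewrite -subn1 natrB// ltnW.
rewrite -/(log_volume d n.-1 _) -/(log_volume_at (X ^~ w) i) /clip.
have := root4_ge0 R n; move: (L n) (Y w i) => l y l0.
by rewrite /Num.max /Num.min; case: (ltP y l) => ?; do ?case: ltP => ?; lra.
Unshelve. all: end_near. Qed.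

End almost_sure_limit.

Theorem theorem1 (R : realType) (d : nat) (hd : (0 < d)%N)
    (f : d.-tuple R -> R) (hf : is_density f)
    (dT : measure_display) (T : measurableType dT) (P : probability T R)
    (X : nat -> {RV P >-> d.-tuple R})
    (hX : forall i, has_density (X i) f)
    (hind : mutually_independent X)
    (hsupp : ebounded (density_support f))
    (hint : (\int[lebesgue_tuple R d]_x (f x * ln (f x + 1))%:E < +oo)%E) :
  {ae P, forall w,
    (KL_estimate (fun i => X i w) n)%:E @[n --> \oo] --> diff_entropy f}.
Proof.
have [mf f0 f1] := hf; have [M0 suppM0] := hsupp.
(* The Borel sets of R belong to two structures, of which Lebesgue measure uses
   one and the sample the other. *)
have mX i : measurable_fun setT (X i : T -> d.-tuple (measurableTypeR R)).
  exact: (measurable_funPT (X i)).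
pose X' i : {RV P >-> d.-tuple (measurableTypeR R)} :=
  HB.pack (X i : T -> d.-tuple (measurableTypeR R)) (isMeasurableFun.Build _ _ _ _ _ (mX i)).
pose M := Num.max M0 0; have M_ge0 : 0 <= M by rewrite le_max lexx orbT.
have suppM : density_support f `<=` eball (evec0 R d) M.
  by move=> x /suppM0 /= h; apply: le_trans h _; rewrite le_max lexx.
have boundX : {ae P, forall w i, eball (evec0 R d) M (X i w)}.
  apply/ae_foralln => i.
  have [N [mN N0 outN]] := ae_density_support (mu := distribution P (X' i)) (hX i).
  exists (X' i @^-1` N); split => //; first exact: preimage_measurable.
  by move=> w /= nw; apply: outN => /= sw; apply: nw; exact: suppM.
have hX' i (A : set (d.-tuple (measurableTypeR R))) : measurable A ->
    P (X' i @^-1` A) = (\int[lebesgue_tuple R d]_(x in A) (f x)%:E)%E.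
  by move=> mA; exact: (hX i A mA).
have mf' : measurable_fun setT (f : d.-tuple (measurableTypeR R) -> R).
  exact: mf.
have hind' : mutually_independent X'.
  by move=> J A mA; exact: (hind J A mA).
have concl := ae_KL_estimate_cvg hd mf' f0 f1 hint hind' hX' M_ge0 boundX.
exact: concl.
Qed.
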